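(* For the two-dimensional isentropic MHD system below, let $(U_l,U_r,\sigma_2)$ be a 2-shock wave with either $B_l>B_r>0$ or $B_l<B_r<0$. Then there is no weight $a>0$ such that $(U_l,U_r,\sigma_2)$ satisfies $a$-contraction. Likewise, if $(\tilde U_l,\tilde U_r,\sigma_3)$ is a 3-shock wave with either $\tilde B_r>\tilde B_l>0$ or $\tilde B_r<\tilde B_l<0$, there is no $a>0$ such that it satisfies $a$-contraction.
   Context: The system (Lagrangian coordinates) is $\partial_t v-\partial_x u=0$, $\partial_t(vB)-\beta\partial_x w=0$, $\partial_t u+\partial_x(p(v)+\tfrac12B^2)=0$, $\partial_t w-\beta\partial_x B=0$, with $\beta$ a fixed nonzero real constant, $p(v)=v^{-\gamma}$, $\gamma>1$, $v>0$. Conservative variables $U=(v,q,u,w)$ with $q=vB$; entropy $\eta(U)=\int_v^\infty p(s)\,ds+\tfrac12(u^2+w^2)+\frac{q^2}{2v}$, with entropy flux $Q$ satisfying $\nabla Q=\nabla\eta\,\nabla F$ where $F$ is the flux; states with $B\neq0$ are considered. With $c=\sqrt{-p'(v)}$ and $\alpha_\pm=\tfrac12\Big[\frac{B^2+\beta^2}{v}+c^2\pm\sqrt{(\frac{B^2+\beta^2}{v}+c^2)^2-4\beta^2\frac{c^2}{v}}\Big]$, the characteristic speeds are $\lambda_1=-\sqrt{\alpha_+}<\lambda_2=-\sqrt{\alpha_-}<\lambda_3=\sqrt{\alpha_-}<\lambda_4=\sqrt{\alpha_+}$. A $k$-shock wave $(U_l,U_r,\sigma)$ is an entropic (Lax)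 Rankine–Hugoniot discontinuity of the $k$-th characteristic family: $F(U_r)-F(U_l)=\sigma(U_r-U_l)$, $Q(U_r)-Q(U_l)\le\sigma(\eta(U_r)-\eta(U_l))$, with $U_r$ on the $k$-shock curve from $U_l$. Relative entropy $\eta(U|V)=\eta(U)-\eta(V)-\nabla\eta(V)\cdot(U-V)$. a-contraction: with $E_a(U(t),h)=\int_{-\infty}^h\eta(U(t,x)|U_l)dx+a\int_h^\infty\eta(U(t,x)|U_r)dx$ and $S(x)=U_l$ ($x<0$), $U_r$ ($x>0$), the discontinuity satisfies $a$-contraction if for every bounded convex set $\mathcal U_K$ of states there is $C_K$ such that for every entropy weak solution $U\in\mathcal U_K\cap BV_{loc}((0,T)\times\mathbb R)^4$ (i.e. weak solution with $\partial_t\eta(U)+\partial_xQ(U)\le0$) with initial datum $U_0$, $E_a(U_0,0)<\infty$, there is a Lipschitz $h$, $h(0)=0$, with $E_a(U(t),h(t))\le E_a(U(s),h(s))$ for a.e. $t>s>0$, $|h'(t)|\le C_K$ and $|h(t)-\sigma t|\le C_K\sqrt t\|U_0-S\|_{L^2}$. *)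

(* Defs.v *)
From HB Require Import structures.
From mathcomp Require Import all_boot all_order all_algebra.
From mathcomp Require Import all_classical all_reals all_analysis.
Import Order.TTheory GRing.Theory Num.Theory.
Import numFieldNormedType.Exports.
Set Implicit Arguments. Unset Strict Implicit. Unset Printing Implicit Defensive.
Local Open Scope classical_set_scope.
Local Open Scope ring_scope.

(* States U = (v, q, u, w) in R^4, q = v B. *)
Notation state R := 'rV[R]_4.

Definition mkstate {R : realType} (v q u w : R) : state R :=
  \row_(i < 4) [:: v; q; u; w]`_i.
Definition st_v {R : realType} (U : state R) : R := U ord0 (inord 0).
Definition st_q {R : realType} (U : state R) : R := U ord0 (inord 1).
Definition st_u {R : realType} (U : state R) : R := U ord0 (inord 2).
Definition st_w {R : realType} (U : state R) : R := U ord0 (inord 3).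
Definition st_B {R : realType} (U : state R) : R := st_q U / st_v U.

Definition pressure {R : realType} (gamma v : R) : R := v `^ (- gamma).
Definition sound {R : realType} (gamma v : R) : R :=
  Num.sqrt (- (derive1 (pressure gamma)) v).

Definition alpha {R : realType} (beta gamma : R) (pm : bool) (U : state R) : R :=
  let v := st_v U in let B := st_B U in let c := sound gamma v in
  let A := (B ^+ 2 + beta ^+ 2) / v + c ^+ 2 in
  let D := Num.sqrt (A ^+ 2 - 4 * beta ^+ 2 * (c ^+ 2 / v)) in
  (if pm then A + D else A - D) / 2.

(* characteristic speeds lambda_1 < ... < lambda_4 (k = 1..4) *)
Definition lambda {R : realType} (beta gamma : R) (k : nat) (U : state R) : R :=
  match k with
  | 1 => - Num.sqrt (alpha beta gamma true U)
  | 2 => - Num.sqrt (alpha beta gamma false U)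
  | 3 => Num.sqrt (alpha beta gamma false U)
  | _ => Num.sqrt (alpha beta gamma true U)
  end.

Definition flux {R : realType} (beta gamma : R) (U : state R) : state R :=
  mkstate (- st_u U) (- (beta * st_w U))
          (pressure gamma (st_v U) + st_B U ^+ 2 / 2) (- (beta * st_B U)).

(* entropy eta(U) = int_v^oo p(s) ds + (u^2+w^2)/2 + q^2/(2v);
   int_v^oo s^(-gamma) ds = v^(1-gamma)/(gamma-1) for gamma > 1, v > 0 *)
Definition eta {R : realType} (gamma : R) (U : state R) : R :=
  (st_v U) `^ (1 - gamma) / (gamma - 1)
  + (st_u U ^+ 2 + st_w U ^+ 2) / 2 + st_q U ^+ 2 / (2 * st_v U).

(* entropy flux Q(U) = (p(v) + B^2/2) u - beta B w  (satisfies grad Q = grad eta . grad F) *)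
Definition Qflux {R : realType} (beta gamma : R) (U : state R) : R :=
  (pressure gamma (st_v U) + st_B U ^+ 2 / 2) * st_u U - beta * st_B U * st_w U.

(* relative entropy eta(U|V) = eta(U) - eta(V) - grad eta(V).(U - V),
   the last term being the directional derivative of eta at V along U - V *)
Definition rel_entropy {R : realType} (gamma : R) (U V : state R) : R :=
  eta gamma U - eta gamma V - derive (eta gamma) V (U - V).

Definition admissible {R : realType} (U : state R) : Prop := 0 < st_v U.

Definition shock_wave {R : realType} (beta gamma : R) (k : nat)
    (Ul Ur : state R) (sigma : R) : Prop :=
  [/\ admissible Ul /\ admissible Ur, Ul != Ur,
      flux beta gamma Ur - flux beta gamma Ul = sigma *: (Ur - Ul),
      Qflux beta gamma Ur - Qflux beta gamma Ul
        <= sigma * (eta gamma Ur - eta gamma Ul)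
    & [/\ (1 <= k <= 4)%N,
          lambda beta gamma k Ur < sigma < lambda beta gamma k Ul,
          (1 < k)%N -> lambda beta gamma k.-1 Ul < sigma
        & (k < 4)%N -> sigma < lambda beta gamma k.+1 Ur]].

Definition Rint {R : realType} (D : set R) (f : R -> R) : R :=
  Rintegral (@lebesgue_measure R) D f.

Definition dint {R : realType} (T : R) (g : R -> R -> R) : R :=
  Rint `]0, T[ (fun t => Rint setT (fun x => g t x)).

Definition C1_supp {R : realType} (phi phit phix : R -> R -> R)
    (t1 t2 x1 x2 : R) : Prop :=
  [/\ forall t x : R, is_derive t (1 : R) (fun s => phi s x) (phit t x),
      forall t x : R, is_derive x (1 : R) (phi t) (phix t x),
      continuous (fun z : R * R => phit z.1 z.2),
      continuous (fun z : R * R => phix z.1 z.2)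
    & forall t x, ~ (t1 <= t <= t2 /\ x1 <= x <= x2) -> phi t x = 0].

(* test functions with compact support in [0,T) x R *)
Definition test_init {R : realType} (T : R) (phi phit phix : R -> R -> R) :=
  exists t1 t2 x1 x2, t2 < T /\ C1_supp phi phit phix t1 t2 x1 x2.

Definition test_open {R : realType} (T : R) (phi phit phix : R -> R -> R) :=
  exists t1 t2 x1 x2, 0 < t1 /\ t2 < T /\ C1_supp phi phit phix t1 t2 x1 x2.

Definition entropy_weak_solution {R : realType} (beta gamma T : R)
    (U : R -> R -> state R) (U0 : R -> state R) : Prop :=
  [/\ forall i : 'I_4, measurable_fun setT (fun z : R * R => U z.1 z.2 ord0 i),
      forall i : 'I_4, measurable_fun setT (fun x : R => U0 x ord0 i),
      forall phi phit phix, test_init T phi phit phix -> forall i : 'I_4,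
        dint T (fun t x => U t x ord0 i * phit t x
                           + flux beta gamma (U t x) ord0 i * phix t x)
        + Rint setT (fun x => U0 x ord0 i * phi 0 x) = 0
    & (* entropy inequality d_t eta(U) + d_x Q(U) <= 0 in D'((0,T) x R) *)
      forall phi phit phix, test_open T phi phit phix ->
        (forall t x, 0 <= phi t x) ->
        0 <= dint T (fun t x => eta gamma (U t x) * phit t x
                                + Qflux beta gamma (U t x) * phix t x)].

Definition BV_loc {R : realType} (T : R) (U : R -> R -> state R) : Prop :=
  forall i : 'I_4, forall t1 t2 x1 x2, 0 < t1 -> t2 < T ->
    exists M : R, forall phi1 phi1t phi1x phi2 phi2t phi2x,
      C1_supp phi1 phi1t phi1x t1 t2 x1 x2 ->
      C1_supp phi2 phi2t phi2x t1 t2 x1 x2 ->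
      (forall t x, phi1 t x ^+ 2 + phi2 t x ^+ 2 <= 1) ->
      `| dint T (fun t x => U t x ord0 i * (phi1t t x + phi2x t x)) | <= M.

Definition E_a {R : realType} (gamma a : R) (Ul Ur : state R)
    (W : R -> state R) (h : R) : \bar R :=
  (\int[@lebesgue_measure R]_(x in `]-oo, h[) (rel_entropy gamma (W x) Ul)%:E
   + a%:E * \int[@lebesgue_measure R]_(x in `]h, +oo[) (rel_entropy gamma (W x) Ur)%:E)%E.

Definition shock_profile {R : realType} (Ul Ur : state R) (x : R) : state R :=
  if x < 0 then Ul else Ur.

Definition L2sq {R : realType} (Ul Ur : state R) (U0 : R -> state R) : \bar R :=
  (\int[@lebesgue_measure R]_(x in setT)
     (\sum_(i < 4) (U0 x ord0 i - shock_profile Ul Ur x ord0 i) ^+ 2)%:E)%E.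

Definition convex_states {R : realType} (K : set (state R)) : Prop :=
  forall x y (l : R), K x -> K y -> 0 <= l <= 1 -> K (l *: x + (1 - l) *: y).

Definition a_contraction {R : realType} (beta gamma : R) (Ul Ur : state R)
    (sigma a : R) : Prop :=
  forall K : set (state R),
    K `<=` [set V | admissible V] -> bounded_set K -> convex_states K ->
    exists CK : R, forall T : R, 0 < T ->
    forall (U : R -> R -> state R) (U0 : R -> state R),
      entropy_weak_solution beta gamma T U U0 ->
      (forall t x, 0 < t < T -> K (U t x)) ->
      BV_loc T U ->
      (E_a gamma a Ul Ur U0 0 < +oo)%E ->
      exists h : R -> R,
        [/\ h 0 = 0,
            forall s t, 0 <= s < T -> 0 <= t < T -> `|h t - h s| <= CK * `|t - s|,
            exists N : set R, [/\ measurable N, (@lebesgue_measure R) N = 0%E &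
              forall s t, 0 < s -> s < t -> t < T -> ~ N s -> ~ N t ->
                (E_a gamma a Ul Ur (U t) (h t) <= E_a gamma a Ul Ur (U s) (h s))%E]
          & (* |h(t) - sigma t| <= CK sqrt(t) ||U0 - S||_{L^2}, squared *)
            forall t, 0 <= t < T ->
              ((`|h t - sigma * t| ^+ 2)%:E
                 <= (CK ^+ 2 * t)%:E * L2sq Ul Ur U0)%E].

(* Main.v *)
From Pilot Require Import Defs.
From HB Require Import structures.
From mathcomp Require Import all_boot all_order all_algebra.
From mathcomp Require Import all_classical all_reals all_analysis.
From mathcomp Require Import measurable_realfun ring lra.
Import Order.TTheory GRing.Theory Num.Theory.
Import numFieldNormedType.Exports Pilot.Defs.
Set Implicit Arguments. Unset Strict Implicit. Unset Printing Implicit Defensive.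
Local Open Scope classical_set_scope.
Local Open Scope ring_scope.

(** The shock is strictly slower than the fast waves, and the Lax condition
    together with [B_l], [B_r] of the same sign forces [u_l > u_r].

    Let [a <= 1].  Consider the solution
    [U_l | 1-fan | V | 1-fan | U_l | shock | U_r] whose fans issue from
    distinct points and whose plateau [V] surrounds the origin; one of the two
    fans is a rarefaction, the other a compression, which stays Lipschitz for a
    short time.  The state [V] lies on the integral curve of the fast family
    through [U_l].  Put [G(V) = a eta(V|U_r) - eta(V|U_l)].  Then [G(U_l) > 0],
    while [G] becomes negative far along the curve because [u_l > u_r], so that
    [V] can be chosen with [G(V) = 0].  As [h] is Lipschitz, it remains in the
    plateau for a short time, where [G(V) = 0] makes the energy independent of
    [h].  The energy is then affine in time, with slope
    [F(V) - F(U_l) + sigma G(U_l)], where [F] is the entropy flux associated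
    with [G], so that [F' = lambda G'] along the curve.  Since [|lambda_1|]
    increases along the curve, integration by parts bounds the slope from below by
    [(sigma - lambda_1(U_l)) G(U_l) > 0], contradicting a-contraction.

    For [a >= 1] the mirror image
    [U_l | shock | U_r | 4-fan | V | 4-fan | U_r] is used in the same way. *)

(** * Bounded measurable functions and their integrals *)

(** The solution must be tested against arbitrary test functions and its energy computed exactly.
    Both tasks become one-dimensional once every wave is a superposition of elementary steps moving
    along straight lines: a shock is a constant family of steps, a fan a continuum indexed by the
    parameter of the curve. Conservation is then checked step by step, where it reads F' = lambda U'
    on a fan, and the energy is affine in time because each step has constant speed. A compression
    is no harder than a rarefaction: its steps meet at time 1 instead of time 0.

    The plateau answers the freedom of the shift: nothing is known of [h] near time 0 but its
    Lipschitz constant, which depends on the set of states and not on the time horizon.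

    G turns negative because for a = 1 the entropies of V cancel in the difference of the two
    relative entropies; a linear form in V remains, dominated by u, and a smaller a only lowers G.
    For a >= 1 the end states are exchanged and a is replaced by 1/a. The curve is parametrized by r
    = 1/v, in which it exists for all r >= 1/v_l, and |u - u_l| grows along it at least like the
    square root of r. *)

Section bounded_measurable.
Context {R : realType}.

(** Boundedness and measurability are stable under sums, products and composition and give
    integrability on every segment, so they serve as the single side condition for linearity,
    comparison and Fubini. *)
Definition bmeas d (T : measurableType d) (f : T -> R) : Prop :=
  measurable_fun setT f /\ exists M : R, forall x, `|f x| <= M.

Lemma bmeas_cst d (T : measurableType d) (k : R) : bmeas (fun _ : T => k).
Proof. by split; [exact: measurable_cst|exists `|k|]. Qed.

Lemma bmeasD d (T : measurableType d) (f g : T -> R) :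
  bmeas f -> bmeas g -> bmeas (fun x => f x + g x).
Proof.
move=> [mf [M fM]] [mg [N gN]]; split; first exact: measurable_funD.
by exists (M + N) => x; rewrite (le_trans (ler_normD _ _))// lerD.
Qed.

Lemma bmeasM d (T : measurableType d) (f g : T -> R) :
  bmeas f -> bmeas g -> bmeas (fun x => f x * g x).
Proof.
move=> [mf [M fM]] [mg [N gN]]; split; first exact: measurable_funM.
by exists (M * N) => x; rewrite normrM ler_pM.
Qed.

Lemma bmeasN d (T : measurableType d) (f : T -> R) :
  bmeas f -> bmeas (fun x => - f x).
Proof.
move=> [mf [M fM]]; split; first exact: measurableT_comp.
by exists M => x; rewrite normrN.
Qed.

Lemma bmeas_comp d d' (T : measurableType d) (T' : measurableType d')
    (f : T' -> R) (g : T -> T') :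
  measurable_fun setT g -> bmeas f -> bmeas (fun x => f (g x)).
Proof.
move=> mg [mf [M fM]]; split; first exact: (measurableT_comp mf).
by exists M => x.
Qed.

Lemma bmeas_sum d (T : measurableType d) (I : Type) (s : seq I)
    (f : I -> T -> R) :
  (forall i, bmeas (f i)) -> bmeas (fun x => \sum_(i <- s) f i x).
Proof.
move=> bf; elim: s => [|i s ih].
  rewrite (_ : (fun _ => _) = fun _ => 0); first exact: bmeas_cst.
  by apply/funext => x; rewrite big_nil.
rewrite (_ : (fun _ => _) = fun x => f i x + \sum_(i <- s) f i x).
  exact: bmeasD.
by apply/funext => x; rewrite big_cons.
Qed.

Implicit Types (a b c k : R).

(** For [b < a] the value is 0 rather than a signed integral; primitives therefore vanish to the
    left of their base point. *)
Definition integ (a b : R) (f : R -> R) : R := Rint `[a, b] f.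

Lemma itv_measure_fin (a b : R) :
  ((@lebesgue_measure R) `[a, b] < +oo)%E.
Proof. by rewrite lebesgue_measure_itv/=; case: ifP => // _; rewrite -EFinD ltry. Qed.

Lemma bmeas_integrable (a b : R) (f : R -> R) : bmeas f ->
  (@lebesgue_measure R).-integrable `[a, b] (EFin \o f).
Proof.
move=> [mf [M fM]]; apply: measurable_bounded_integrable => //.
- exact: itv_measure_fin.
- exact: measurable_funS mf.
- by exists M; split; [exact: num_real|move=> N MN x _ /=; rewrite (le_trans (fM x))// ltW].
Qed.

Lemma integD a b f g : bmeas f -> bmeas g ->
  integ a b (fun x => f x + g x) = integ a b f + integ a b g.
Proof. by move=> bf bg; apply: RintegralD => //; exact: bmeas_integrable. Qed.

Lemma integZ a b k f : bmeas f -> integ a b (fun x => k * f x) = k * integ a b f.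
Proof. by move=> bf; apply: RintegralZl => //; exact: bmeas_integrable. Qed.

Lemma eq_integ a b f g : (forall x, a <= x <= b -> f x = g x) ->
  integ a b f = integ a b g.
Proof. by move=> fg; apply: eq_Rintegral => x; rewrite inE/= in_itv/= => /fg. Qed.

Lemma integ_cst a b k : a <= b -> integ a b (fun=> k) = k * (b - a).
Proof.
move=> ab; rewrite /integ /Rint Rintegral_cst//= lebesgue_measure_itv/= lte_fin.
by move: ab; rewrite le_eqVlt => /predU1P[->|->//]; rewrite ltxx subrr.
Qed.

Lemma le_integ a b f g : bmeas f -> bmeas g ->
  (forall x, a <= x <= b -> f x <= g x) -> integ a b f <= integ a b g.
Proof.
move=> bf bg fg; apply: le_Rintegral => //; try exact: bmeas_integrable.
Qed.

Lemma integ_sum (I : Type) (s : seq I) a b (f : I -> R -> R) :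
  (forall i, bmeas (f i)) ->
  integ a b (fun x => \sum_(i <- s) f i x) = \sum_(i <- s) integ a b (f i).
Proof.
move=> bf; elim: s => [|i s ih].
  rewrite big_nil (_ : (fun _ => _) = fun _ => 0 * 0).
    by rewrite integZ ?mul0r//; exact: bmeas_cst.
  by apply/funext => x; rewrite big_nil mul0r.
rewrite big_cons -ih -integD//; last exact: bmeas_sum.
by congr integ; apply/funext => x; rewrite big_cons.
Qed.

Lemma norm_integ_le a b f M : a <= b -> bmeas f ->
  (forall x, a <= x <= b -> `|f x| <= M) -> `|integ a b f| <= M * (b - a).
Proof.
move=> ab bf fM; rewrite ler_norml -mulNr -!integ_cst//; apply/andP; split;
  apply: le_integ => //; try exact: bmeas_cst.
  by move=> x /fM; rewrite ler_norml => /andP[].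
by move=> x /fM; rewrite ler_norml => /andP[].
Qed.

(** Tonelli gives measurability of a partial integral for nonnegative functions, so [f] is raised by
    its bound [M], cut off outside the segment, and the integral of [M] is subtracted again. *)
Lemma bmeas_param d (T : measurableType d) (a b : R) (f : T * R -> R) :
  bmeas f -> bmeas (fun z => integ a b (fun x => f (z, x))).
Proof.
move=> bf; have [mf [M fM]] := bf.
have bfz z : bmeas (fun x => f (z, x)).
  by apply: (bmeas_comp (g := fun x => (z, x))) => //; exact: pair1_measurable.
split; last first.
  exists (M * (b - a) * (a <= b)%R%:R) => z; have [ab|ba] := leP a b.
    by rewrite mulr1; apply: norm_integ_le.
  by rewrite mulr0 /integ /Rint set_itv_ge ?bnd_simp -?ltNge// Rintegral_set0 normr0.
have mg : measurable_fun setT (fun z : T * R => (f z + M) * (z.2 \in `[a, b])%:R).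
  apply: measurable_funM; first by apply: measurable_funD.
  rewrite (_ : (fun _ => _) = (fun x : R => (x \in `[a, b])%:R) \o snd)//.
  apply: measurableT_comp => //.
  rewrite (_ : (fun _ => _) = \1_(`[a, b] : set R)); first exact: measurable_indic.
  by apply/funext => x; rewrite indicE mem_setE.
have -> : (fun z => integ a b (fun x => f (z, x))) =
  fun z => fine (\int[@lebesgue_measure R]_x ((f (z, x) + M) * (x \in `[a, b])%:R)%:E)%E
           - integ a b (fun=> M).
  apply/funext => z.
  rewrite (_ : integ a b (fun x => f (z, x)) =
     integ a b (fun x => f (z, x) + M) - integ a b (fun=> M)).
    congr (_ - _); rewrite /integ /Rint Rintegral_mkcond /Rintegral; congr fine.
    apply: eq_integral => x _; rewrite patchE mem_setE; case: ifP => _;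
      by rewrite ?mulr1 ?mulr0.
  by rewrite integD ?addrK//; exact: bmeas_cst.
apply: measurable_funB; last exact: measurable_cst.
apply: measurableT_comp => //.
have := @measurable_fun_fubini_tonelli_F _ _ T (measurableTypeR R) R (@lebesgue_measure R)
   (fun z : T * R => ((f z + M) * (z.2 \in `[a, b])%:R)%:E); apply.
  exact/measurable_EFinP.
move=> z /=; rewrite lee_fin mulr_ge0// -lerBlDr sub0r.
by have := fM z; rewrite ler_norml => /andP[].
Qed.

Lemma integ_mkcond_EFin a b (f : R -> R) : bmeas f ->
  (\int[@lebesgue_measure R]_x (f x * (x \in `[a, b])%:R)%:E = (integ a b f)%:E)%E.
Proof.
move=> bf; rewrite /integ /Rint /Rintegral fineK; last first.
  by apply: integrable_fin_num => //; exact: bmeas_integrable.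
rewrite [RHS]integral_mkcond; apply: eq_integral => x _.
by rewrite patchE mem_setE; case: ifP => _; rewrite ?mulr1 ?mulr0.
Qed.

Lemma integ_swap (a b c d : R) (f : R * R -> R) : bmeas f ->
  integ a b (fun x => integ c d (fun y => f (x, y))) =
  integ c d (fun y => integ a b (fun x => f (x, y))).
Proof.
move=> bf; have [mf [M fM]] := bf.
(* Cutting [f] off outside the rectangle turns both iterated integrals into integrals over the
   plane, where Fubini applies. *)
pose g (z : R * R) := f z * (z.1 \in `[a, b])%:R * (z.2 \in `[c, d])%:R.
have mI (u v : R) : measurable_fun setT (fun x : R => (x \in `[u, v])%:R : R).
  rewrite (_ : (fun _ => _) = \1_(`[u, v] : set R)); first exact: measurable_indic.
  by apply/funext => x; rewrite indicE mem_setE.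
have mg : measurable_fun setT g.
  apply: measurable_funM; first apply: measurable_funM => //.
  - by apply: (measurableT_comp (mI a b)).
  - by apply: (measurableT_comp (mI c d)).
have bfx x : bmeas (fun y => f (x, y)).
  by apply: (bmeas_comp (g := fun y => (x, y))) => //; exact: pair1_measurable.
have bfy y : bmeas (fun x => f (x, y)).
  by apply: (bmeas_comp (g := fun x => (x, y))) => //; exact: pair2_measurable.
have E1 x : (\int[@lebesgue_measure R]_y (g (x, y))%:E)%E =
   ((x \in `[a, b])%:R * integ c d (fun y => f (x, y)))%:E.
  rewrite -integZ// -integ_mkcond_EFin; last by apply: bmeasM => //; exact: bmeas_cst.
  by apply: eq_integral => y _; rewrite /g/= (mulrC (f _)).
have E2 y : (\int[@lebesgue_measure R]_x (g (x, y))%:E)%E =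
   ((y \in `[c, d])%:R * integ a b (fun x => f (x, y)))%:E.
  rewrite -integZ// -integ_mkcond_EFin; last by apply: bmeasM => //; exact: bmeas_cst.
  by apply: eq_integral => x _; rewrite /g/= mulrAC (mulrC (f _)).
have F : ((\int[@lebesgue_measure R]_x \int[@lebesgue_measure R]_y (g (x, y))%:E) =
          (\int[@lebesgue_measure R]_y \int[@lebesgue_measure R]_x (g (x, y))%:E))%E.
  apply: (@Fubini _ _ _ _ _ (@lebesgue_measure R) (@lebesgue_measure R) (fun z => (g z)%:E)).
  apply/integrable12ltyP; first exact/measurable_EFinP.
  have bnf : bmeas (fun z => `|f z|).
    by split; [exact: measurableT_comp|exists M => z; rewrite normr_id].
  have bnfx x : bmeas (fun y => `|f (x, y)|).
    by apply: (bmeas_comp (f := fun z => `|f z|) (g := fun y => (x, y))) => //; exact: pair1_measurable.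
  have E x : (\int[@lebesgue_measure R]_y `|(g (x, y))%:E| =
     (integ c d (fun y => `|f (x, y)|) * (x \in `[a, b])%:R)%:E)%E.
    rewrite mulrC -integZ// -integ_mkcond_EFin; last by apply: bmeasM => //; exact: bmeas_cst.
    apply: eq_integral => y _; rewrite /g/= !normrM (mulrC `|f _|).
    by rewrite (ger0_norm (ler0n _ _)) (ger0_norm (ler0n _ (_ \in `[c, d]))).
  under eq_integral do rewrite E.
  by rewrite integ_mkcond_EFin ?ltry//; exact: (@bmeas_param _ R c d (fun z => `|f z|)).
rewrite /integ /Rint [LHS]Rintegral_mkcond [RHS]Rintegral_mkcond /Rintegral.
congr fine; transitivity (\int[@lebesgue_measure R]_x \int[@lebesgue_measure R]_y (g (x, y))%:E)%E.
  apply: eq_integral => x _; rewrite E1 patchE mem_setE.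
  by case: ifP => _; rewrite ?mul1r ?mul0r.
rewrite F; apply: eq_integral => y _; rewrite E2 patchE mem_setE.
by case: ifP => _; rewrite ?mul1r ?mul0r.
Qed.

Lemma Rint_setT_integ (a b : R) (f : R -> R) :
  (forall x, ~~ (a <= x <= b) -> f x = 0) -> Rint setT f = integ a b f.
Proof.
move=> f0; rewrite /integ /Rint Rintegral_mkcond [RHS]Rintegral_mkcond.
apply: eq_Rintegral => x _; rewrite !patchE mem_setE in_setT in_itv/=.
by case: ifPn => // /f0.
Qed.

Lemma Rint_oo_integ (a b : R) (f : R -> R) : bmeas f ->
  Rint `]a, b[ f = integ a b f.
Proof.
move=> bf; have [ab|ba] := ltP a b; last first.
  rewrite /integ /Rint set_itv_ge ?bnd_simp -?leNgt// Rintegral_set0.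
  move: ba; rewrite le_eqVlt => /predU1P[->|ba].
    by rewrite set_itv1 Rintegral_set1.
  by rewrite set_itv_ge ?bnd_simp -?ltNge// Rintegral_set0.
rewrite /integ /Rint Rintegral_itv_obnd_cbnd ?Rintegral_itv_bndo_bndc//;
  apply: integrableS (bmeas_integrable a b bf) => //.
- by apply: subset_itv; rewrite bnd_simp.
- by apply: subset_itv; rewrite bnd_simp.
Qed.

(** The sigma-algebra on [R * R] is the product one, so an open set has to be exhibited as a
    countable union of rectangles: the squares with rational centre and half-width that it contains.
    A half-width below [e / 2] keeps a square through [z] inside the ball of radius [e]. *)
Lemma continuous2_measurable (f : R * R -> R) : continuous f ->
  measurable_fun setT f.
Proof.
move=> cf; apply: measurability (RGenOInfty.measurableE R) _ => _ [_ [x ->] <-].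
rewrite setTI.
pose box (q : rat * rat * rat) : set (R * R) :=
  `]ratr q.1.1 - ratr q.2, ratr q.1.1 + ratr q.2[ `*`
  `]ratr q.1.2 - ratr q.2, ratr q.1.2 + ratr q.2[.
pose A (q : rat * rat * rat) := if pselect (box q `<=` f @^-1` `]x, +oo[) then box q else set0.
rewrite (_ : f @^-1` _ = \bigcup_q A q); last first.
  apply/seteqP; split => [z fz|z [q _]]; last by rewrite /A; case: pselect => // sb /sb.
  have zO : nbhs z (f @^-1` `]x, +oo[).
    by apply: cf; apply: open_nbhs_nbhs; split => //; exact: rray_open.
  have /nbhs_ballP[e /= e0 he] := zO.
  have /rat_in_itvoo[q] : 0 < e / 2 by rewrite divr_gt0.
  rewrite in_itv/= => /andP[q0 qe].
  have /rat_in_itvoo[a] : z.1 < z.1 + ratr q by rewrite ltrDl.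
  rewrite in_itv/= => ha.
  have /rat_in_itvoo[b] : z.2 < z.2 + ratr q by rewrite ltrDl.
  rewrite in_itv/= => hb.
  exists ((a, b), q) => //; rewrite /A; case: pselect => [sb|[]].
    by move: ha hb => /andP[? ?] /andP[? ?]; rewrite /box/=; split; rewrite /= in_itv/=; apply/andP; split; lra.
  move=> [u v] [/=]; rewrite !in_itv/= => /andP[? ?] /andP[? ?]; apply: he.
  by move: ha hb => /andP[? ?] /andP[? ?]; split; rewrite /ball/= ltr_norml; apply/andP; split; lra.
apply: countable_bigcupT_measurable => // q; rewrite /A.
by case: pselect => sb /=; [exact: measurableX|exact: measurable0].
Qed.

End bounded_measurable.

(** * Calculus in one and two real variables *)

Section calculus.
Context {R : realType}.
Lemma bmeas_ler d (T : measurableType d) (f g : T -> R) :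
  measurable_fun setT f -> measurable_fun setT g ->
  bmeas (fun x : T => (f x <= g x)%R%:R : R).
Proof.
move=> mf mg; split; last by exists 1 => x; case: (f x <= g x); rewrite ?normr0 ?normr1.
rewrite (_ : (fun _ => _) = fun x => if f x <= g x then 1 else 0).
  by apply: measurable_fun_ifT => //; exact: measurable_fun_ler.
by apply/funext => x; case: ifP.
Qed.

Implicit Types (a b c s t x : R).

Lemma continuousW a b (f : R -> R) : continuous f -> {within `[a, b], continuous f}.
Proof. by move=> cf; apply: continuous_subspaceT => x; exact: cf. Qed.

Lemma integ_FTC a b (f F : R -> R) : a <= b -> continuous f -> continuous F ->
  (forall x, a < x < b -> is_derive x 1 F (f x)) -> integ a b f = F b - F a.
Proof.
rewrite le_eqVlt => /predU1P[<- _ _ _|ab cf cF dF].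
  by rewrite /integ /Rint set_itv1 Rintegral_set1 subrr.
rewrite /integ /Rint /Rintegral (@continuous_FTC2 _ f F)//.
- exact: continuousW.
- split.
  + by move=> x; rewrite in_itv/= => /dF.
  + exact: cvg_at_right_filter (cF a).
  + exact: cvg_at_left_filter (cF b).
- by move=> x; rewrite in_itv/= => /dF dFx; rewrite derive1E derive_val.
Qed.

Lemma integ_translate a b c (f : R -> R) : a <= b -> continuous f ->
  integ a b (fun z => f (z + c)) = integ (a + c) (b + c) f.
Proof.
move=> ab cf; have dF (x : R) : is_derive x 1 (fun z => z + c) 1.
  by apply: is_derive_eq; rewrite addr0.
have F1 : derive1 (fun z : R => z + c) = cst 1.
  by apply/funext => x; rewrite derive1E derive_val.
rewrite /integ /Rint /Rintegral [in RHS](@integration_by_substitution_increasing _ (fun z => z + c) f a b)//.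
- by congr fine; apply: eq_integral => x _; rewrite F1 /= fctE/= mulr1.
- by move=> x y _ _ xy; rewrite ltrD2r.
- by rewrite F1 => x _; exact: cvg_cst.
- by rewrite F1; exact: is_cvg_cst.
- by rewrite F1; exact: is_cvg_cst.
- have cc : continuous (fun z : R => z + c).
    by move=> x; apply: continuousD; [exact: cvg_id|exact: cvg_cst].
  split.
  + by move=> x _.
  + exact: cvg_at_right_filter (cc a).
  + exact: cvg_at_left_filter (cc b).
- exact: continuousW.
Qed.

Lemma is_derive_continuous (f f' : R -> R) :
  (forall x, is_derive x 1 f (f' x)) -> continuous f.
Proof.
move=> df x; apply/differentiable_continuous/derivable1_diffP.
by apply: (@ex_derive _ _ _ _ _ _ _ (df x)).
Qed.

Lemma mean_value (f f' : R -> R) a b : (forall x, is_derive x 1 f (f' x)) ->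
  exists2 c, `|c - a| <= `|b - a| & f b - f a = f' c * (b - a).
Proof.
move=> df; have cf := is_derive_continuous df.
have [ab|/ltW ba] := leP a b.
  have [c] := @MVT_segment R f f' a b ab (fun x _ => df x) (continuousW cf).
  rewrite in_itv/= => /andP[ac cb] E; exists c => //.
  by rewrite !ger0_norm ?subr_ge0// lerB.
have [c] := @MVT_segment R f f' b a ba (fun x _ => df x) (continuousW cf).
rewrite in_itv/= => /andP[ac cb] E; exists c.
  by rewrite !(distrC _ a) !ger0_norm ?subr_ge0// lerB.
by rewrite -opprB E -mulrN opprB.
Qed.

Lemma is_deriveP (f : R -> R) x l :
  (forall e, 0 < e -> exists2 d, 0 < d & forall h, h != 0 -> `|h| < d ->
     `|(f (x + h) - f x) / h - l| < e) -> is_derive x 1 f l.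
Proof.
move=> H; have C : (fun h => h^-1 *: ((f \o shift x) (h *: 1) - f x)) @ 0^' --> l.
  apply/cvgrPdist_lt => e /H[d d0 hd]; near=> h.
  rewrite distrC /= [h *: 1]mulr1 (addrC h) [_ *: _]mulrC; apply: hd.
    by near: h; exact: nbhs_dnbhs_neq.
  by near: h; apply: dnbhs0_lt.
by split; [apply/cvg_ex; exists l|exact: cvg_lim C].
Unshelve. all: by end_near. Qed.

Lemma continuous2P (f : R * R -> R) x y e : continuous f -> 0 < e ->
  exists2 d, 0 < d & forall x' y', `|x' - x| < d -> `|y' - y| < d ->
     `|f (x', y') - f (x, y)| < e.
Proof.
move=> cf e0; have /cvgrPdist_lt/(_ e e0)/nbhs_ballP[d /= d0 hd] := cf (x, y).
exists d => // x' y' h1 h2; rewrite distrC; apply: hd.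
by split; rewrite /ball/= distrC.
Qed.

(** Only continuous partial derivatives are given, so the increment along the line is split into a
    time step and a space step, with the mean value theorem applied to each. *)
Lemma is_derive_line (f ft fx : R -> R -> R) c s t :
  (forall t x, is_derive t 1 (fun s => f s x) (ft t x)) ->
  (forall t x, is_derive x 1 (f t) (fx t x)) ->
  continuous (fun z : R * R => ft z.1 z.2) ->
  continuous (fun z : R * R => fx z.1 z.2) ->
  is_derive t 1 (fun t => f t (c + s * t)) (ft t (c + s * t) + s * fx t (c + s * t)).
Proof.
move=> dt dx ct cx; apply: is_deriveP => e e0.
pose e' := e / (2 * (1 + `|s|)).
have s0 : 0 < 1 + `|s| by rewrite ltr_pwDl.
have e'0 : 0 < e' by rewrite divr_gt0// mulr_gt0.
have [d1 d10 h1] := continuous2P t (c + s * t) ct e'0.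
have [d2 d20 h2] := continuous2P t (c + s * t) cx e'0.
exists (Num.min d1 d2 / (1 + `|s|)).
  by rewrite divr_gt0// lt_min d10.
move=> h hn0; rewrite ltr_pdivlMr// lt_min => /andP[hd1 hd2].
have [u ut Eu] := @mean_value (fun s0 => f s0 (c + s * (t + h))) (fun s0 => ft s0 (c + s * (t + h))) t (t + h) (fun s0 => dt s0 _).
have [v vx Ev] := @mean_value (f t) (fx t) (c + s * t) (c + s * (t + h)) (dx t).
have hh : `|h| <= `|h| * (1 + `|s|) by rewrite ler_peMr// lerDl.
have sh : `|s * h| <= `|h| * (1 + `|s|).
  by rewrite normrM mulrC ler_wpM2l// lerDr.
have Ec : c + s * (t + h) - (c + s * t) = s * h by ring.
have Et : t + h - t = h by ring.
rewrite Ec in vx Ev; rewrite Et in ut Eu.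
have -> : (f (t + h) (c + s * (t + h)) - f t (c + s * t)) / h =
    ft u (c + s * (t + h)) + s * fx t v.
  rewrite (_ : _ - _ = ft u (c + s * (t + h)) * h + fx t v * (s * h)).
    by field.
  by rewrite -Eu -Ev; ring.
have H1 : `|ft u (c + s * (t + h)) - ft t (c + s * t)| < e'.
  by apply: (h1 u); [apply: le_lt_trans (le_trans ut hh) hd1|rewrite Ec; exact: le_lt_trans sh hd1].
have H2 : `|fx t v - fx t (c + s * t)| < e'.
  by apply: (h2 t); [rewrite subrr normr0|exact: le_lt_trans (le_trans vx sh) hd2].
rewrite (_ : _ - _ = (ft u (c + s * (t + h)) - ft t (c + s * t)) + s * (fx t v - fx t (c + s * t))); last by ring.
apply: (@le_lt_trans _ _ (e' * (1 + `|s|))).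
  rewrite (le_trans (ler_normD _ _))// [leRHS]mulrDr mulr1 lerD ?(ltW H1)//.
  by rewrite normrM mulrC ler_wpM2r// ltW.
by rewrite /e' invfM mulrA divfK ?gt_eqF// ltr_pdivrMr// ltr_pMr// ltr1n.
Qed.

End calculus.

(** * Superpositions of moving fronts *)

Section fronts.
Context {R : realType}.
Implicit Types (a b s t x th T : R).

Lemma continuous_bmeas (f : R * R -> R) (t1 t2 x1 x2 : R) : continuous f ->
  (forall t x, ~ (t1 <= t <= t2 /\ x1 <= x <= x2) -> f (t, x) = 0) -> bmeas f.
Proof.
move=> cf f0; split; first exact: continuous2_measurable.
have cK : compact (`[t1, t2] `*` `[x1, x2] : set (R * R)).
  by apply: compact_setX; exact: segment_compact.
have /compact_bounded[M [_ hM]] : compact (f @` (`[t1, t2] `*` `[x1, x2])).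
  by apply: continuous_compact cK; apply: continuous_subspaceT => z; exact: cf.
exists (`|M| + 1) => -[t x].
have [K|/f0->] := pselect (t1 <= t <= t2 /\ x1 <= x <= x2); last first.
  by rewrite normr0 addr_ge0.
apply: hM; first by rewrite (le_lt_trans (ler_norm M))// ltrDl.
by exists (t, x) => //; split; rewrite /= in_itv/=; case: K.
Qed.

Lemma continuous_bmeas1 (f : R -> R) (x1 x2 : R) : continuous f ->
  (forall x, ~~ (x1 <= x <= x2) -> f x = 0) -> bmeas f.
Proof.
move=> cf f0; split; first exact: continuous_measurable_fun.
have /compact_bounded[M [_ hM]] : compact (f @` `[x1, x2]).
  apply: continuous_compact; last exact: segment_compact.
  by apply: continuous_subspaceT => z; exact: cf.
exists (`|M| + 1) => x.
have [K|/f0->] := boolP (x1 <= x <= x2); last by rewrite normr0 addr_ge0.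
apply: hM; first by rewrite (le_lt_trans (ler_norm M))// ltrDl.
by exists x => //=; rewrite in_itv/=.
Qed.

Lemma dint_integ T (x1 x2 : R) (g : R -> R -> R) :
  bmeas (fun z : R * R => g z.1 z.2) ->
  (forall t x, ~~ (x1 <= x <= x2) -> g t x = 0) ->
  dint T g = integ 0 T (fun t => integ x1 x2 (g t)).
Proof.
move=> bg g0; rewrite /dint.
have -> : (fun t => Rint setT (fun x => g t x)) = (fun t => integ x1 x2 (g t)).
  by apply/funext => t; apply: Rint_setT_integ => x /g0.
by rewrite Rint_oo_integ//; exact: (@bmeas_param R _ R x1 x2 (fun z : R * R => g z.1 z.2)).
Qed.

Lemma bmeas_slice1 (f : R -> R -> R) t : bmeas (fun z : R * R => f z.1 z.2) ->
  bmeas (f t).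
Proof.
move=> bf; apply: (bmeas_comp (f := fun z : R * R => f z.1 z.2) (g := fun x => (t, x))) => //.
exact: pair1_measurable.
Qed.

Lemma Rint_cut_le (X Z : R) (g : R -> R) :
  (forall x, X + Z < x -> g x = 0) ->
  Rint setT (fun x => (X <= x)%R%:R * g x) = integ X (X + Z) g.
Proof.
move=> g0; rewrite (@Rint_setT_integ _ X (X + Z)).
  by apply: eq_integ => x /andP[-> _]; rewrite mul1r.
move=> x; rewrite negb_and -!ltNge => /orP[xX|/g0->]; last by rewrite mulr0.
by rewrite leNgt xX mul0r.
Qed.

Lemma continuous2_slice (f : R -> R -> R) t :
  continuous (fun z : R * R => f z.1 z.2) -> continuous (f t).
Proof.
move=> cf x; apply/cvgrPdist_lt => e e0.
have [d d0 hd] := continuous2P t x cf e0.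
near=> y; rewrite distrC; apply: (hd t y); first by rewrite subrr normr0.
by near: y; apply/nbhs_ballP; exists d => // y; rewrite /ball/= distrC.
Unshelve. all: by end_near. Qed.

Lemma continuous2_line (f : R -> R -> R) (c s : R) :
  continuous (fun z : R * R => f z.1 z.2) -> continuous (fun t => f t (c + s * t)).
Proof.
move=> cf t; apply/cvgrPdist_lt => e e0.
have [d d0 hd] := continuous2P t (c + s * t) cf e0.
have ca : (fun y => c + s * y) @ t --> c + s * t.
  by apply: cvgD; [exact: cvg_cst|apply: cvgM; [exact: cvg_cst|exact: cvg_id]].
near=> y; rewrite distrC; apply: (hd y); rewrite distrC; near: y.
  by apply/nbhs_ballP; exists d.
by have /cvgrPdist_lt/(_ d d0) := ca.
Unshelve. all: by end_near. Qed.

Section test_function.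
Variables (phi phit phix : R -> R -> R) (t1 t2 x1 x2 : R).
Hypothesis C1 : C1_supp phi phit phix t1 t2 x1 x2.

Let dt t x : is_derive t 1 (fun s => phi s x) (phit t x).
Proof. by have [+ _ _ _ _] := C1; apply. Qed.
Let dx t x : is_derive x 1 (phi t) (phix t x).
Proof. by have [_ + _ _ _] := C1; apply. Qed.
Let ct : continuous (fun z : R * R => phit z.1 z.2).
Proof. by have [_ _ + _ _] := C1; apply. Qed.
Let cx : continuous (fun z : R * R => phix z.1 z.2).
Proof. by have [_ _ _ + _] := C1; apply. Qed.

Lemma supp0 t x : ~ (t1 <= t <= t2 /\ x1 <= x <= x2) -> phi t x = 0.
Proof. by have [_ _ _ _ +] := C1; apply. Qed.

Let out t x : ~ (t1 <= t <= t2 /\ x1 <= x <= x2) ->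
  [\/ t < t1, t2 < t, x < x1 | x2 < x].
Proof.
move=> H; have [a1|?] := leP t1 t; last by apply: Or41.
have [a2|?] := leP t t2; last by apply: Or42.
have [a3|?] := leP x1 x; last by apply: Or43.
have [a4|?] := leP x x2; last by apply: Or44.
by exfalso; apply: H; rewrite a1 a2 a3 a4.
Qed.

Let eq0_derive (f : R -> R) x l : is_derive x 1 f l ->
  (\near x, f x = 0) -> l = 0.
Proof.
move=> df f0; rewrite -(@derive_val _ _ _ _ _ _ _ df).
by rewrite (near_eq_derive _ f0) derive_cst.
Qed.

(** The complement of the closed rectangle is open, so [phi] vanishes along a neighbourhood of the
    point and its derivative there is 0. *)
Lemma phit_supp0 t x : ~ (t1 <= t <= t2 /\ x1 <= x <= x2) -> phit t x = 0.
Proof.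
move=> H; apply: (eq0_derive (dt t x)).
case: (out H) => h.
- near=> s; apply: supp0 => -[/andP[h1 _] _].
  have : s < t1 by near: s; exact: lt_nbhsl.
  by rewrite ltNge h1.
- near=> s; apply: supp0 => -[/andP[_ h1] _].
  have : t2 < s by near: s; exact: lt_nbhsr.
  by rewrite ltNge h1.
- by near=> s; apply: supp0 => -[_ /andP[h1 _]]; move: h; rewrite ltNge h1.
- by near=> s; apply: supp0 => -[_ /andP[_ h1]]; move: h; rewrite ltNge h1.
Unshelve. all: by end_near. Qed.

Lemma phix_supp0 t x : ~ (t1 <= t <= t2 /\ x1 <= x <= x2) -> phix t x = 0.
Proof.
move=> H; apply: (eq0_derive (dx t x)).
case: (out H) => h.
- by near=> s; apply: supp0 => -[/andP[h1 _] _]; move: h; rewrite ltNge h1.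
- by near=> s; apply: supp0 => -[/andP[_ h1] _]; move: h; rewrite ltNge h1.
- near=> s; apply: supp0 => -[_ /andP[h1 _]].
  have : s < x1 by near: s; exact: lt_nbhsl.
  by rewrite ltNge h1.
- near=> s; apply: supp0 => -[_ /andP[_ h1]].
  have : x2 < s by near: s; exact: lt_nbhsr.
  by rewrite ltNge h1.
Unshelve. all: by end_near. Qed.

Lemma bmeas_phit : bmeas (fun z : R * R => phit z.1 z.2).
Proof. by apply: continuous_bmeas ct _ => t x; exact: phit_supp0. Qed.

Lemma bmeas_phix : bmeas (fun z : R * R => phix z.1 z.2).
Proof. by apply: continuous_bmeas cx _ => t x; exact: phix_supp0. Qed.

Lemma continuous_phi t : continuous (phi t).
Proof. exact: is_derive_continuous (dx t). Qed.

Lemma bmeas_phi t : bmeas (phi t).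
Proof.
apply: (@continuous_bmeas1 _ x1 x2 (@continuous_phi t)) => x h.
by apply: supp0 => -[_]; exact/negP.
Qed.

Lemma front_x t X : Rint setT (fun x => (X <= x)%R%:R * phix t x) = - phi t X.
Proof.
pose Z := `|x2 - X| + 1.
have Z0 : 0 <= Z by rewrite addr_ge0.
have h x : X + Z <= x -> x2 < x by have := ler_norm (x2 - X); rewrite /Z; lra.
rewrite (@Rint_cut_le X Z); last first.
  by move=> x /ltW/h hx; apply: phix_supp0 => -[_ /andP[_]]; rewrite leNgt hx.
rewrite (integ_FTC _ _ (@continuous_phi t) (fun x _ => dx t x)).
- rewrite (@supp0 t (X + Z)) ?sub0r// => -[_ /andP[_]].
  by rewrite leNgt (h (X + Z)).
- by rewrite lerDl.
- exact: continuous2_slice cx.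
Qed.

Lemma bmeas_phit_line (x0 s : R) : bmeas (fun z : R * R =>
  phit z.1 (z.2 + (x0 + s * z.1)) + s * phix z.1 (z.2 + (x0 + s * z.1))).
Proof.
have m : measurable_fun setT (fun z : R * R => (z.1, z.2 + (x0 + s * z.1))).
  apply: measurable_fun_pair => //; apply: measurable_funD => //.
  by apply: measurable_funD => //; apply: measurable_funM.
apply: bmeasD; first exact: (bmeas_comp m bmeas_phit).
apply: bmeasM; first exact: bmeas_cst.
exact: (bmeas_comp m bmeas_phix).
Qed.

(** The weak identity for one step of height 1 moving at speed [s]. In the moving variable
    [z = x - (x0 + s * t)] the domain is a fixed half-line, and for each [z] the integrand is the
    derivative of [phi] along a line; [phi] vanishes at time [T] because [t2 < T], which leaves the
    initial term. *)
Lemma front_line T x0 s : 0 <= T -> t2 < T ->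
  integ 0 T (fun t => Rint setT
     (fun x => (x0 + s * t <= x)%R%:R * (phit t x + s * phix t x)))
  + Rint setT (fun x => (x0 <= x)%R%:R * phi 0 x) = 0.
Proof.
move=> T0 t2T.
pose Z := `|x2| + `|x0| + `|s| * T + 1.
have Z0 : 0 <= Z by rewrite !addr_ge0// mulr_ge0.
have h t x : 0 <= t <= T -> x0 + s * t + Z < x -> x2 < x.
  move=> /andP[t0 tT]; apply: le_lt_trans.
  have : - (s * t) <= `|s| * T.
    by rewrite (le_trans (ler_norm _))// normrN normrM ler_wpM2l// ger0_norm.
  rewrite /Z; have := ler_norm x2; have := ler_norm (- x0); rewrite normrN; lra.
have cg t : continuous (fun x => phit t x + s * phix t x).
  move=> x; apply: cvgD; first exact: (@continuous2_slice phit t ct x).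
  by apply: cvgM; [exact: cvg_cst|exact: (@continuous2_slice phix t cx x)].
have E t : 0 <= t <= T -> Rint setT
     (fun x => (x0 + s * t <= x)%R%:R * (phit t x + s * phix t x)) =
   integ 0 Z (fun z => phit t (z + (x0 + s * t)) + s * phix t (z + (x0 + s * t))).
  move=> tT; rewrite (@Rint_cut_le _ Z); last first.
    move=> x /(h _ _ tT) hx.
    by rewrite phit_supp0 ?phix_supp0 ?mulr0 ?addr0// => -[_ /andP[_]]; rewrite leNgt hx.
  by rewrite (@integ_translate _ 0 Z (x0 + s * t) _ Z0 (cg t)) add0r addrC (addrC Z).
rewrite (eq_integ E).
rewrite (@integ_swap _ 0 T 0 Z (fun z : R * R => phit z.1 (z.2 + (x0 + s * z.1)) +
   s * phix z.1 (z.2 + (x0 + s * z.1)))); last exact: bmeas_phit_line.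
rewrite (@Rint_cut_le x0 Z); last first.
  move=> x hx; apply: supp0 => -[_ /andP[_]].
  by rewrite leNgt (h 0)// ?lexx// mulr0 addr0.
have -> : integ x0 (x0 + Z) (phi 0) = integ 0 Z (fun z => phi 0 (z + x0)).
  by rewrite integ_translate ?add0r 1?addrC//; exact: continuous_phi.
rewrite -integD.
- rewrite -[RHS](mul0r (Z - 0)) -integ_cst//; apply: eq_integ => z zZ /=.
  pose g t := phit t (z + x0 + s * t) + s * phix t (z + x0 + s * t).
  have dl t : is_derive t 1 (fun t => phi t (z + x0 + s * t)) (g t).
    exact: (@is_derive_line _ phi phit phix (z + x0) s t dt dx ct cx).
  rewrite (@eq_integ _ 0 T _ g); last by move=> t _; rewrite /g addrA.
  rewrite (integ_FTC T0 _ (is_derive_continuous dl) (fun t _ => dl t)).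
    rewrite mulr0 addr0 (@supp0 T) ?sub0r ?addNr//.
    by move=> -[/andP[_]]; rewrite leNgt t2T.
  move=> t; apply: cvgD; first exact: (continuous2_line (f := phit) ct).
  apply: cvgM; first exact: cvg_cst.
  exact: (continuous2_line (f := phix) cx).
- exact: (bmeas_param _ _ (bmeas_comp (@measurable_swap _ _ R R) (bmeas_phit_line x0 s))).
- have m : measurable_fun setT (fun z : R => z + x0) by apply: measurable_funD.
  exact: (@bmeas_comp R _ _ R R (phi 0) (fun z => z + x0) m (bmeas_phi 0)).
Qed.

End test_function.
End fronts.

Section superposition.
Context {R : realType}.
Implicit Types (s t x th T : R) (dg dG : R -> R).
Variables (pos spd : R -> R).
Hypotheses (mpos : measurable_fun setT pos) (mspd : measurable_fun setT spd).

(** A layer-cake sum: at time [t] the step with index [th] sits at [pos th + spd th * t] and has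
    height [dg th]. All components of the state, the flux and the entropy pair share the same steps
    and differ in [dg] only. *)
Definition fronts (dg : R -> R) t x : R :=
  integ 0 1 (fun th => (pos th + spd th * t <= x)%R%:R * dg th).

Let bI : bmeas (fun z : (R * R) * R => (pos z.2 + spd z.2 * z.1.1 <= z.1.2)%R%:R : R).
Proof.
apply: bmeas_ler; last by apply: measurableT_comp => //; exact: measurable_snd.
apply: measurable_funD; first exact: measurableT_comp.
by apply: measurable_funM; apply: measurableT_comp => //; exact: measurable_fst.
Qed.

Let bI' d (T : measurableType d) (f g h : T -> R) :
  measurable_fun setT f -> measurable_fun setT g -> measurable_fun setT h ->
  bmeas (fun z => (pos (h z) + spd (h z) * f z <= g z)%R%:R : R).
Proof.
move=> mf mg mh; apply: bmeas_ler => //.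
apply: measurable_funD; first exact: measurableT_comp.
by apply: measurable_funM => //; exact: measurableT_comp.
Qed.

Lemma bmeas_fronts dg : bmeas dg -> bmeas (fun z : R * R => fronts dg z.1 z.2).
Proof.
move=> bdg; apply: (@bmeas_param R _ (R * R)%type 0 1 (fun z : (R * R) * R =>
  (pos z.2 + spd z.2 * z.1.1 <= z.1.2)%R%:R * dg z.2)).
by apply: bmeasM => //; apply: bmeas_comp bdg.
Qed.

Section against_test.
Variables (T x1 x2 : R) (psi : R -> R -> R).
Hypothesis bpsi : bmeas (fun z : R * R => psi z.1 z.2).
Hypothesis psi0 : forall t x, ~~ (x1 <= x <= x2) -> psi t x = 0.

Definition front_test th : R := integ 0 T (fun t => Rint setT
  (fun x => (pos th + spd th * t <= x)%R%:R * psi t x)).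

Let front_testE : front_test = fun th => integ 0 T (fun t => integ x1 x2
  (fun x => (pos th + spd th * t <= x)%R%:R * psi t x)).
Proof.
apply/funext => th; congr integ; apply/funext => t; apply: Rint_setT_integ => x h.
by rewrite psi0 ?mulr0.
Qed.

Let b3 : bmeas (fun z : (R * R) * R =>
   (pos z.1.1 + spd z.1.1 * z.1.2 <= z.2)%R%:R * psi z.1.2 z.2).
Proof.
apply: bmeasM.
  apply: bI' => //; apply: measurableT_comp => //.
apply: (bmeas_comp (f := fun z : R * R => psi z.1 z.2) (g := fun z : (R * R) * R => (z.1.2, z.2))) => //.
by apply: measurable_fun_pair => //; exact: measurableT_comp.
Qed.

Lemma bmeas_front_test : bmeas front_test.
Proof.
rewrite front_testE.
apply: (@bmeas_param R _ R 0 T (fun z : R * R => integ x1 x2 (fun x =>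
  (pos z.1 + spd z.1 * z.2 <= x)%R%:R * psi z.2 x))).
exact: (@bmeas_param R _ (R * R)%type x1 x2 (fun z : (R * R) * R =>
   (pos z.1.1 + spd z.1.1 * z.1.2 <= z.2)%R%:R * psi z.1.2 z.2)).
Qed.

Lemma bmeas_front_slice th :
  bmeas (fun z : R * R => (pos th + spd th * z.1 <= z.2)%R%:R * psi z.1 z.2).
Proof.
apply: bmeasM; last exact: bpsi.
exact: (bI' (f := fst) (g := snd) (h := fun=> th)).
Qed.

(** Fubini with [th] outermost: testing a superposition amounts to testing each of its steps. *)
Lemma dint_fronts dg : bmeas dg ->
  dint T (fun t x => fronts dg t x * psi t x) =
  integ 0 1 (fun th => dg th * front_test th).
Proof.
move=> bdg; rewrite (@dint_integ _ _ x1 x2); last 2 first.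
- by apply: bmeasM; [exact: bmeas_fronts|exact: bpsi].
- by move=> t x h; rewrite psi0 ?mulr0.
rewrite front_testE.
pose f t th x : R := dg th * ((pos th + spd th * t <= x)%R%:R * psi t x).
have bf : bmeas (fun z : (R * R) * R => f z.1.1 z.1.2 z.2).
  apply: bmeasM; first by apply: bmeas_comp bdg; exact: measurableT_comp.
  apply: bmeasM; first by apply: bI' => //; exact: measurableT_comp.
  apply: (bmeas_comp (f := fun z : R * R => psi z.1 z.2) (g := fun z : (R * R) * R => (z.1.1, z.2))) => //.
  by apply: measurable_fun_pair => //; exact: measurableT_comp.
have mc (t x : R) : bmeas (fun th => (pos th + spd th * t <= x)%R%:R * dg th).
  by apply: bmeasM => //; exact: (bI' (f := fun=> t) (g := fun=> x) (h := id)).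
transitivity (integ 0 T (fun t => integ 0 1 (fun th => integ x1 x2 (f t th)))).
  apply: eq_integ => t _; rewrite -(@integ_swap _ x1 x2 0 1 (fun z : R * R => f t z.2 z.1)).
    apply: eq_integ => x _; rewrite mulrC /fronts -integZ//.
    by apply: eq_integ => th _; rewrite /f/=; ring.
  apply: (bmeas_comp (g := fun z : R * R => ((t, z.2), z.1)) _ bf).
  by apply: measurable_fun_pair => //; apply: measurable_fun_pair => //.
rewrite (@integ_swap _ 0 T 0 1 (fun z : R * R => integ x1 x2 (f z.1 z.2))); last first.
  exact: (@bmeas_param R _ (R * R)%type x1 x2 (fun z : (R * R) * R => f z.1.1 z.1.2 z.2)).
apply: eq_integ => th _ /=; rewrite -integZ; last first.
  exact: (@bmeas_param R _ R x1 x2 (fun z : R * R => (pos th + spd th * z.1 <= z.2)%R%:R * psi z.1 z.2) (bmeas_front_slice th)).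
apply: eq_integ => t _; rewrite -integZ//.
exact: (@bmeas_slice1 R (fun t x => (pos th + spd th * t <= x)%R%:R * psi t x) t (bmeas_front_slice th)).
Qed.

End against_test.

Let bt t (psi : R -> R) : bmeas psi ->
  bmeas (fun z : R * R => (pos z.1 + spd z.1 * t <= z.2)%R%:R * psi z.2).
Proof.
move=> bpsi; apply: bmeasM; first exact: (bI' (f := fun=> t) (g := snd) (h := fst)).
exact: bmeas_comp bpsi.
Qed.

Let bs t x dg : bmeas dg -> bmeas (fun th => (pos th + spd th * t <= x)%R%:R * dg th).
Proof.
by move=> bdg; apply: bmeasM => //; exact: (bI' (f := fun=> t) (g := fun=> x) (h := id)).
Qed.

Lemma bmeas_cut t (psi : R -> R) (x1 x2 : R) : bmeas psi ->
  (forall x, ~~ (x1 <= x <= x2) -> psi x = 0) ->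
  bmeas (fun th => Rint setT (fun x => (pos th + spd th * t <= x)%R%:R * psi x)).
Proof.
move=> bpsi psi0; rewrite (_ : (fun _ => _) = fun th => integ x1 x2
   (fun x => (pos th + spd th * t <= x)%R%:R * psi x)).
  exact: (bmeas_param _ _ (bt t bpsi)).
apply/funext => th; apply: Rint_setT_integ => x h.
by rewrite psi0 ?mulr0.
Qed.

Let integ_fronts_test dg (x1 x2 t : R) (psi : R -> R) : bmeas dg -> bmeas psi ->
  integ x1 x2 (fun x => fronts dg t x * psi x) =
  integ 0 1 (fun th => dg th * integ x1 x2 (fun x => (pos th + spd th * t <= x)%R%:R * psi x)).
Proof.
move=> bdg bpsi.
pose f x th : R := dg th * ((pos th + spd th * t <= x)%R%:R * psi x).
transitivity (integ x1 x2 (fun x => integ 0 1 (f x))).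
  apply: eq_integ => x _; rewrite mulrC /fronts -integZ; last exact: bs.
  by apply: eq_integ => th _; rewrite /f/=; ring.
rewrite (@integ_swap _ x1 x2 0 1 (fun z => f z.1 z.2)); last first.
  apply: bmeasM; first exact: bmeas_comp bdg.
  exact: (bmeas_comp (@measurable_swap _ _ R R) (bt t bpsi)).
apply: eq_integ => th _; rewrite -integZ//.
exact: (@bmeas_slice1 R (fun th x => (pos th + spd th * t <= x)%R%:R * psi x) th (bt t bpsi)).
Qed.

Lemma Rint_fronts dg (x1 x2 t : R) (psi : R -> R) : bmeas dg -> bmeas psi ->
  (forall x, ~~ (x1 <= x <= x2) -> psi x = 0) ->
  Rint setT (fun x => fronts dg t x * psi x) =
  integ 0 1 (fun th => dg th * Rint setT (fun x => (pos th + spd th * t <= x)%R%:R * psi x)).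
Proof.
move=> bdg bpsi psi0; rewrite (@Rint_setT_integ _ x1 x2).
  rewrite integ_fronts_test//; apply: eq_integ => th _; congr (_ * _).
  by apply/esym/Rint_setT_integ => x h; rewrite psi0 ?mulr0.
by move=> x h; rewrite psi0 ?mulr0.
Qed.

Lemma integ_fronts dg (x1 x2 t : R) : bmeas dg ->
  (forall th, 0 <= th <= 1 -> x1 <= pos th + spd th * t <= x2) ->
  integ x1 x2 (fronts dg t) = integ 0 1 (fun th => dg th * (x2 - (pos th + spd th * t))).
Proof.
move=> bdg h.
transitivity (integ x1 x2 (fun x => fronts dg t x * 1)).
  by apply: eq_integ => x _; rewrite mulr1.
rewrite integ_fronts_test//; last exact: bmeas_cst.
apply: eq_integ => th /h /andP[h1 h2]; congr (_ * _).
pose f x : R := (pos th + spd th * t <= x <= x2)%R%:R.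
transitivity (integ x1 x2 f).
  by apply: eq_integ => x /andP[_ xx2]; rewrite /f xx2 andbT mulr1.
rewrite -(@Rint_setT_integ _ x1 x2 f).
  rewrite (@Rint_setT_integ _ (pos th + spd th * t) x2 f).
    rewrite -[RHS]mul1r -integ_cst//; apply: eq_integ => x hx.
    by rewrite /f hx.
  by move=> x /negbTE hx; rewrite /f hx.
move=> x hx; rewrite /f (_ : _ && _ = false)//; apply: contraNF hx => /andP[xa xb].
by rewrite (le_trans h1 xa) xb.
Qed.

(** [dG = spd * dg] is the Rankine-Hugoniot relation of the infinitesimal step [th]; under it the
    identity holds step by step, by [front_line]. *)
Lemma weak_fronts T phi phit phix t1 t2 x1 x2 dg dG : 0 <= T -> t2 < T ->
  C1_supp phi phit phix t1 t2 x1 x2 -> bmeas dg -> bmeas dG ->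
  (forall th, dG th = spd th * dg th) ->
  dint T (fun t x => fronts dg t x * phit t x) +
  dint T (fun t x => fronts dG t x * phix t x) +
  Rint setT (fun x => fronts dg 0 x * phi 0 x) = 0.
Proof.
move=> T0 t2T C1 bdg bdG dGE.
have bt' := bmeas_phit C1; have bx' := bmeas_phix C1.
have t0 t x : ~~ (x1 <= x <= x2) -> phit t x = 0.
  by move=> h; apply: (phit_supp0 C1) => -[_]; exact/negP.
have x0 t x : ~~ (x1 <= x <= x2) -> phix t x = 0.
  by move=> h; apply: (phix_supp0 C1) => -[_]; exact/negP.
have p0 x : ~~ (x1 <= x <= x2) -> phi 0 x = 0.
  by move=> h; apply: (supp0 C1) => -[_]; exact/negP.
rewrite (dint_fronts T bt' t0 bdg) (dint_fronts T bx' x0 bdG).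
rewrite (Rint_fronts 0 bdg (bmeas_phi C1 0) p0).
have bA := bmeas_front_test T bt' t0; have bB := bmeas_front_test T bx' x0.
have bC := bmeas_cut 0 (bmeas_phi C1 0) p0.
rewrite -!integD; try by repeat apply: bmeasD; apply: bmeasM.
rewrite -[RHS](mul0r (1 - 0)) -integ_cst//; apply: eq_integ => th _.
have := front_line C1 (pos th) (spd th) T0 t2T.
rewrite (_ : integ 0 T _ = front_test T phit th + spd th * front_test T phix th).
  rewrite dGE mulr0 addr0 => E; transitivity (dg th * 0); last by rewrite mulr0.
  by rewrite -[X in _ = _ * X]E; ring.
pose I t x : R := (pos th + spd th * t <= x)%R%:R.
have bi psi : bmeas (fun z : R * R => psi z.1 z.2) ->
    bmeas (fun z : R * R => I z.1 z.2 * psi z.1 z.2).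
  by move=> bp; exact: bmeas_front_slice.
have fE psi : (forall t x, ~~ (x1 <= x <= x2) -> psi t x = 0) ->
    front_test T psi th = integ 0 T (fun t => integ x1 x2 (fun x => I t x * psi t x)).
  move=> p; apply: eq_integ => t _; apply: Rint_setT_integ => x h.
  by rewrite p ?mulr0.
rewrite !fE// -integZ; last first.
  exact: (@bmeas_param R _ R x1 x2 (fun z : R * R => I z.1 z.2 * phix z.1 z.2) (bi _ bx')).
rewrite -integD; last 2 first.
- exact: (@bmeas_param R _ R x1 x2 (fun z : R * R => I z.1 z.2 * phit z.1 z.2) (bi _ bt')).
- apply: bmeasM; first exact: bmeas_cst.
  exact: (@bmeas_param R _ R x1 x2 (fun z : R * R => I z.1 z.2 * phix z.1 z.2) (bi _ bx')).
apply: eq_integ => t _.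
have b1 := @bmeas_slice1 R (fun t x => I t x * phit t x) t (bi _ bt').
have b2 := @bmeas_slice1 R (fun t x => I t x * phix t x) t (bi _ bx').
rewrite -integZ// -integD//; last by apply: bmeasM => //; exact: bmeas_cst.
rewrite (@Rint_setT_integ _ x1 x2).
  by apply: eq_integ => x _; rewrite /I; ring.
by move=> x h; rewrite t0 ?x0// mulr0 addr0 mulr0.
Qed.

Lemma front_test_x T phi phit phix t1 t2 x1 x2 th :
  C1_supp phi phit phix t1 t2 x1 x2 ->
  front_test T phix th = integ 0 T (fun t => - phi t (pos th + spd th * t)).
Proof. by move=> C1; apply: eq_integ => t _; rewrite (front_x C1). Qed.

Lemma bmeas_phi_line phi phit phix t1 t2 x1 x2 (c s : R) :
  C1_supp phi phit phix t1 t2 x1 x2 -> bmeas (fun t => phi t (c + s * t)).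
Proof.
move=> C1; have [dt dx ct cx _] := C1.
have dl t := @is_derive_line _ phi phit phix c s t dt dx ct cx.
apply: (@continuous_bmeas1 _ _ t1 t2 (is_derive_continuous dl)) => t h.
by apply: (supp0 C1) => -[h1 _]; move/negP: h; exact.
Qed.

Lemma front_test_x_le0 T phi phit phix t1 t2 x1 x2 th :
  C1_supp phi phit phix t1 t2 x1 x2 -> (forall t x, 0 <= phi t x) ->
  0 <= T -> front_test T phix th <= 0.
Proof.
move=> C1 p0 T0; rewrite (front_test_x _ _ C1) -[leRHS](mul0r (T - 0)) -integ_cst//.
apply: le_integ.
- by apply: bmeasN; exact: bmeas_phi_line C1.
- exact: bmeas_cst.
- by move=> t _; rewrite oppr_le0.
Qed.

Lemma norm_front_test_x T phi phit phix t1 t2 x1 x2 M th :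
  C1_supp phi phit phix t1 t2 x1 x2 -> (forall t x, `|phi t x| <= M) ->
  0 <= T -> `|front_test T phix th| <= M * T.
Proof.
move=> C1 pM T0; rewrite (front_test_x _ _ C1) -[T in leRHS]subr0.
apply: norm_integ_le => //; first by apply: bmeasN; exact: bmeas_phi_line C1.
by move=> t _; rewrite normrN.
Qed.

(** A step tested against [phix] returns values of [phi] along the front, so the bound involves
    [phi] and none of its derivatives, as bounded variation demands. *)
Lemma norm_dint_fronts T phi phit phix t1 t2 x1 x2 dg M N : 0 <= T ->
  C1_supp phi phit phix t1 t2 x1 x2 -> bmeas dg ->
  (forall th, `|dg th| <= N) -> (forall t x, `|phi t x| <= M) ->
  `|dint T (fun t x => fronts dg t x * phix t x)| <= N * (M * T).
Proof.
move=> T0 C1 bdg dN pM; have bx' := bmeas_phix C1.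
have x0 t x : ~~ (x1 <= x <= x2) -> phix t x = 0.
  by move=> h; apply: (phix_supp0 C1) => -[_]; exact/negP.
rewrite (dint_fronts T bx' x0 bdg) -[leRHS]mulr1 -[1 in leRHS]subr0.
apply: norm_integ_le => //.
  by apply: bmeasM => //; exact: bmeas_front_test bx' x0.
move=> th _; rewrite normrM ler_pM//.
exact: norm_front_test_x C1 pM T0.
Qed.

(** With [spd * dg] in place of [dG] the sum is 0 by [weak_fronts]. The defect [dG - spd * dg <= 0]
    is paired with [front_test T phix], which is nonpositive for [phi >= 0]. *)
Lemma entropy_fronts T phi phit phix t1 t2 x1 x2 dg dG : 0 <= T -> 0 < t1 -> t2 < T ->
  C1_supp phi phit phix t1 t2 x1 x2 -> (forall t x, 0 <= phi t x) ->
  bmeas dg -> bmeas dG -> bmeas (fun th => spd th * dg th) ->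
  (forall th, dG th <= spd th * dg th) ->
  0 <= dint T (fun t x => fronts dg t x * phit t x) +
       dint T (fun t x => fronts dG t x * phix t x).
Proof.
move=> T0 t10 t2T C1 p0 bdg bdG bd dGE; have bx' := bmeas_phix C1.
have x0 t x : ~~ (x1 <= x <= x2) -> phix t x = 0.
  by move=> h; apply: (phix_supp0 C1) => -[_]; exact/negP.
have := weak_fronts T0 t2T C1 bdg bd (fun=> erefl).
rewrite (_ : Rint setT _ = 0); last first.
  rewrite (_ : (fun x => _) = fun=> 0) /Rint ?Rintegral_cst ?mul0r//.
  apply/funext => x; rewrite (supp0 C1) ?mulr0// => -[/andP[+ _] _].
  by rewrite leNgt t10.
rewrite addr0 => <-; rewrite lerD2l.
rewrite (dint_fronts T bx' x0 bdG) (dint_fronts T bx' x0 bd).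
have bB := bmeas_front_test T bx' x0.
apply: le_integ; [exact: bmeasM|exact: bmeasM|move=> th _].
by apply: ler_wnM2r => //; exact: front_test_x_le0 C1 p0 T0.
Qed.

End superposition.

(** * Rules of differentiation *)

Section derivatives.
Context {R : realType}.
Implicit Types (f g : R -> R) (x a b : R).

Lemma isd_cst x (c : R) : is_derive x 1 (fun=> c) 0.
Proof. exact: is_derive_cst. Qed.

Lemma isd_id x : is_derive x 1 (fun y : R => y) 1.
Proof. exact: is_derive_id. Qed.

Lemma isd_add f g x a b : is_derive x 1 f a -> is_derive x 1 g b ->
  is_derive x 1 (fun y => f y + g y) (a + b).
Proof. by move=> df dg; exact: is_deriveD. Qed.

Lemma isd_opp f x a : is_derive x 1 f a -> is_derive x 1 (fun y => - f y) (- a).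
Proof. by move=> df; exact: is_deriveN. Qed.

Lemma isd_mul f g x a b : is_derive x 1 f a -> is_derive x 1 g b ->
  is_derive x 1 (fun y => f y * g y) (f x * b + g x * a).
Proof. by move=> df dg; exact: is_deriveM. Qed.

Lemma isd_sqr f x a : is_derive x 1 f a ->
  is_derive x 1 (fun y => f y ^+ 2) (2 * f x * a).
Proof.
move=> df; have := isd_mul df df; rewrite (_ : (fun y => _) = fun y => f y ^+ 2).
  by move/is_derive_eq; apply; ring.
by apply/funext => y; rewrite expr2.
Qed.

Lemma isd_inv f x a : f x != 0 -> is_derive x 1 f a ->
  is_derive x 1 (fun y => (f y)^-1) (- a / f x ^+ 2).
Proof.
move=> fx df; apply: is_derive_eq (is_deriveV fx df) _.
by rewrite [LHS]mulrC mulNr mulrN.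
Qed.

Lemma isd_comp f g x a b : is_derive (g x) 1 f a -> is_derive x 1 g b ->
  is_derive x 1 (fun y => f (g y)) (a * b).
Proof. by move=> df dg; exact: is_derive1_comp. Qed.

Lemma isd_sqrt f x a : 0 < f x -> is_derive x 1 f a ->
  is_derive x 1 (fun y => Num.sqrt (f y)) (a / (2 * Num.sqrt (f x))).
Proof. by move=> fx df; rewrite mulrC; apply: isd_comp; exact: is_derive1_sqrt. Qed.

Lemma isd_powR f x a (p : R) : 0 < f x -> is_derive x 1 f a ->
  is_derive x 1 (fun y => f y `^ p) (p * f x `^ (p - 1) * a).
Proof.
by move=> fx df; apply: (isd_comp (f := fun z => z `^ p)); exact: is_derive1_powR.
Qed.

End derivatives.

(** * Conservative variables, gradient of the entropy and relative entropy *)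

Section states.
Context {R : realType}.
Implicit Types (U V W : state R) (gamma beta : R).

Lemma mkstate_v (v q u w : R) : st_v (mkstate v q u w) = v.
Proof. by rewrite /st_v mxE inordK. Qed.
Lemma mkstate_q (v q u w : R) : st_q (mkstate v q u w) = q.
Proof. by rewrite /st_q mxE inordK. Qed.
Lemma mkstate_u (v q u w : R) : st_u (mkstate v q u w) = u.
Proof. by rewrite /st_u mxE inordK. Qed.
Lemma mkstate_w (v q u w : R) : st_w (mkstate v q u w) = w.
Proof. by rewrite /st_w mxE inordK. Qed.

Definition mkstateE := (mkstate_v, mkstate_q, mkstate_u, mkstate_w).

Lemma mkstateK U : mkstate (st_v U) (st_q U) (st_u U) (st_w U) = U.
Proof.
apply/rowP => i; rewrite mxE.
case: i => -[|[|[|[|//]]]] h /=; congr (U _ _); apply/val_inj; rewrite /= inordK//.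
Qed.

Lemma ord4_ind (P : 'I_4 -> Prop) : P (inord 0) -> P (inord 1) ->
  P (inord 2) -> P (inord 3) -> forall i, P i.
Proof.
move=> P0 P1 P2 P3 -[[|[|[|[|//]]]] h].
- by rewrite (_ : Ordinal h = inord 0)//; apply/val_inj; rewrite /= inordK.
- by rewrite (_ : Ordinal h = inord 1)//; apply/val_inj; rewrite /= inordK.
- by rewrite (_ : Ordinal h = inord 2)//; apply/val_inj; rewrite /= inordK.
- by rewrite (_ : Ordinal h = inord 3)//; apply/val_inj; rewrite /= inordK.
Qed.

Lemma sum4 (f : 'I_4 -> R) :
  \sum_i f i = f (inord 0) + f (inord 1) + f (inord 2) + f (inord 3).
Proof.
rewrite !big_ord_recl big_ord0 addr0 !addrA.
by congr (f _ + f _ + f _ + f _); apply/val_inj; rewrite /= inordK.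
Qed.

(** Total pressure, gas plus magnetic; [- Pi] is the derivative of the entropy in [v] at fixed
    [q]. *)
Definition Pi gamma U : R := pressure gamma (st_v U) + st_B U ^+ 2 / 2.

Definition grad_eta gamma U (i : 'I_4) : R :=
  [:: - Pi gamma U; st_B U; st_u U; st_w U]`_i.

Lemma derive_eta gamma V W : 1 < gamma -> admissible V ->
  derive (eta gamma) V W = \sum_i grad_eta gamma V i * W ord0 i.
Proof.
move=> g1 v0; pose F (h : R) := eta gamma (h *: W + V).
have -> : derive (eta gamma) V W = derive F 0 1.
  rewrite /derive; set f := (X in lim (X @ _)); set g := (X in _ = lim (X @ _)).
  suff -> : f = g by [].
  apply/funext => h; rewrite /f /g /F /=.
  by rewrite [h *: 1]mulr1 addr0 scale0r add0r.
have E i h : (h *: W + V) ord0 i = h * W ord0 i + V ord0 i by rewrite !mxE.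
rewrite /F /eta /st_v /st_q /st_u /st_w.
under eq_fun do rewrite !E.
rewrite sum4 /grad_eta !inordK//= /Pi /st_B /pressure.
move: v0; rewrite /admissible /st_u /st_v /st_q /st_w.
set W0 := W ord0 (inord 0); set W1 := W ord0 (inord 1).
set W2 := W ord0 (inord 2); set W3 := W ord0 (inord 3).
set V0 := V ord0 (inord 0); set V1 := V ord0 (inord 1).
set V2 := V ord0 (inord 2); set V3 := V ord0 (inord 3) => v0.
have dl (A B : R) : is_derive (0 : R) 1 (fun h => h * A + B) A.
  by apply: is_derive_eq (isd_add (isd_mul (isd_id _) (isd_cst _ _)) (isd_cst _ _)) _; rewrite mulr0 add0r addr0 mulr1.
have p0 : 0 < 0 * W0 + V0 by rewrite mul0r add0r.
have p0' : 2 * (0 * W0 + V0) != 0 by rewrite mulf_neq0// gt_eqF.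
have := isd_add (isd_add (isd_mul (@isd_powR R (fun h => h * W0 + V0) 0 W0 (1 - gamma) p0 (dl W0 V0)) (isd_cst 0 (gamma - 1)^-1))
  (isd_mul (isd_add (isd_sqr (dl W2 V2)) (isd_sqr (dl W3 V3))) (isd_cst 0 2^-1)))
  (isd_mul (isd_sqr (dl W1 V1)) (@isd_inv R (fun h => 2 * (h * W0 + V0)) 0 _ p0' (isd_mul (isd_cst 0 2) (dl W0 V0)))).
move/(@derive_val _ _ _ _ _ _ _) => ->.
rewrite !mul0r !add0r (_ : 1 - gamma - 1 = - gamma); last by ring.
have g0 : gamma - 1 != 0 by rewrite subr_eq0 gt_eqF.
by field; rewrite g0 gt_eqF.
Qed.

Lemma rel_entropyE gamma U V : 1 < gamma -> admissible V ->
  rel_entropy gamma U V =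
  eta gamma U - eta gamma V - \sum_i grad_eta gamma V i * (U ord0 i - V ord0 i).
Proof.
move=> g1 v0; rewrite /rel_entropy derive_eta//; congr (_ - _).
by apply: eq_bigr => i _; rewrite !mxE.
Qed.

End states.

(** * Linearity of the tested integral and the contribution of constants *)

Section linear_dint.
Context {R : realType}.
Implicit Types (t x T : R).

Definition tame (x1 x2 : R) (g : R -> R -> R) : Prop :=
  bmeas (fun z : R * R => g z.1 z.2) /\
  forall t x, ~~ (x1 <= x <= x2) -> g t x = 0.

Lemma tameD (x1 x2 : R) g h : tame x1 x2 g -> tame x1 x2 h ->
  tame x1 x2 (fun t x => g t x + h t x).
Proof.
move=> [bg g0] [bh h0]; split; first exact: bmeasD.
by move=> t x hx; rewrite g0 ?h0 ?addr0.
Qed.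

Lemma tameM (x1 x2 : R) g h : bmeas (fun z : R * R => g z.1 z.2) -> tame x1 x2 h ->
  tame x1 x2 (fun t x => g t x * h t x).
Proof.
move=> bg [bh h0]; split; first exact: bmeasM.
by move=> t x hx; rewrite h0 ?mulr0.
Qed.

Lemma tame_sum (x1 x2 : R) n (g : 'I_n -> R -> R -> R) :
  (forall i, tame x1 x2 (g i)) -> tame x1 x2 (fun t x => \sum_i g i t x).
Proof.
move=> tg; split.
  by apply: (@bmeas_sum R _ _ _ _ (fun i (z : R * R) => g i z.1 z.2)) => i; case: (tg i).
by move=> t x hx; rewrite big1// => i _; case: (tg i) => _ ->.
Qed.

Lemma dintD T (x1 x2 : R) g h : tame x1 x2 g -> tame x1 x2 h ->
  dint T (fun t x => g t x + h t x) = dint T g + dint T h.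
Proof.
move=> tg th; have [bg g0] := tg; have [bh h0] := th; have [bgh gh0] := tameD tg th.
rewrite (dint_integ T bg g0) (dint_integ T bh h0) (dint_integ T bgh gh0) -integD.
- apply: eq_integ => t _; rewrite -integD//; first exact: bmeas_slice1.
  exact: bmeas_slice1.
- exact: (@bmeas_param R _ R x1 x2 (fun z : R * R => g z.1 z.2)).
- exact: (@bmeas_param R _ R x1 x2 (fun z : R * R => h z.1 z.2)).
Qed.

Lemma dintZ T (x1 x2 : R) (k : R) g : tame x1 x2 g ->
  dint T (fun t x => k * g t x) = k * dint T g.
Proof.
move=> tg; have [bg g0] := tg.
have [bgh gh0] := tameM (bmeas_cst _ k) tg.
rewrite (dint_integ T bg g0) (dint_integ T bgh gh0) -integZ.
- by apply: eq_integ => t _; rewrite -integZ//; exact: bmeas_slice1.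
- exact: (@bmeas_param R _ R x1 x2 (fun z : R * R => g z.1 z.2)).
Qed.

Lemma dint_sum T (x1 x2 : R) n (g : 'I_n -> R -> R -> R) :
  (forall i, tame x1 x2 (g i)) ->
  dint T (fun t x => \sum_i g i t x) = \sum_i dint T (g i).
Proof.
move=> tg; have [bg g0] := tame_sum tg; rewrite (dint_integ T bg g0).
have bi i : bmeas (fun z : R * R => g i z.1 z.2) by case: (tg i).
transitivity (integ 0 T (fun t => \sum_i integ x1 x2 (g i t))).
  by apply: eq_integ => t _; rewrite integ_sum// => i; exact: bmeas_slice1.
rewrite integ_sum.
  by apply: eq_bigr => i _; case: (tg i) => bgi gi0; rewrite (dint_integ T bgi gi0).
by move=> i; exact: (@bmeas_param R _ R x1 x2 (fun z : R * R => g i z.1 z.2)).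
Qed.

Lemma eq_dint T g h : (forall t x, 0 < t < T -> g t x = h t x) ->
  dint T g = dint T h.
Proof.
move=> gh; apply: eq_Rintegral => t; rewrite inE/= in_itv/= => tT.
by apply: eq_Rintegral => x _; exact: gh.
Qed.

Section test_const.
Variables (phi phit phix : R -> R -> R) (t1 t2 x1 x2 T : R).
Hypotheses (T0 : 0 <= T) (t2T : t2 < T).
Hypothesis C1 : C1_supp phi phit phix t1 t2 x1 x2.

Lemma tame_phit : tame x1 x2 phit.
Proof.
split; first exact: bmeas_phit C1.
by move=> t x h; apply: (phit_supp0 C1) => -[_]; exact/negP.
Qed.

Lemma tame_phix : tame x1 x2 phix.
Proof.
split; first exact: bmeas_phix C1.
by move=> t x h; apply: (phix_supp0 C1) => -[_]; exact/negP.
Qed.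

(** On the support of the test function the constant 1 coincides with a standing front placed left
    of it, at [x1 - 1]; constant backgrounds are thus covered by the identities for fronts. *)
Let one t x : x1 <= x ->
  fronts (fun=> x1 - 1) (fun=> 0) (fun=> 1) t x = 1.
Proof.
move=> h; rewrite /fronts (@eq_integ _ 0 1 _ (fun=> 1)).
  by rewrite integ_cst// subr0 mulr1.
move=> th _; rewrite mul0r addr0 mulr1.
by rewrite (_ : (_ <= _) = true)//; apply: le_trans h; rewrite gerBl.
Qed.

Let oneM (g : R -> R -> R) t x : (forall t x, ~~ (x1 <= x <= x2) -> g t x = 0) ->
  fronts (fun=> x1 - 1) (fun=> 0) (fun=> 1) t x * g t x = g t x.
Proof.
move=> g0; have [h|h] := boolP (x1 <= x <= x2); last by rewrite g0 ?mulr0.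
by rewrite one ?mul1r//; case/andP: h.
Qed.

Lemma dint_phix : dint T phix = 0.
Proof.
rewrite /dint (_ : (fun t => _) = fun=> 0) /Rint ?Rintegral_cst ?mul0r//.
apply/funext => t; rewrite -[LHS]/(Rint setT (phix t)).
have := front_x C1 t (x1 - 1); rewrite (supp0 C1) ?oppr0; last first.
  by move=> -[_ /andP[+ _]]; apply/negP; rewrite -ltNge; lra.
move=> <-; congr Rint; apply/funext => x.
have [h|h] := boolP (x1 <= x <= x2).
  by rewrite (_ : (_ <= _) = true) ?mul1r//; case/andP: h => h _; lra.
by have [_ ->] := tame_phix; rewrite ?mulr0.
Qed.

Lemma dint_phit : dint T phit + Rint setT (phi 0) = 0.
Proof.
have := @weak_fronts R (fun=> x1 - 1) (fun=> 0) (measurable_cst _) (measurable_cst _)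
  T phi phit phix t1 t2 x1 x2 (fun=> 1) (fun=> 0) T0 t2T C1
  (bmeas_cst _ _) (bmeas_cst _ _) (fun th => esym (mul0r _)).
have -> : dint T (fun t x => fronts (fun=> x1 - 1) (fun=> 0) (fun=> 1) t x * phit t x) = dint T phit.
  by apply: eq_dint => t x _; apply: oneM; case: tame_phit.
have -> : dint T (fun t x => fronts (fun=> x1 - 1) (fun=> 0) (fun=> 0) t x * phix t x) = 0 * dint T phix.
  rewrite -(dintZ _ _ tame_phix); apply: eq_dint => t x _; congr (_ * _).
  rewrite /fronts (@eq_integ _ 0 1 _ (fun=> 0)) ?integ_cst ?mul0r//.
  by move=> th _; rewrite mulr0.
rewrite mul0r addr0 => E; rewrite -[RHS]E; congr (_ + Rint _ _); apply/funext => x.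
rewrite (@oneM phi)// => t y h.
by apply: (supp0 C1) => -[_]; exact/negP.
Qed.

End test_const.
End linear_dint.

(** The four kinds of densities live on common fronts. [w_dFE] is conservation across each front,
    while [w_dqE] is an inequality since a shock may dissipate. Speeds are only asked to be
    measurable, hence the separate bound [w_bsde]. *)
Record wave (R : realType) := Wave {
  w_pos : R -> R; w_spd : R -> R;
  w_dU : 'I_4 -> R -> R; w_dF : 'I_4 -> R -> R; w_de : R -> R; w_dq : R -> R;
  w_bpos : bmeas w_pos;
  w_mspd : measurable_fun setT w_spd;
  w_bdU : forall i, bmeas (w_dU i);
  w_bdF : forall i, bmeas (w_dF i);
  w_bde : bmeas w_de;
  w_bdq : bmeas w_dq;
  w_bsde : bmeas (fun th => w_spd th * w_de th);
  w_dFE : forall i th, w_dF i th = w_spd th * w_dU i th;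
  w_dqE : forall th, w_dq th <= w_spd th * w_de th }.

Lemma w_mpos (R : realType) (w : wave R) : measurable_fun setT (w_pos w).
Proof. by case: (w_bpos w). Qed.

(** * Finite sums of waves over a constant background *)

Section wave_sums.
Context {R : realType}.
Variables (n : nat) (w : 'I_n -> wave R).
Implicit Types (t x T c k : R) (d D : 'I_n -> R -> R).

Definition wsum d t x : R := \sum_j fronts (w_pos (w j)) (w_spd (w j)) (d j) t x.

Lemma bmeas_wsum d : (forall j, bmeas (d j)) -> bmeas (fun z : R * R => wsum d z.1 z.2).
Proof.
move=> bd; apply: (@bmeas_sum R _ _ _ _ (fun j (z : R * R) =>
  fronts (w_pos (w j)) (w_spd (w j)) (d j) z.1 z.2)) => j.
by apply: bmeas_fronts => //; [exact: w_mpos|exact: w_mspd].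
Qed.

Lemma dint_wsum T x1 x2 d c psi : (forall j, bmeas (d j)) -> tame x1 x2 psi ->
  dint T (fun t x => (c + wsum d t x) * psi t x) =
  c * dint T psi +
  \sum_j dint T (fun t x => fronts (w_pos (w j)) (w_spd (w j)) (d j) t x * psi t x).
Proof.
move=> bd tp.
have tj j : tame x1 x2 (fun t x => fronts (w_pos (w j)) (w_spd (w j)) (d j) t x * psi t x).
  by apply: tameM tp; apply: bmeas_fronts => //; [exact: w_mpos|exact: w_mspd].
rewrite -(dint_sum _ tj) -(dintZ _ _ tp) -(@dintD _ _ x1 x2).
- by apply: eq_dint => t x _; rewrite mulrDl /wsum mulr_suml.
- by apply: (tameM (g := fun _ _ => c)) tp; exact: bmeas_cst.
- exact: tame_sum.
Qed.

Section test.
Variables (phi phit phix : R -> R -> R) (t1 t2 x1 x2 T : R).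
Hypotheses (T0 : 0 <= T) (t2T : t2 < T).
Hypothesis C1 : C1_supp phi phit phix t1 t2 x1 x2.

Lemma Rint_wsum d c : (forall j, bmeas (d j)) ->
  Rint setT (fun x => (c + wsum d 0 x) * phi 0 x) =
  c * Rint setT (phi 0) +
  \sum_j Rint setT (fun x => fronts (w_pos (w j)) (w_spd (w j)) (d j) 0 x * phi 0 x).
Proof.
move=> bd.
have p0 x : ~~ (x1 <= x <= x2) -> phi 0 x = 0.
  by move=> h; apply: (supp0 C1) => -[_]; exact/negP.
have bp := bmeas_phi C1 0.
have bf j : bmeas (fun x => fronts (w_pos (w j)) (w_spd (w j)) (d j) 0 x * phi 0 x).
  apply: bmeasM => //; apply: bmeas_slice1; apply: bmeas_fronts => //; [exact: w_mpos|exact: w_mspd].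
rewrite (Rint_setT_integ p0) (@Rint_setT_integ _ x1 x2); last first.
  by move=> x h; rewrite p0 ?mulr0.
transitivity (integ x1 x2 (fun x => c * phi 0 x +
   \sum_j fronts (w_pos (w j)) (w_spd (w j)) (d j) 0 x * phi 0 x)).
  by apply: eq_integ => x _; rewrite mulrDl /wsum mulr_suml.
rewrite integD; last 2 first.
- by apply: bmeasM => //; exact: bmeas_cst.
- exact: bmeas_sum.
rewrite integZ// integ_sum//; congr (_ + _); apply: eq_bigr => j _.
by apply/esym/Rint_setT_integ => x h; rewrite p0 ?mulr0.
Qed.

Lemma weak_wsum d D c c' : (forall j, bmeas (d j)) -> (forall j, bmeas (D j)) ->
  (forall j th, D j th = w_spd (w j) th * d j th) ->
  dint T (fun t x => (c + wsum d t x) * phit t x + (c' + wsum D t x) * phix t x) +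
  Rint setT (fun x => (c + wsum d 0 x) * phi 0 x) = 0.
Proof.
move=> bd bD dD; have tt := tame_phit C1; have tx := tame_phix C1.
rewrite (@dintD _ _ x1 x2); last 2 first.
- by apply: tameM tt; apply: bmeasD; [exact: bmeas_cst|exact: bmeas_wsum].
- by apply: tameM tx; apply: bmeasD; [exact: bmeas_cst|exact: bmeas_wsum].
rewrite (dint_wsum T c bd tt) (dint_wsum T c' bD tx) Rint_wsum// (dint_phix T C1) mulr0 add0r.
rewrite (_ : _ + _ + _ = c * (dint T phit + Rint setT (phi 0)) +
  \sum_j (dint T (fun t x => fronts (w_pos (w j)) (w_spd (w j)) (d j) t x * phit t x) +
   dint T (fun t x => fronts (w_pos (w j)) (w_spd (w j)) (D j) t x * phix t x) +
   Rint setT (fun x => fronts (w_pos (w j)) (w_spd (w j)) (d j) 0 x * phi 0 x))).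
  rewrite (dint_phit T0 t2T C1) mulr0 add0r big1// => j _.
  by apply: weak_fronts T0 t2T C1 (bd j) (bD j) (dD j); [exact: w_mpos|exact: w_mspd].
by rewrite !big_split/=; ring.
Qed.

Lemma entropy_wsum c c' : 0 < t1 -> (forall t x, 0 <= phi t x) ->
  0 <= dint T (fun t x => (c + wsum (fun j => w_de (w j)) t x) * phit t x +
                          (c' + wsum (fun j => w_dq (w j)) t x) * phix t x).
Proof.
move=> t10 p0; have tt := tame_phit C1; have tx := tame_phix C1.
have bd j : bmeas (w_de (w j)) by exact: w_bde.
have bD j : bmeas (w_dq (w j)) by exact: w_bdq.
rewrite (@dintD _ _ x1 x2); last 2 first.
- by apply: tameM tt; apply: bmeasD; [exact: bmeas_cst|exact: bmeas_wsum].
- by apply: tameM tx; apply: bmeasD; [exact: bmeas_cst|exact: bmeas_wsum].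
rewrite (dint_wsum T c bd tt) (dint_wsum T c' bD tx) (dint_phix T C1) mulr0 add0r.
have -> : dint T phit = 0.
  have := dint_phit T0 t2T C1; rewrite (_ : phi 0 = fun=> 0).
    by rewrite /Rint Rintegral_cst// mul0r addr0.
  by apply/funext => x; apply: (supp0 C1) => -[/andP[+ _] _]; rewrite leNgt t10.
rewrite mulr0 add0r -big_split sumr_ge0//= => j _.
apply: entropy_fronts T0 t10 t2T C1 p0 _ _ _ _;
  [exact: w_mpos|exact: w_mspd|exact: w_bde|exact: w_bdq|exact: w_bsde|exact: w_dqE].
Qed.

End test.
End wave_sums.

(** * A growing energy excludes a-contraction *)

Section half_lines.
Context {R : realType}.
Implicit Types (h M x : R) (f : R -> R).

Lemma integral_left h M f : bmeas f -> (forall x, x < M -> f x = 0) ->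
  (\int[@lebesgue_measure R]_(x in `]-oo, h[) (f x)%:E = (integ M h f)%:E)%E.
Proof.
move=> bf f0; rewrite (@integral_itv_bndo_bndc R -oo%O h (fun x => (f x)%:E)); last first.
  by apply/measurable_EFinP; apply: measurable_funS (bf.1).
rewrite -integ_mkcond_EFin// integral_mkcond; apply: eq_integral => x _.
rewrite patchE mem_setE !in_itv/=; have [xM|xM] := ltP x M.
  by rewrite f0// mul0r if_same.
by case: ifP => _; rewrite ?mulr1 ?mulr0.
Qed.

Lemma integral_right h M f : bmeas f -> (forall x, M < x -> f x = 0) ->
  (\int[@lebesgue_measure R]_(x in `]h, +oo[) (f x)%:E = (integ h M f)%:E)%E.
Proof.
move=> bf f0; rewrite (@integral_itv_obnd_cbnd R h +oo%O (fun x => (f x)%:E)); last first.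
  by apply/measurable_EFinP; apply: measurable_funS (bf.1).
rewrite -integ_mkcond_EFin// integral_mkcond; apply: eq_integral => x _.
rewrite patchE mem_setE !in_itv/= andbT; have [xM|xM] := ltP M x.
  by rewrite f0// mul0r if_same.
by rewrite andbT; case: ifP => _; rewrite ?mulr1 ?mulr0.
Qed.

Lemma not_null_itv (a b : R) (N : set R) : a < b ->
  (@lebesgue_measure R) N = 0%E -> measurable N -> exists2 x, a < x < b & ~ N x.
Proof.
move=> ab N0 mN; apply: contrapT => H.
have : ((@lebesgue_measure R) `]a, b[ <= (@lebesgue_measure R) N)%E.
  apply: le_measure; rewrite ?inE// => x; rewrite /= in_itv/= => xab.
  by apply: contrapT => Nx; apply: H; exists x.
by rewrite N0 lebesgue_measure_itv/= lte_fin ab -EFinD lee_fin subr_le0 leNgt ab.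
Qed.

End half_lines.

Section fronts_far.
Context {R : realType}.
Variables (pos spd : R -> R).
Hypotheses (mpos : measurable_fun setT pos) (mspd : measurable_fun setT spd).
Implicit Types (t x : R) (dg : R -> R).

Lemma fronts_before dg t x :
  (forall th, 0 <= th <= 1 -> x < pos th + spd th * t) -> fronts pos spd dg t x = 0.
Proof.
move=> h; rewrite /fronts -[RHS](mul0r (1 - 0)) -integ_cst//; apply: eq_integ => th /h.
by rewrite ltNge => /negbTE ->; rewrite mul0r.
Qed.

Lemma fronts_after dg t x :
  (forall th, 0 <= th <= 1 -> pos th + spd th * t <= x) ->
  fronts pos spd dg t x = integ 0 1 dg.
Proof. by move=> h; apply: eq_integ => th /h ->; rewrite mul1r. Qed.

Let bI t x : bmeas (fun th => (pos th + spd th * t <= x)%R%:R : R).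
Proof.
apply: bmeas_ler => //; apply: measurable_funD => //.
by apply: measurable_funM.
Qed.

Lemma fronts_lin (dg : R -> R) (k : 'I_4 -> R) (dk : 'I_4 -> R -> R) t x :
  bmeas dg -> (forall i, bmeas (dk i)) ->
  fronts pos spd (fun th => dg th - \sum_i k i * dk i th) t x =
  fronts pos spd dg t x - \sum_i k i * fronts pos spd (dk i) t x.
Proof.
move=> bdg bdk; pose I th : R := (pos th + spd th * t <= x)%R%:R.
have bk i : bmeas (fun th => (- k i) * (I th * dk i th)).
  by apply: bmeasM; [exact: bmeas_cst|apply: bmeasM => //; exact: bI].
transitivity (integ 0 1 (fun th => I th * dg th + \sum_i (- k i) * (I th * dk i th))).
  apply: eq_integ => th _; rewrite mulrDr; congr (_ + _).
  by rewrite mulrN mulr_sumr -sumrN; apply: eq_bigr => i _; rewrite /I; ring.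
rewrite integD; last 2 first.
- by apply: bmeasM => //; exact: bI.
- exact: bmeas_sum.
rewrite integ_sum// -sumrN; congr (_ + _); apply: eq_bigr => i _.
by rewrite integZ ?mulNr//; apply: bmeasM => //; exact: bI.
Qed.

End fronts_far.

Section criterion.
Context {R : realType}.
Variables (beta gamma a sigma : R) (Ul Ur V : state R).
Variables (nl nr : nat) (wl : 'I_nl -> wave R) (wr : 'I_nr -> wave R).
Variables (U : R -> R -> state R) (K : set (state R)) (delta M : R).
Implicit Types (t x th h T : R).

(** The relative entropy with respect to a fixed [W] is affine in the pair formed by [eta] and the
    state, so it too is carried by the fronts, with this density. *)
Definition w_rho (W : state R) (w : wave R) th : R :=
  w_de w th - \sum_i grad_eta gamma W i * w_dU w i th.

Hypotheses (g1 : 1 < gamma) (aUl : admissible Ul) (aUr : admissible Ur).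
Hypothesis d0 : 0 < delta.
Hypothesis winl : forall j t th, 0 <= t <= 1 -> 0 <= th <= 1 ->
  - M <= w_pos (wl j) th + w_spd (wl j) th * t <= - delta.
Hypothesis winr : forall j t th, 0 <= t <= 1 -> 0 <= th <= 1 ->
  delta <= w_pos (wr j) th + w_spd (wr j) th * t <= M.
Hypothesis mU : forall i, measurable_fun setT (fun z : R * R => U z.1 z.2 ord0 i).
Hypotheses (K_adm : K `<=` [set W | admissible W]) (K_bnd : bounded_set K)
  (K_cvx : convex_states K) (KU : forall t x, K (U t x)).
Hypothesis repU : forall i t x, 0 <= t <= 1 -> U t x ord0 i = Ul ord0 i +
  wsum wl (fun j => w_dU (wl j) i) t x + wsum wr (fun j => w_dU (wr j) i) t x.
Hypothesis repF : forall i t x, 0 <= t <= 1 ->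
  flux beta gamma (U t x) ord0 i = flux beta gamma Ul ord0 i +
  wsum wl (fun j => w_dF (wl j) i) t x + wsum wr (fun j => w_dF (wr j) i) t x.
Hypothesis repe : forall t x, 0 <= t <= 1 -> eta gamma (U t x) = eta gamma Ul +
  wsum wl (fun j => w_de (wl j)) t x + wsum wr (fun j => w_de (wr j)) t x.
Hypothesis repq : forall t x, 0 <= t <= 1 ->
  Qflux beta gamma (U t x) = Qflux beta gamma Ul +
  wsum wl (fun j => w_dq (wl j)) t x + wsum wr (fun j => w_dq (wr j)) t x.
Hypothesis UV : U 0 0 = V.
Hypothesis UM : U 0 M = Ur.
Hypothesis GV : rel_entropy gamma V Ul = a * rel_entropy gamma V Ur.

(** Up to a fixed endpoint, a step of height [rho] at position [X] integrates to [rho] times the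
    distance from [X] to that endpoint; moving at speed [s], it changes the energy at the rate
    [- s * rho]. *)
Let rate : R :=
  - (\sum_j integ 0 1 (fun th => w_spd (wl j) th * w_rho Ul (wl j) th)
     + a * \sum_j integ 0 1 (fun th => w_spd (wr j) th * w_rho Ur (wr j) th)).
Hypothesis rate0 : 0 < rate.

Let w (k : 'I_(nl + nr)) : wave R :=
  match fintype.split k with inl i => wl i | inr j => wr j end.

Let wsumE (d : wave R -> R -> R) t x : wsum w (fun k => d (w k)) t x =
  wsum wl (fun j => d (wl j)) t x + wsum wr (fun j => d (wr j)) t x.
Proof.
rewrite /wsum big_split_ord /=; congr (_ + _); apply: eq_bigr => i _.
  by rewrite /w -[lshift nr i]/(unsplit (inl i)) unsplitK.
by rewrite /w -[rshift nl i]/(unsplit (inr i)) unsplitK.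
Qed.

Let weak T : 0 < T <= 1 -> entropy_weak_solution beta gamma T U (U 0).
Proof.
move=> /andP[T0 T1]; have T0' := ltW T0.
have tT t : 0 < t < T -> 0 <= t <= 1.
  by move=> /andP[t0 tT]; rewrite ltW//= (le_trans (ltW tT)).
have RU i t x : 0 <= t <= 1 -> U t x ord0 i = Ul ord0 i + wsum w (fun k => w_dU (w k) i) t x.
  by move=> h; rewrite repU// (wsumE (fun w => w_dU w i)) addrA.
split=> //.
- by move=> i; have := @measurableT_comp _ _ _ _ _ _ _ setT (fun x : R => (0 : R, x)) (mU i) (pair1_measurable _).
- move=> phi phit phix [t1 [t2 [x1 [x2 [t2T C1]]]]] i.
  have := @weak_wsum R _ w phi phit phix t1 t2 x1 x2 T T0' t2T C1
    (fun k => w_dU (w k) i) (fun k => w_dF (w k) i) (Ul ord0 i) (flux beta gamma Ul ord0 i)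
    (fun k => w_bdU (w k) i) (fun k => w_bdF (w k) i) (fun k => w_dFE (w k) i).
  apply: etrans; congr (_ + _).
    apply: eq_dint => t x /tT t01; rewrite RU// repF// (wsumE (fun w => w_dF w i)).
    by rewrite addrA.
  by congr Rint; apply/funext => x; rewrite RU// lexx ler01.
- move=> phi phit phix [t1 [t2 [x1 [x2 [t10 [t2T C1]]]]]] p0.
  apply: le_trans (@entropy_wsum R _ w phi phit phix t1 t2 x1 x2 T T0' t2T C1
    (eta gamma Ul) (Qflux beta gamma Ul) t10 p0) _.
  rewrite le_eqVlt; apply/predU1P; left.
  apply: eq_dint => t x /tT t01; rewrite repe// repq//.
  by rewrite -!addrA -(wsumE (@w_de R)) -(wsumE (@w_dq R)).
Qed.

(** The identity [weak_fronts] trades the time derivative of [phi1] for a space derivative with the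
    densities [w_dF]; both terms then fall under [norm_dint_fronts], with the bounds [|phi1| <= 1]
    and [|phi2| <= 1]. *)
Let bv T : 0 < T <= 1 -> BV_loc T U.
Proof.
move=> /andP[T0 T1] i t1 t2 x1 x2 t10 t2T; have T0' := ltW T0.
have /choice[N hN] : forall k, exists N : R, forall th, `|w_dU (w k) i th| <= N.
  by move=> k; case: (w_bdU (w k) i).
have /choice[N' hN'] : forall k, exists N : R, forall th, `|w_dF (w k) i th| <= N.
  by move=> k; case: (w_bdF (w k) i).
exists (\sum_k (N' k * (1 * T) + N k * (1 * T))).
move=> phi1 phi1t phi1x phi2 phi2t phi2x C1 C2 hb.
have b1 t x : `|phi1 t x| <= 1.
  rewrite -(@ler_pXn2r _ 2)// ?nnegrE// expr1n real_normK ?num_real//.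
  by apply: le_trans (hb t x); rewrite lerDl sqr_ge0.
have b2 t x : `|phi2 t x| <= 1.
  rewrite -(@ler_pXn2r _ 2)// ?nnegrE// expr1n real_normK ?num_real//.
  by apply: le_trans (hb t x); rewrite lerDr sqr_ge0.
have tt := tame_phit C1; have tx := tame_phix C2.
pose d k := w_dU (w k) i.
have bd k : bmeas (d k) by exact: w_bdU.
have bD k : bmeas (w_dF (w k) i) by exact: w_bdF.
rewrite (_ : dint T _ = dint T (fun t x => (Ul ord0 i + wsum w d t x) * phi1t t x
   + (Ul ord0 i + wsum w d t x) * phi2x t x)); last first.
  apply: eq_dint => t x /andP[t0 tT]; rewrite repU ?(ltW t0) ?(le_trans (ltW tT) T1)//.
  by rewrite /d (wsumE (fun w => w_dU w i)) mulrDr !addrA.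
rewrite (@dintD _ _ x1 x2); last 2 first.
- by apply: tameM tt; apply: bmeasD; [exact: bmeas_cst|exact: bmeas_wsum].
- by apply: tameM tx; apply: bmeasD; [exact: bmeas_cst|exact: bmeas_wsum].
have z0 (f : R -> R) : Rint setT (fun x => f x * phi1 0 x) = 0.
  rewrite (_ : (fun x => _) = fun=> 0) /Rint ?Rintegral_cst ?mul0r//.
  apply/funext => x; rewrite (supp0 C1) ?mulr0// => -[/andP[+ _] _].
  by rewrite leNgt t10.
rewrite (dint_wsum w T _ bd tt) (dint_wsum w T _ bd tx) (dint_phix T C2) mulr0 add0r.
have -> : dint T phi1t = 0.
  have := dint_phit T0' t2T C1; rewrite (_ : phi1 0 = fun x => 1 * phi1 0 x).
    by rewrite (z0 (fun=> 1)) addr0.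
  by apply/funext => x; rewrite mul1r.
rewrite mulr0 add0r -big_split; apply: le_trans (ler_norm_sum _ _ _) _.
apply: ler_sum => k _; apply: le_trans (ler_normD _ _) _; apply: lerD.
  have := @weak_fronts R _ _ (w_mpos (w k)) (w_mspd (w k)) T _ _ _ t1 t2 x1 x2 _ _ T0' t2T C1 (bd k) (bD k) (w_dFE (w k) i).
  rewrite z0 addr0 => /eqP; rewrite addr_eq0 => /eqP ->; rewrite normrN.
  exact: (norm_dint_fronts (w_mpos (w k)) (w_mspd (w k)) T0' C1 (bD k) (hN' k) b1).
exact: (norm_dint_fronts (w_mpos (w k)) (w_mspd (w k)) T0' C2 (bd k) (hN k) b2).
Qed.

Let rho_rep (W : state R) t x : admissible W -> 0 <= t <= 1 ->
  rel_entropy gamma (U t x) W = rel_entropy gamma Ul W +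
  wsum wl (fun j => w_rho W (wl j)) t x + wsum wr (fun j => w_rho W (wr j)) t x.
Proof.
move=> aW t01; rewrite !rel_entropyE// repe//.
have E n (v : 'I_n -> wave R) : wsum v (fun j => w_rho W (v j)) t x =
    wsum v (fun j => w_de (v j)) t x -
    \sum_i grad_eta gamma W i * wsum v (fun j => w_dU (v j) i) t x.
  rewrite /wsum; under eq_bigr => j _.
    rewrite fronts_lin; [|exact: w_mpos|exact: w_mspd|exact: w_bde|by move=> i; exact: w_bdU].
    over.
  rewrite big_split/= sumrN exchange_big/=; congr (_ - _); apply: eq_bigr => i _.
  by rewrite mulr_sumr.
rewrite !E.
rewrite (_ : \sum_i grad_eta gamma W i * (U t x ord0 i - W ord0 i) =
  \sum_i (grad_eta gamma W i * (Ul ord0 i - W ord0 i)) +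
  \sum_i (grad_eta gamma W i * wsum wl (fun j => w_dU (wl j) i) t x) +
  \sum_i (grad_eta gamma W i * wsum wr (fun j => w_dU (wr j) i) t x)); first by ring.
by rewrite -!big_split/=; apply: eq_bigr => i _; rewrite repU//; ring.
Qed.

Let brho W v : bmeas (w_rho W v).
Proof.
apply: bmeasD; first exact: w_bde.
by apply/bmeasN/bmeas_sum => i; apply: bmeasM; [exact: bmeas_cst|exact: w_bdU].
Qed.

Let bsrho W v : bmeas (fun th => w_spd v th * w_rho W v th).
Proof.
rewrite (_ : (fun th => _) = fun th => w_spd v th * w_de v th -
    \sum_i grad_eta gamma W i * w_dF v i th).
  apply: bmeasD; first exact: w_bsde.
  by apply/bmeasN/bmeas_sum => i; apply: bmeasM; [exact: bmeas_cst|exact: w_bdF].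
apply/funext => th; rewrite /w_rho mulrBr; congr (_ - _).
by rewrite mulr_sumr; apply: eq_bigr => i _; rewrite w_dFE; ring.
Qed.

Let rel_entropy_refl W : admissible W -> rel_entropy gamma W W = 0.
Proof.
move=> aW; rewrite rel_entropyE// subrr sub0r big1 ?oppr0// => i _.
by rewrite subrr mulr0.
Qed.

Let wsumr0 (d : wave R -> R -> R) t x : 0 <= t <= 1 -> x < delta ->
  wsum wr (fun j => d (wr j)) t x = 0.
Proof.
move=> t01 xd; rewrite /wsum big1// => j _; apply: fronts_before => th th01.
by have /andP[h _] := winr j t01 th01; exact: lt_le_trans h.
Qed.

Let wsuml1 (d : wave R -> R -> R) t x : 0 <= t <= 1 -> - delta < x ->
  wsum wl (fun j => d (wl j)) t x = \sum_j integ 0 1 (d (wl j)).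
Proof.
move=> t01 xd; rewrite /wsum; apply: eq_bigr => j _; apply: fronts_after => th th01.
by have /andP[_ h] := winl j t01 th01; exact: le_trans h (ltW xd).
Qed.

Let wsumr1 (d : wave R -> R -> R) t x : 0 <= t <= 1 -> M <= x ->
  wsum wr (fun j => d (wr j)) t x = \sum_j integ 0 1 (d (wr j)).
Proof.
move=> t01 xd; rewrite /wsum; apply: eq_bigr => j _; apply: fronts_after => th th01.
by have /andP[_ h] := winr j t01 th01; exact: le_trans h xd.
Qed.

Let wsuml0 (d : wave R -> R -> R) t x : 0 <= t <= 1 -> x < - M ->
  wsum wl (fun j => d (wl j)) t x = 0.
Proof.
move=> t01 xd; rewrite /wsum big1// => j _; apply: fronts_before => th th01.
by have /andP[h _] := winl j t01 th01; exact: lt_le_trans h.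
Qed.

Let t00 : 0 <= (0 : R) <= 1.
Proof. by rewrite lexx ler01. Qed.

Let rhoVl : \sum_j integ 0 1 (w_rho Ul (wl j)) = rel_entropy gamma V Ul.
Proof.
rewrite -UV rho_rep// rel_entropy_refl// add0r.
rewrite (wsumr0 (w_rho Ul) t00 d0) addr0 (wsuml1 (w_rho Ul) t00)//.
by rewrite oppr_lt0.
Qed.

Let rho_right t x : 0 <= t <= 1 -> - delta < x -> rel_entropy gamma (U t x) Ur =
  rel_entropy gamma V Ur + wsum wr (fun j => w_rho Ur (wr j)) t x.
Proof.
move=> t01 xd; rewrite -UV !rho_rep// !(wsuml1 (w_rho Ur))// ?oppr_lt0//.
by rewrite (wsumr0 (w_rho Ur) t00 d0) addr0.
Qed.

Hypothesis dM : delta <= M.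

Let rhoVr : rel_entropy gamma V Ur + \sum_j integ 0 1 (w_rho Ur (wr j)) = 0.
Proof.
have dM' : - delta < M by rewrite (lt_le_trans _ dM)// (lt_trans _ d0)// oppr_lt0.
have := rho_right t00 dM'; rewrite UM rel_entropy_refl//.
by rewrite (wsumr1 (w_rho Ur) t00 (lexx M)) => <-.
Qed.

Let e0 : R := - \sum_j integ 0 1 (fun th => w_rho Ul (wl j) th * w_pos (wl j) th)
  - a * \sum_j integ 0 1 (fun th => w_rho Ur (wr j) th * w_pos (wr j) th).

Let bwrho n (v : 'I_n -> wave R) W t : bmeas (wsum v (fun j => w_rho W (v j)) t).
Proof. by apply: bmeas_slice1; apply: bmeas_wsum. Qed.

Let integ_rho W v t h :
  integ 0 1 (fun th => w_rho W v th * (h - (w_pos v th + w_spd v th * t))) =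
  h * integ 0 1 (w_rho W v) - integ 0 1 (fun th => w_rho W v th * w_pos v th)
  - t * integ 0 1 (fun th => w_spd v th * w_rho W v th).
Proof.
have bp : bmeas (fun th => w_rho W v th * w_pos v th).
  by apply: bmeasM => //; exact: w_bpos.
transitivity (integ 0 1 (fun th => h * w_rho W v th +
   ((-1) * (w_rho W v th * w_pos v th) + (- t) * (w_spd v th * w_rho W v th)))).
  by apply: eq_integ => th _; ring.
have b1 (c : R) f : bmeas f -> bmeas (fun th : R => c * f th).
  by apply: bmeasM; exact: bmeas_cst.
rewrite integD; [|exact: b1|by apply: bmeasD; exact: b1].
rewrite integD; [|exact: b1|exact: b1].
by rewrite !integZ//; ring.
Qed.

Let energy t h : 0 <= t <= 1 -> - delta < h < delta ->
  E_a gamma a Ul Ur (U t) h = (e0 + rate * t)%:E.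
Proof.
move=> t01 /andP[hd1 hd2].
have hl : - M <= h by rewrite (le_trans _ (ltW hd1))// lerN2.
have hr : h <= M by rewrite (le_trans (ltW hd2)).
have -> : E_a gamma a Ul Ur (U t) h =
  (integ (- M) h (wsum wl (fun j => w_rho Ul (wl j)) t) + a * integ h M
    (fun x => rel_entropy gamma V Ur + wsum wr (fun j => w_rho Ur (wr j)) t x))%:E.
  rewrite EFinD EFinM -integral_left; last 2 first.
  - exact: bwrho.
  - by move=> x xM; exact: (wsuml0 (w_rho Ul)).
  rewrite -integral_right; last 2 first.
  - by apply: bmeasD; [exact: bmeas_cst|exact: bwrho].
  - by move=> x xM; rewrite (wsumr1 (w_rho Ur))// ltW.
  congr (_ + _ * _)%E; apply: eq_integral => x; rewrite inE/= in_itv/= ?andbT => xh; congr EFin.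
    rewrite rho_rep// rel_entropy_refl// add0r (wsumr0 (w_rho Ul))// ?addr0//.
    exact: lt_trans hd2.
  by rewrite rho_right//; exact: lt_trans xh.
have -> : integ (- M) h (wsum wl (fun j => w_rho Ul (wl j)) t) =
   h * rel_entropy gamma V Ul
   - \sum_j integ 0 1 (fun th => w_rho Ul (wl j) th * w_pos (wl j) th)
   - t * \sum_j integ 0 1 (fun th => w_spd (wl j) th * w_rho Ul (wl j) th).
  rewrite -rhoVl !mulr_sumr -!sumrB /wsum integ_sum; last first.
    move=> j; apply: bmeas_slice1; apply: bmeas_fronts => //; [exact: w_mpos|exact: w_mspd].
  apply: eq_bigr => j _; rewrite integ_fronts ?integ_rho//; [exact: w_mpos|exact: w_mspd|].
  move=> th th01; have /andP[-> h2] /= := winl j t01 th01.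
  exact: le_trans h2 (ltW hd1).
have -> : integ h M (fun x => rel_entropy gamma V Ur + wsum wr (fun j => w_rho Ur (wr j)) t x) =
   - h * rel_entropy gamma V Ur
   - \sum_j integ 0 1 (fun th => w_rho Ur (wr j) th * w_pos (wr j) th)
   - t * \sum_j integ 0 1 (fun th => w_spd (wr j) th * w_rho Ur (wr j) th).
  rewrite integD; last 2 first.
  - exact: bmeas_cst.
  - exact: bwrho.
  rewrite integ_cst// /wsum integ_sum; last first.
    move=> j; apply: bmeas_slice1; apply: bmeas_fronts => //; [exact: w_mpos|exact: w_mspd].
  rewrite (_ : \sum_j _ = M * \sum_j integ 0 1 (w_rho Ur (wr j))
   - \sum_j integ 0 1 (fun th => w_rho Ur (wr j) th * w_pos (wr j) th)
   - t * \sum_j integ 0 1 (fun th => w_spd (wr j) th * w_rho Ur (wr j) th)).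
    move/eqP: rhoVr; rewrite addrC addr_eq0 => /eqP ->; ring.
  rewrite !mulr_sumr -!sumrB.
  apply: eq_bigr => j _; rewrite integ_fronts ?integ_rho//; [exact: w_mpos|exact: w_mspd|].
  move=> th th01; have /andP[h2 ->] := winr j t01 th01.
  by rewrite andbT (le_trans (ltW hd2)).
by congr EFin; rewrite GV /e0 /rate; ring.
Qed.

Theorem growing_energy_not_a_contraction : ~ a_contraction beta gamma Ul Ur sigma a.
Proof.
move=> /(_ K K_adm K_bnd K_cvx)[CK hCK].
(* [CK] depends on [K] alone, so the horizon can be fixed after it: [|h t| <= |CK| * t < delta]
   keeps the shift in the plateau. The bound 1 stays within the time span of the wave
   representation. *)
pose T := Num.min 1 (delta / (`|CK| + 1)).
have C0 : 0 < `|CK| + 1 by rewrite ltr_wpDl.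
have T0 : 0 < T by rewrite lt_min ltr01 divr_gt0.
have T1 : T <= 1 by rewrite ge_min lexx.
have T01 : 0 < T <= 1 by rewrite T0.
have [|||h [h0 hlip [N [mN N0 hE]] _]] := hCK T T0 U (U 0) (weak T01).
- by move=> t x _; exact: KU.
- exact: bv.
- by rewrite energy ?ltry// oppr_lt0 d0.
have hd t : 0 < t < T -> - delta < h t < delta.
  move=> /andP[t0 tT]; rewrite -ltr_norml -[h t]subr0 -h0.
  apply: le_lt_trans (hlip 0 t _ _) _; rewrite ?lexx ?T0 ?ltW//= subr0 gtr0_norm//.
  apply: (@le_lt_trans _ _ (`|CK| * t)); first by rewrite ler_wpM2r ?ler_norm// ltW.
  have : t < delta / (`|CK| + 1) by apply: (lt_le_trans tT); rewrite /T ge_min lexx orbT.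
  by rewrite ltr_pdivlMr// mulrDr mulr1 mulrC => /(lt_trans _); apply; rewrite ltrDl.
have T2 : 0 < T / 2 by rewrite divr_gt0.
have T3 : T / 2 < T by rewrite ltr_pdivrMr// ltr_pMr// ltr1n.
(* Two times avoiding the null set, ordered because they come from the two halves of the time
   interval. *)
have [s /andP[s0 sT] Ns] := not_null_itv T2 N0 mN.
have [t /andP[t2 tT] Nt] := not_null_itv T3 N0 mN.
have st : s < t by exact: lt_trans t2.
have t0 : 0 < t by exact: lt_trans st.
have := hE s t s0 st tT Ns Nt.
have sT' : s < T by exact: lt_trans tT.
rewrite !energy; last 4 first.
- by rewrite ltW//= (le_trans (ltW sT')).
- by rewrite hd// s0.
- by rewrite ltW//= (le_trans (ltW tT)).
- by rewrite hd// t0.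
by rewrite lee_fin lerD2l ler_pM2l// leNgt st.
Qed.

End criterion.

(** * The Picard theorem *)

Section picard.
Context {R : realType}.
Implicit Types (r s x y : R) (f g : R -> R).

(** With [e n] the tail of the geometric series, the intervals [[u n - e n, u n + e n]] are nested;
    the supremum of their left ends lies in all of them, which gives the limit together with its
    rate. *)
Lemma geometric_limit (u : nat -> R) (K : R) :
  (forall n, `|u n.+1 - u n| <= K / 2 ^+ n) ->
  exists l, forall n, `|l - u n| <= 2 * K / 2 ^+ n.
Proof.
move=> hu; pose e n := 2 * K / 2 ^+ n.
have eS n : e n - e n.+1 = K / 2 ^+ n.
  by rewrite /e exprS; field; rewrite expf_neq0.
have K0 : 0 <= K by have := hu 0%N; rewrite expr0 divr1; exact: le_trans.
have e0 n : 0 <= e n by rewrite /e !mulr_ge0// invr_ge0 exprn_ge0.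
have up : {homo (fun n => u n - e n) : n m / (n <= m)%N >-> n <= m}.
  apply: homo_leq => [//|x y z|n]; first exact: le_trans.
  by have := hu n; rewrite -eS ler_norml => /andP[]; lra.
have dn : {homo (fun n => - (u n + e n)) : n m / (n <= m)%N >-> n <= m}.
  apply: homo_leq => [//|x y z|n]; first exact: le_trans.
  by have := hu n; rewrite -eS ler_norml => /andP[]; lra.
have ab n m : u n - e n <= u m + e m.
  have h1 := up _ _ (leq_maxl n m); have h2 := dn _ _ (leq_maxr n m).
  by have := e0 (maxn n m); move: h1 h2; lra.
pose A : set R := range (fun n => u n - e n).
have A0 : A !=set0 by exists (u 0%N - e 0%N), 0%N.
exists (sup A) => n; rewrite ler_norml -/(e n); apply/andP; split.
  have : u n - e n <= sup A.
    by apply: ub_le_sup; [exists (u 0%N + e 0%N) => _ [m _ <-]; exact: ab|exists n].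
  lra.
have : sup A <= u n + e n by apply: ge_sup => // _ [m _ <-]; exact: ab.
lra.
Qed.

Lemma le_half_pow (c K : R) : (forall n, c <= K / 2 ^+ n) -> c <= 0.
Proof.
move=> h; rewrite leNgt; apply/negP => c0.
have K0 : 0 < K by have := h 0%N; rewrite expr0 divr1; exact: lt_le_trans.
have [n hn] : exists n : nat, K / c < 2 ^+ n.
  exists (Num.truncn (K / c)).+1; apply: lt_trans (_ : (Num.truncn (K / c)).+1%:R < _).
    by rewrite truncnS_gt// divr_ge0 ?ltW.
  by rewrite -natrX ltr_nat ltn_expl.
have := h n; rewrite leNgt => /negP; apply.
by rewrite ltr_pdivrMr ?exprn_gt0// mulrC -ltr_pdivrMr.
Qed.

(** Since [integ] is 0 on reversed segments, this primitive is extended by 0 to the left of [r0]: it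
    is continuous on the whole line, and its derivative is claimed only to the right of [r0]. *)
Lemma primitiveP (r0 : R) f : continuous f ->
  [/\ integ r0 r0 f = 0, (forall r, r <= r0 -> integ r0 r f = 0),
      continuous (fun r => integ r0 r f) &
      forall r, r0 < r -> is_derive r 1 (fun r => integ r0 r f) (f r)].
Proof.
move=> cf; have fi b : (@lebesgue_measure R).-integrable `[r0, b] (EFin \o f).
  by apply: continuous_compact_integrable; [exact: segment_compact|exact: continuousW].
have z r : r <= r0 -> integ r0 r f = 0.
  rewrite le_eqVlt => /predU1P[->|h]; rewrite /integ /Rint.
    by rewrite set_itv1 Rintegral_set1.
  by rewrite set_itv_ge ?bnd_simp -?ltNge// Rintegral_set0.
have d r : r0 < r -> is_derive r 1 (fun r => integ r0 r f) (f r).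
  move=> r0r; have [|d1 d2] := @continuous_FTC1_closed _ f r0 r (r + 1) _ (fi _) r0r (cf r).
    by rewrite ltrDl.
  by apply: DeriveDef; [exact: d1|rewrite -d2 derive1E].
split => //; first exact: z.
move=> r; have [h|h|->] := ltgtP r r0.
- apply: cvg_near_cst; near=> s; rewrite !z ?(ltW h)//.
  by apply/ltW; near: s; exact: lt_nbhsl.
- apply/differentiable_continuous/derivable1_diffP.
  exact: (@ex_derive _ _ _ _ _ _ _ (d r h)).
- rewrite /continuous_at z//; apply: (@parameterized_integral_cvg_left R r0 (r0 + 1)) => //.
  by rewrite ltrDl.
Unshelve. all: by end_near. Qed.

Lemma is_derive_le (F G f g : R -> R) (r0 r : R) : r0 <= r ->
  continuous F -> continuous G ->
  (forall s, r0 < s < r -> is_derive s 1 F (f s)) ->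
  (forall s, r0 < s < r -> is_derive s 1 G (g s)) ->
  (forall s, r0 < s < r -> f s <= g s) -> F r - F r0 <= G r - G r0.
Proof.
move=> r0r cF cG dF dG fg.
have dH s : r0 < s < r -> is_derive s 1 (fun s => F s + - G s) (f s + - g s).
  by move=> h; apply: isd_add; [exact: dF|apply: isd_opp; exact: dG].
have := @ler0_derive1_nincr _ (fun s => F s + - G s) r0 r.
move/(_ _ _ _ r0 r (lexx _) r0r (lexx _)) => H.
suff : F r + - G r <= F r0 + - G r0 by lra.
apply: H.
- by move=> s; rewrite in_itv/= => /dH ds; exact: (@ex_derive _ _ _ _ _ _ _ ds).
- move=> s; rewrite in_itv/= => h; have ds := dH s h.
  by rewrite derive1E (@derive_val _ _ _ _ _ _ _ ds) subr_le0 fg.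
- by apply: continuousW => s; apply: cvgB; [exact: cF|exact: cG].
Qed.

Lemma norm_is_derive_le (F G f g : R -> R) (r0 r : R) : r0 <= r ->
  continuous F -> continuous G ->
  (forall s, r0 < s < r -> is_derive s 1 F (f s)) ->
  (forall s, r0 < s < r -> is_derive s 1 G (g s)) ->
  (forall s, r0 < s < r -> `|f s| <= g s) -> `|F r - F r0| <= G r - G r0.
Proof.
move=> r0r cF cG dF dG fg; rewrite ler_norml; apply/andP; split; last first.
  by apply: is_derive_le r0r cF cG dF dG _ => s /fg; exact: le_trans (ler_norm _).
rewrite -lerN2 opprK opprB.
have cN : continuous (fun s => - F s) by move=> s; apply: cvgN; exact: cF.
have := @is_derive_le _ G _ g r0 r r0r cN cG (fun s h => isd_opp (dF s h)) dG.
rewrite opprK (addrC _ (F r0)); apply => s /fg; apply: le_trans.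
by rewrite -normrN ler_norm.
Qed.

Variables (k : R -> R -> R) (L r0 y0 : R).
Hypotheses (L0 : 0 < L)
  (lip : forall r y y', `|k r y - k r y'| <= L * `|y - y'|)
  (ck : continuous (fun z : R * R => k z.1 z.2)).

Let ckc (y : R -> R) : continuous y -> continuous (fun s => k s (y s)).
Proof.
move=> cy s; apply/cvgrPdist_lt => e e0.
have [d d0 hd] := continuous2P s (y s) ck e0.
near=> t; rewrite distrC; apply: (hd t); rewrite distrC; near: t.
  by apply/nbhs_ballP; exists d.
by have /cvgrPdist_lt/(_ d d0) := cy s.
Unshelve. all: by end_near. Qed.

Fixpoint picard_iter n : R -> R :=
  if n is m.+1 then fun r => y0 + integ r0 r (fun s => k s (picard_iter m s))
  else fun=> y0.

Let cpi n : continuous (picard_iter n).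
Proof.
elim: n => [|n ih] r /=; first exact: cvg_cst.
by apply: cvgD; [exact: cvg_cst|case: (primitiveP r0 (ckc ih)) => _ _ + _; apply].
Qed.

Let dpi n r : r0 < r -> is_derive r 1 (picard_iter n.+1) (k r (picard_iter n r)).
Proof.
move=> h; case: (primitiveP r0 (ckc (@cpi n))) => _ _ _ /(_ r h) d.
by have := isd_add (isd_cst r y0) d; rewrite add0r.
Qed.

Let pi0 n r : r <= r0 -> picard_iter n r = y0.
Proof.
case: n => //= n h; case: (primitiveP r0 (ckc (@cpi n))) => _ z _ _.
by rewrite z// addr0.
Qed.

(** Bielecki's weight. The integral of [L * E] from [r0] is at most [E / 2], so the Picard map
    contracts by 1/2 in the norm weighted by [E], however large [r] is; this makes the solution
    global. *)
Let E r := expR (2 * L * (r - r0)).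

Let dE c r : is_derive r 1 (fun s => c * E s) (c * (2 * L * E r)).
Proof.
have d1 : is_derive r 1 (fun s => 2 * L * (s - r0)) (2 * L).
  apply: is_derive_eq (isd_mul (isd_cst r (2 * L)) (isd_add (isd_id r) (isd_cst r (- r0)))) _.
  by rewrite addr0 mulr1 mulr0 addr0.
apply: is_derive_eq (isd_mul (isd_cst r c) (isd_comp (is_derive_expR _) d1)) _.
by rewrite mulr0 addr0 (mulrC (expR _)).
Qed.

Let step (R1 : R) : exists2 C : R, 0 <= C & forall n r, r <= R1 ->
  `|picard_iter n.+1 r - picard_iter n r| <= C / 2 ^+ n * E r.
Proof.
have [C C0 hC] : exists2 C, 0 <= C & forall r, r <= R1 -> `|picard_iter 1 r - y0| <= C.
  have [M hM] : exists M, forall r, r0 <= r <= R1 -> `|picard_iter 1 r - y0| <= M.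
    have : compact ((fun r => picard_iter 1 r - y0) @` `[r0, R1]).
      apply: continuous_compact; last exact: segment_compact.
      by apply: continuousW => r; apply: cvgB; [exact: cpi|exact: cvg_cst].
    move/compact_bounded => [M [_ hM]]; exists (`|M| + 1) => r h.
    apply: hM; first by rewrite (le_lt_trans (ler_norm M))// ltrDl.
    by exists r => //=; rewrite in_itv/=.
  exists `|M| => // r rR; have [h|/ltW h] := leP r r0.
    by rewrite pi0// subrr normr0.
  by apply: le_trans (ler_norm M); apply: hM; rewrite h.
exists C => // n; elim: n => [|n ih] r rR.
  rewrite expr0 divr1; have [h|/ltW h] := leP r r0.
    by rewrite !pi0// subrr normr0 mulr_ge0// expR_ge0.
  apply: le_trans (hC r rR) _; rewrite ler_peMr// /E -expR0 ler_expR.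
  by rewrite !mulr_ge0 ?subr_ge0// ltW.
have [h|/ltW h] := leP r r0.
  by rewrite !pi0// subrr normr0 !mulr_ge0 ?expR_ge0// invr_ge0 exprn_ge0.
pose F s := picard_iter n.+2 s - picard_iter n.+1 s.
pose G s := C / 2 ^+ n.+1 * E s.
have cF : continuous F by move=> s; apply: cvgB; exact: cpi.
have cG : continuous G by exact: is_derive_continuous (dE (C / 2 ^+ n.+1)).
have := @norm_is_derive_le F G _ _ r0 r h cF cG
  (fun s hs => isd_add (dpi n.+1 (andP hs).1) (isd_opp (dpi n (andP hs).1)))
  (fun s hs => dE (C / 2 ^+ n.+1) s).
have F0 : F r0 = 0 by rewrite /F !pi0// subrr.
rewrite F0 subr0 => H.
apply: le_trans (H _) _; last by rewrite gerBl mulr_ge0 ?expR_ge0// mulr_ge0// invr_ge0 exprn_ge0.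
move=> s /andP[s0 sr]; apply: le_trans (lip _ _ _) _.
have := ih s (le_trans (ltW sr) rR).
rewrite -(ler_pM2l L0) => /le_trans; apply; rewrite exprS le_eqVlt; apply/orP; left.
by apply/eqP; field; rewrite expf_neq0.
Qed.

Theorem picard : exists y : R -> R, [/\ (forall r, r <= r0 -> y r = y0), continuous y &
  forall r, r0 < r -> is_derive r 1 y (k r (y r))].
Proof.
have [y hy] : exists y : R -> R, forall r, exists2 K : R, 0 <= K & forall n s, s <= r ->
    `|y s - picard_iter n s| <= K / 2 ^+ n.
  (* The constant of [step] depends on the right end [R1], while the limit at [s] must be one
     number; it is therefore chosen to work for every admissible [C], two limits being equal by
     [le_half_pow]. *)
  have /choice[y hy] : forall s, exists l, forall C : R, 0 <= C ->
     (forall n, `|picard_iter n.+1 s - picard_iter n s| <= C / 2 ^+ n) ->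
     forall n, `|l - picard_iter n s| <= 2 * C / 2 ^+ n.
    move=> s; have [C C0 hC] := step s.
    have [n|l hl] := @geometric_limit (picard_iter ^~ s) (C * E s).
      by have := hC n s (lexx _); rewrite mulrAC.
    exists l => C' C'0 hC' n.
    have [l' hl'] := @geometric_limit (picard_iter ^~ s) C' hC'.
    suff <- : l' = l by exact: hl'.
    apply/eqP; rewrite -subr_eq0 -normr_le0.
    apply: (@le_half_pow _ (2 * C' + 2 * (C * E s))) => m.
    rewrite mulrDl (_ : l' - l = (l' - picard_iter m s) + (picard_iter m s - l)); last by ring.
    rewrite (le_trans (ler_normD _ _))// lerD//.
    by rewrite distrC.
  exists y => r; have [C C0 hC] := step r.
  exists (2 * (C * E r)); first by rewrite !mulr_ge0// expR_ge0.
  move=> n s sr; apply: hy; first by rewrite mulr_ge0// expR_ge0.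
  move=> m; apply: le_trans (hC m s sr) _; rewrite mulrAC ler_wpM2r ?invr_ge0 ?exprn_ge0//.
  by rewrite ler_wpM2l// ler_expR ler_wpM2l ?lerD2r// mulr_ge0// ltW.
have yr0 r : r <= r0 -> y r = y0.
  move=> h; have [K K0 hK] := hy r; apply/eqP; rewrite -subr_eq0 -normr_le0.
  by apply: (@le_half_pow _ K) => n; rewrite -{1}(pi0 n h); exact: hK.
have cy : continuous y.
  move=> r; apply/cvgrPdist_lt => e e0; have [K K0 hK] := hy (r + 1).
  have [n hn] : exists n, K / 2 ^+ n < e / 3.
    apply: contrapT => H; have : e / 3 <= 0.
      apply: (@le_half_pow _ K) => n; rewrite leNgt; apply/negP => h; apply: H; by exists n.
    by rewrite leNgt divr_gt0.
  have e3 : 0 < e / 3 by rewrite divr_gt0.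
  near=> s.
  have s1 : s <= r + 1 by apply/ltW; near: s; apply: lt_nbhsl; rewrite ltrDl.
  have h1 := hK n s s1; have h2 := hK n r (ltac:(rewrite lerDl//)).
  have h3 : `|picard_iter n r - picard_iter n s| < e / 3.
    near: s; by have /cvgrPdist_lt/(_ _ e3) := @cpi n r.
  move: h1 h2 h3 hn; rewrite !ler_norml !ltr_norml => /andP[? ?] /andP[? ?] /andP[? ?] ?.
  by apply/andP; split; lra.
have [P0 Pz cP dP] := primitiveP r0 (ckc cy).
have yE r : r0 <= r -> y r = y0 + integ r0 r (fun s => k s (y s)).
  move=> h; have [K K0 hK] := hy r; apply/eqP; rewrite -subr_eq0 -normr_le0.
  apply: (@le_half_pow _ (K + L * K * (r - r0))) => n.
  pose F s := picard_iter n.+1 s - integ r0 s (fun s => k s (y s)).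
  pose G s := L * (K / 2 ^+ n) * s.
  have cF : continuous F by move=> s; apply: cvgB; [exact: cpi|exact: cP].
  have dG s : is_derive s 1 G (L * (K / 2 ^+ n)).
    by apply: is_derive_eq (isd_mul (isd_cst s _) (isd_id s)) _; rewrite mulr1 mulr0 addr0.
  have := @norm_is_derive_le F G _ _ r0 r h cF (is_derive_continuous dG)
    (fun s hs => isd_add (dpi n (andP hs).1) (isd_opp (dP s (andP hs).1))) (fun s hs => dG s).
  have -> : F r - F r0 = picard_iter n.+1 r - (y0 + integ r0 r (fun s => k s (y s))).
    by rewrite /F P0 (pi0 _ (lexx r0)); ring.
  move=> H; have {}H : `|picard_iter n.+1 r - (y0 + integ r0 r (fun s => k s (y s)))| <= G r - G r0.
    apply: H => s /andP[s0 sr]; apply: le_trans (lip _ _ _) _.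
    by rewrite ler_pM2l// distrC; apply: hK; exact: ltW.
  set z := y0 + _; rewrite (_ : y r - z = (y r - picard_iter n.+1 r) + (picard_iter n.+1 r - z)); last by ring.
  rewrite (le_trans (ler_normD _ _))// mulrDl; apply: lerD.
    apply: le_trans (hK n.+1 r (lexx _)) _; rewrite ler_wpM2l// exprS lef_pV2 ?posrE ?mulr_gt0 ?exprn_gt0//.
    by rewrite ler_peMl ?exprn_ge0// ler1n.
  by apply: le_trans H _; rewrite /G; lra.
exists y; split => // r h.
have d : is_derive r 1 (fun r => y0 + integ r0 r (fun s => k s (y s))) (k r (y r)).
  by apply: is_derive_eq (isd_add (isd_cst r y0) (dP r h)) _; rewrite add0r.
apply: near_eq_is_derive d; near=> s; apply/esym/yE/ltW; near: s; exact: lt_nbhsr.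
Unshelve. all: by end_near. Qed.

End picard.

(** * Shock and fan profiles *)

Section profiles.
Context {R : realType}.
Variables (beta gamma : R).
Implicit Types (t x th c : R) (w : wave R) (A B : state R).

(** The quantities entering the weak formulation and the entropy inequality, indexed by one type so
    that a representation by fronts is proved once for all of them. *)
Inductive obs := OU of 'I_4 | OF of 'I_4 | Oe | Oq.

Definition oval (o : obs) (U : state R) : R :=
  match o with
  | OU i => U ord0 i | OF i => flux beta gamma U ord0 i
  | Oe => eta gamma U | Oq => Qflux beta gamma U
  end.

Definition oder (o : obs) w : R -> R :=
  match o with
  | OU i => w_dU w i | OF i => w_dF w i | Oe => w_de w | Oq => w_dq w
  end.

Definition wfront w (o : obs) t x : R := fronts (w_pos w) (w_spd w) (oder o w) t x.

(** A wave leading from [A] on the left to [B] on the right. Its fronts stay within [Lam] of [c]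
    during the unit time span, which is what allows several waves to be placed side by side without
    meeting. *)
Definition profile w (W : R -> R -> state R) A B (P : state R -> Prop) c Lam : Prop :=
  [/\ forall o t x, 0 <= t <= 1 -> oval o (W t x) = oval o A + wfront w o t x,
      forall o, oval o B = oval o A + integ 0 1 (oder o w),
      forall i, measurable_fun setT (fun z : R * R => W z.1 z.2 ord0 i),
      forall t x, P (W t x) &
      forall t th, 0 <= t <= 1 -> 0 <= th <= 1 ->
        c - Lam <= w_pos w th + w_spd w th * t <= c + Lam].

Lemma profile_le w W A B P c Lam Lam' : Lam <= Lam' ->
  profile w W A B P c Lam -> profile w W A B P c Lam'.
Proof.
move=> LL [h1 h2 h3 h4 h5]; split => // t th t01 th01.
by have /andP[a b] := h5 t th t01 th01; apply/andP; split; [move: a|move: b]; lra.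
Qed.

Section shock.
Variables (A B : state R) (sigma c : R).
Hypothesis RH : flux beta gamma B - flux beta gamma A = sigma *: (B - A).
Hypothesis ent : Qflux beta gamma B - Qflux beta gamma A <= sigma * (eta gamma B - eta gamma A).

Let RHi i (_ : R) : flux beta gamma B ord0 i - flux beta gamma A ord0 i =
  sigma * (B ord0 i - A ord0 i).
Proof. by have /rowP/(_ i) := RH; rewrite !mxE. Qed.

Definition shock_front : wave R :=
  @Wave R (fun=> c) (fun=> sigma) (fun i _ => B ord0 i - A ord0 i)
   (fun i _ => flux beta gamma B ord0 i - flux beta gamma A ord0 i)
   (fun=> eta gamma B - eta gamma A) (fun=> Qflux beta gamma B - Qflux beta gamma A)
   (bmeas_cst _ _) (measurable_cst _) (fun i => bmeas_cst _ _) (fun i => bmeas_cst _ _)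
   (bmeas_cst _ _) (bmeas_cst _ _) (bmeas_cst _ _) RHi (fun=> ent).

Lemma shock_frontP : profile shock_front
  (fun t x => if c + sigma * t <= x then B else A) A B
  (fun W => W = A \/ W = B) c `|sigma|.
Proof.
have hd o : oder o shock_front = fun=> oval o B - oval o A by case: o.
split.
- move=> o t x t01; rewrite /wfront hd /fronts/= (@eq_integ _ 0 1 _
    (fun=> (c + sigma * t <= x)%R%:R * (oval o B - oval o A)))//.
  rewrite integ_cst// subr0 mulr1; case: ifP => _; last by rewrite mul0r addr0.
  by rewrite mul1r addrC subrK.
- by move=> o; rewrite hd integ_cst// subr0 mulr1 addrC subrK.
- move=> i; rewrite (_ : (fun z : R * R => _) =
    fun z : R * R => if c + sigma * z.1 <= z.2 then B ord0 i else A ord0 i).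
    apply: measurable_fun_ifT => //; apply: measurable_fun_ler => //.
    by apply: measurable_funD => //; exact: measurable_funM.
  by apply/funext => z; case: ifP.
- by move=> t x; case: ifP; [right|left].
- move=> t th /andP[t0 t1] _ /=; have : `|sigma * t| <= `|sigma|.
    by rewrite normrM ler_piMr// ger0_norm.
  by rewrite ler_norml => /andP[? ?]; apply/andP; split; lra.
Qed.

End shock.

Section fan.
Variables (Phi : R -> state R) (lam : R -> R).
Variables (gU gF : 'I_4 -> R -> R) (ge gq : R -> R).

Definition ogr (o : obs) : R -> R :=
  match o with OU i => gU i | OF i => gF i | Oe => ge | Oq => gq end.

Hypothesis cPhi : forall o, continuous (fun th => oval o (Phi th)).
Hypothesis cg : forall o, continuous (ogr o).
Hypothesis clam : continuous lam.
Hypothesis dPhi : forall o th, 0 < th < 1 ->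
  is_derive th 1 (fun th => oval o (Phi th)) (ogr o th).
Hypothesis gFE : forall i th, gF i th = lam th * gU i th.
Hypothesis gqE : forall th, gq th = lam th * ge th.

(* the clamp onto [0, 1] makes all the data bounded *)
Let cl th : R := Num.min (Num.max th 0) 1.

Let ccl : continuous cl.
Proof.
move=> th.
apply: (@continuous_min R R (fun y => Num.max y 0) (fun=> 1) th); last exact: cvg_cst.
by apply: (@continuous_max R R id (fun=> 0) th); [exact: cvg_id|exact: cvg_cst].
Qed.

Let cl01 th : 0 <= cl th <= 1.
Proof. by rewrite /cl le_min ler01 andbT le_max lexx orbT/= ge_min lexx orbT. Qed.

Let clE th : 0 <= th <= 1 -> cl th = th.
Proof. by move=> /andP[h0 h1]; rewrite /cl (max_idPl h0) (min_idPl h1). Qed.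

Let bcl (f : R -> R) : continuous f -> bmeas (fun th => f (cl th)).
Proof.
move=> cf; split.
  apply: continuous_measurable_fun => th.
  by apply: (@continuous_comp _ _ _ cl f); [exact: ccl|exact: cf].
have /compact_bounded[M [_ hM]] : compact (f @` `[0, 1]).
  by apply: continuous_compact; [exact: continuousW|exact: segment_compact].
exists (`|M| + 1) => th; apply: hM; first by rewrite (le_lt_trans (ler_norm M))// ltrDl.
by exists (cl th) => //=; rewrite in_itv/=.
Qed.

Section oriented.
Variables (c : R) (k : R).
Hypothesis k01 : 0 <= k <= 1.
Hypothesis mono : forall th th' t, 0 <= t <= 1 -> 0 <= th -> th <= th' -> th' <= 1 ->
  lam th * (t - k) <= lam th' * (t - k).

Let bpos : bmeas (fun th => c - k * lam (cl th)).
Proof. by apply: bmeasD; [exact: bmeas_cst|apply: bmeasN; apply: bmeasM; [exact: bmeas_cst|exact: bcl]]. Qed.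

(** Front [th] is at [c + lam th * (t - k)], so all fronts pass through [c] at time [k]: the case
    [k = 0] is a centred rarefaction, [k = 1] a compression focusing at time 1. The hypothesis
    [mono] says that on [[0, 1]] the fronts are ordered by [th]. *)
Definition fan_front : wave R :=
  @Wave R (fun th => c - k * lam (cl th)) (fun th => lam (cl th))
   (fun i th => gU i (cl th)) (fun i th => gF i (cl th))
   (fun th => ge (cl th)) (fun th => gq (cl th))
   bpos (bcl clam).1 (fun i => bcl (@cg (OU i))) (fun i => bcl (@cg (OF i)))
   (bcl (@cg Oe)) (bcl (@cg Oq)) (bmeasM (bcl clam) (bcl (@cg Oe)))
   (fun i th => gFE i (cl th))
   (fun th => eq_ind_r (fun z => z <= lam (cl th) * ge (cl th)) (lexx _) (gqE (cl th))).

Let oderE o : oder o fan_front = fun th => ogr o (cl th).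
Proof. by case: o. Qed.

Let integ_ogr o s : 0 <= s <= 1 -> integ 0 s (fun th => ogr o (cl th)) =
  oval o (Phi s) - oval o (Phi 0).
Proof.
move=> /andP[s0 s1].
have c1 : continuous (fun th => ogr o (cl th)).
  by move=> th; apply: (@continuous_comp _ _ _ cl (ogr o)); [exact: ccl|exact: cg].
have d1 th : 0 < th < s -> is_derive th 1 (fun th => oval o (Phi th)) (ogr o (cl th)).
  move=> /andP[h0 h1]; rewrite clE ?(ltW h0) ?(le_trans (ltW h1))//.
  by apply: dPhi; rewrite h0 (lt_le_trans h1).
exact: (integ_FTC s0 c1 (@cPhi o) d1).
Qed.

(** As the fronts are ordered, those lying at or to the left of [x] are indexed by an initial
    segment [[0, s]], closed by continuity of the positions. If there are none, [s = 0] and both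
    integrals vanish. *)
Let cut t x : 0 <= t <= 1 ->
  exists s, [/\ 0 <= s <= 1, forall f, bmeas f ->
    fronts (w_pos fan_front) (w_spd fan_front) f t x = integ 0 s f
    & fronts (w_pos fan_front) (w_spd fan_front) (fun=> 1) t x = s].
Proof.
move=> t01.
pose X th := c + lam (cl th) * (t - k).
have XE th : c - k * lam (cl th) + lam (cl th) * t = X th by rewrite /X; ring.
have Xm th th' : 0 <= th -> th <= th' -> th' <= 1 -> X th <= X th'.
  move=> h0 hh h1; rewrite /X lerD2l !clE ?h0 ?h1 ?(le_trans hh) ?(le_trans h0)//.
  exact: mono.
have cX : continuous X.
  move=> th; apply: cvgD; first exact: cvg_cst.
  apply: cvgM; last exact: cvg_cst.
  by apply: (@continuous_comp _ _ _ cl lam); [exact: ccl|exact: clam].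
suff [s [s01 hs]] : exists s, 0 <= s <= 1 /\ forall f, bmeas f ->
    integ 0 1 (fun th => (X th <= x)%R%:R * f th) = integ 0 s f.
  have hs' f : bmeas f -> fronts (w_pos fan_front) (w_spd fan_front) f t x = integ 0 s f.
    by move=> bf; rewrite -hs//; apply: eq_integ => th _; rewrite /= XE.
  exists s; split => //; rewrite hs'; last exact: bmeas_cst.
  by rewrite integ_cst ?subr0 ?mul1r//; case/andP: s01.
have [h|h] := ltP x (X 0).
  exists 0; split; first by rewrite lexx ler01.
  move=> f _; rewrite [RHS]/integ /Rint set_itv1 Rintegral_set1.
  rewrite -[RHS](mul0r (1 - 0)) -integ_cst//; apply: eq_integ => th /andP[th0 th1].
  by rewrite leNgt (lt_le_trans h) ?mul0r//; exact: Xm.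
pose S : set R := [set th | 0 <= th <= 1 /\ X th <= x].
have S0 : S 0 by split; rewrite ?lexx ?ler01.
have Sub : has_ubound S by exists 1 => th [/andP[]].
pose s := sup S.
have s0 : 0 <= s by exact: ub_le_sup.
have s1 : s <= 1 by apply: ge_sup; [exists 0|move=> th [/andP[]]].
have Xs : X s <= x.
  rewrite leNgt; apply/negP => xXs.
  have /cvgrPdist_lt/(_ (X s - x)) := cX s; rewrite subr_gt0 => /(_ xXs).
  move=> /nbhs_ballP[d /= d0 hd].
  have [th [th01 Xth] sth] : exists2 th, S th & s - d < th.
    by apply: sup_adherent => //; split => //; exists 0.
  have ths : th <= s by exact: ub_le_sup.
  have hb : `|s - th| < d by rewrite ger0_norm ?subr_ge0//; move: sth; lra.
  by have := hd th hb; rewrite /= ltr_norml => /andP[_]; move: Xth; lra.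
exists s; split; first by rewrite s0.
move=> f bf; pose g th := (0 <= th <= s)%R%:R * f th.
transitivity (integ 0 1 g).
  apply: eq_integ => th /andP[th0 th1]; rewrite /g th0/=; congr (_%:R * _).
  congr nat_of_bool; apply/idP/idP => h1.
    by apply: ub_le_sup => //; split => //; apply/andP.
  by apply: le_trans Xs; exact: Xm.
rewrite -(@Rint_setT_integ _ 0 1 g).
  rewrite (@Rint_setT_integ _ 0 s g).
    by apply: eq_integ => th hth; rewrite /g hth mul1r.
  by move=> th /negbTE hth; rewrite /g hth mul0r.
move=> th hth; rewrite /g (_ : _ && _ = false) ?mul0r//.
by apply: contraNF hth => /andP[-> /le_trans->].
Qed.

(** The superposition with density 1 measures the set of fronts already passed, so it is the
    parameter [s] of [cut], the one reached at [x]. *)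
Definition fan_state t x : state R :=
  Phi (fronts (w_pos fan_front) (w_spd fan_front) (fun=> 1) t x).

Lemma fan_frontP (P : state R -> Prop) Lam :
  (forall th, 0 <= th <= 1 -> P (Phi th)) ->
  (forall th, 0 <= th <= 1 -> `|lam th| <= Lam) ->
  profile fan_front fan_state (Phi 0) (Phi 1) P c Lam.
Proof.
move=> hP hLam; split.
- move=> o t x t01; have [s [s01 hs s1]] := cut x t01.
  rewrite /fan_state s1 /wfront oderE hs; last exact: bcl.
  by rewrite integ_ogr// addrC subrK.
- by move=> o; rewrite oderE integ_ogr ?lexx ?ler01// addrC subrK.
- move=> i.
  have cP := continuous_measurable_fun (@cPhi (OU i)).
  have := @bmeas_fronts R _ _ (w_mpos fan_front) (w_mspd fan_front) (fun=> 1) (bmeas_cst _ _).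
  by move=> [mf _]; exact: (measurableT_comp cP mf).
- move=> t x; apply: hP; rewrite /fronts; apply/andP; split.
    by apply: Rintegral_ge0 => th _; rewrite mulr1.
  rewrite [leRHS](_ : 1 = integ 0 1 (fun=> 1)); last by rewrite integ_cst// subr0 mulr1.
  apply: le_integ; [|exact: bmeas_cst|by move=> th _; rewrite mulr1 lern1 leq_b1].
  apply: bmeasM; last exact: bmeas_cst.
  apply: bmeas_ler => //; apply: measurable_funD; first exact: w_mpos.
  by apply: measurable_funM => //; exact: w_mspd.
- move=> t th t01 th01 /=.
  have -> : c - k * lam (cl th) + lam (cl th) * t = c + lam (cl th) * (t - k) by ring.
  have : `|lam (cl th) * (t - k)| <= Lam.
    rewrite normrM -[leRHS]mulr1 ler_pM//; first exact: hLam.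
    by move: t01 k01 => /andP[? ?] /andP[? ?]; rewrite ler_norml; apply/andP; split; lra.
  by rewrite ler_norml => /andP[? ?]; apply/andP; split; lra.
Qed.

End oriented.
End fan.
End profiles.

(** * Three waves side by side around a plateau *)

Section three_waves.
Context {R : realType}.
Variables (beta gamma : R).
Implicit Types (t x th c Lam : R) (w : wave R) (A B V : state R) (K : set (state R)).

(** The centre is left free because the layout depends on where the plateau lies; the contribution
    [e V] to the energy rate is independent of it. *)
Definition translatable_wave A B K (e : state R -> R) Lam : Prop :=
  forall c, exists w W, profile beta gamma w W A B K c Lam /\
    forall V, integ 0 1 (fun th => w_spd w th * w_rho gamma V w th) = e V.

Section glue.
Variables (A0 A1 A2 A3 : state R) (K : set (state R)) (w1 w2 w3 : wave R).
Variables (W1 W2 W3 : R -> R -> state R) (c1 c2 c3 m1 m2 Lam : R).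
Hypotheses (P1 : profile beta gamma w1 W1 A0 A1 K c1 Lam)
  (P2 : profile beta gamma w2 W2 A1 A2 K c2 Lam)
  (P3 : profile beta gamma w3 W3 A2 A3 K c3 Lam).
Hypotheses (h1 : c1 + Lam < m1) (h2 : m1 < c2 - Lam)
  (h3 : c2 + Lam < m2) (h4 : m2 < c3 - Lam) (L0 : 0 <= Lam).

Definition glue t x : state R :=
  if x < m1 then W1 t x else if x < m2 then W2 t x else W3 t x.

Let before w W A B c o t x : profile beta gamma w W A B K c Lam ->
  0 <= t <= 1 -> x < c - Lam -> wfront w o t x = 0.
Proof.
move=> [_ _ _ _ h] t01 xc; apply: fronts_before => th th01.
by have /andP[+ _] := h t th t01 th01; exact: lt_le_trans.
Qed.

Let after w W A B c o t x : profile beta gamma w W A B K c Lam ->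
  0 <= t <= 1 -> c + Lam <= x -> oval beta gamma o B = oval beta gamma o A + wfront w o t x.
Proof.
move=> [_ hB _ _ h] t01 xc; rewrite hB; congr (_ + _); apply/esym/fronts_after => th th01.
by have /andP[_ hh] := h t th t01 th01; exact: le_trans hh xc.
Qed.

Lemma glue_rep o t x : 0 <= t <= 1 -> oval beta gamma o (glue t x) =
  oval beta gamma o A0 + (wfront w1 o t x + wfront w2 o t x + wfront w3 o t x).
Proof.
move=> t01; rewrite /glue.
have [r1 _ _ _ _] := P1; have [r2 _ _ _ _] := P2; have [r3 _ _ _ _] := P3.
have c13 : c2 - Lam < c3 - Lam by move: h3 h4 L0; lra.
have [x1|x1] := ltP x m1.
  have x2 := lt_trans x1 h2; have x3 := lt_trans x2 c13.
  by rewrite r1// (before _ P2 t01 x2) (before _ P3 t01 x3) !addr0.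
have x1' := le_trans (ltW h1) x1.
have [x2|x2] := ltP x m2.
  by rewrite r2// (after _ P1 t01 x1') (before _ P3 t01 (lt_trans x2 h4)) addr0 addrA.
have x2' := le_trans (ltW h3) x2.
by rewrite r3// (after _ P2 t01 x2') (after _ P1 t01 x1') !addrA.
Qed.

Lemma measurable_glue i : measurable_fun setT (fun z : R * R => glue z.1 z.2 ord0 i).
Proof.
have [_ _ q1 _ _] := P1; have [_ _ q2 _ _] := P2; have [_ _ q3 _ _] := P3.
rewrite (_ : (fun z : R * R => _) = fun z : R * R => if z.2 < m1 then W1 z.1 z.2 ord0 i
  else if z.2 < m2 then W2 z.1 z.2 ord0 i else W3 z.1 z.2 ord0 i).
  apply: measurable_fun_ifT => //; first exact: measurable_fun_ltr.
  by apply: measurable_fun_ifT => //; exact: measurable_fun_ltr.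
by apply/funext => z; rewrite /glue; case: ifP => //; case: ifP.
Qed.

Lemma glue_in t x : K (glue t x).
Proof.
have [_ _ _ q1 _] := P1; have [_ _ _ q2 _] := P2; have [_ _ _ q3 _] := P3.
by rewrite /glue; case: ifP => // _; case: ifP.
Qed.

Lemma glue_eq t x A : 0 <= t <= 1 ->
  (forall o, oval beta gamma o (glue t x) = oval beta gamma o A) -> glue t x = A.
Proof. by move=> t01 h; apply/rowP => i; exact: (h (OU i)). Qed.

Lemma glue_mid1 : glue 0 m1 = A1.
Proof.
have t01 : 0 <= (0 : R) <= 1 by rewrite lexx ler01.
apply: glue_eq => // o; rewrite glue_rep// (after _ P1 t01 (ltW h1)).
have x3 : m1 < c3 - Lam by move: h2 h3 h4 L0; lra.
by rewrite (before _ P2 t01 h2) (before _ P3 t01 x3) !addr0.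
Qed.

Lemma glue_mid2 : glue 0 m2 = A2.
Proof.
have t01 : 0 <= (0 : R) <= 1 by rewrite lexx ler01.
have x1' : c1 + Lam <= m2 by move: h1 h2 h3 L0; lra.
apply: glue_eq => // o; rewrite glue_rep// (after _ P2 t01 (ltW h3)) (after _ P1 t01 x1').
by rewrite (before _ P3 t01 h4) addr0 addrA.
Qed.

Lemma glue_right x : c3 + Lam <= x -> glue 0 x = A3.
Proof.
move=> x3; have t01 : 0 <= (0 : R) <= 1 by rewrite lexx ler01.
have x1' : c1 + Lam <= x by move: h1 h2 h3 h4 L0 x3; lra.
have x2' : c2 + Lam <= x by move: h1 h2 h3 h4 L0 x3; lra.
apply: glue_eq => // o; rewrite glue_rep// (after _ P3 t01 x3) (after _ P2 t01 x2').
by rewrite (after _ P1 t01 x1') !addrA.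
Qed.

End glue.

Variables (A0 A1 A2 A3 : state R) (K : set (state R)) (e1 e2 e3 : state R -> R).
Variables (Lam a sigma : R).
Hypotheses (g1 : 1 < gamma) (aA0 : admissible A0) (aA3 : admissible A3).
Hypotheses (K_adm : K `<=` [set W | admissible W]) (K_bnd : bounded_set K)
  (K_cvx : convex_states K) (L0 : 0 <= Lam).
Hypotheses (T1 : translatable_wave A0 A1 K e1 Lam)
  (T2 : translatable_wave A1 A2 K e2 Lam) (T3 : translatable_wave A2 A3 K e3 Lam).

Let sum1 (f : 'I_1 -> R) : \sum_i f i = f ord0.
Proof. by rewrite big_ord1. Qed.

Let sum2 (f : 'I_2 -> R) : \sum_i f i = f ord0 + f ord_max.
Proof. by rewrite big_ord_recl big_ord1; congr (_ + f _); exact/val_inj. Qed.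

Lemma three_waves_plateau1 :
  rel_entropy gamma A1 A0 = a * rel_entropy gamma A1 A3 ->
  0 < - (e1 A0 + a * (e2 A3 + e3 A3)) -> ~ a_contraction beta gamma A0 A3 sigma a.
Proof.
move=> GV rate; have L0' := L0.
(* The windows of half-width [Lam] around the three centres are disjoint, lie in
   [[- (4 * Lam + 3), 4 * Lam + 3]] and leave [(-1, 1)] free; this gives the values of [M] and
   [delta]. *)
have [w1 [W1 [P1 E1]]] := T1 (- (Lam + 1)).
have [w2 [W2 [P2 E2]]] := T2 (Lam + 1).
have [w3 [W3 [P3 E3]]] := T3 (3 * Lam + 3).
have h1 : - (Lam + 1) + Lam < 0 by lra.
have h2 : 0 < Lam + 1 - Lam by lra.
have h3 : Lam + 1 + Lam < 2 * Lam + 2 by lra.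
have h4 : 2 * Lam + 2 < 3 * Lam + 3 - Lam by lra.
pose U := glue W1 W2 W3 0 (2 * Lam + 2).
pose wl (_ : 'I_1) := w1.
pose wr (i : 'I_2) := if i == ord0 then w2 else w3.
have rep o t x : 0 <= t <= 1 -> oval beta gamma o (U t x) = oval beta gamma o A0 +
    wsum wl (fun j => oder o (wl j)) t x + wsum wr (fun j => oder o (wr j)) t x.
  move=> t01; rewrite (glue_rep P1 P2 P3 h1 h2 h3 h4)// /wsum sum1 sum2 /wl /wr/=.
  by rewrite !addrA.
apply: (@growing_energy_not_a_contraction R beta gamma a sigma A0 A3 A1 1 2 wl wr U K 1 (4 * Lam + 3)) => //.
- by move=> j t th t01 th01; have [_ _ _ _ /(_ t th t01 th01)/andP[? ?]] := P1; apply/andP; split; rewrite /wl; lra.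
- move=> j t th t01 th01; rewrite /wr; case: ifP => _.
    by have [_ _ _ _ /(_ t th t01 th01)/andP[? ?]] := P2; apply/andP; split; lra.
  by have [_ _ _ _ /(_ t th t01 th01)/andP[? ?]] := P3; apply/andP; split; lra.
- exact: (measurable_glue _ _ P1 P2 P3).
- by move=> t x; exact: (glue_in _ _ P1 P2 P3).
- by move=> i; exact: (rep (OU i)).
- by move=> i; exact: (rep (OF i)).
- exact: (rep Oe).
- exact: (rep Oq).
- exact: (glue_mid1 P1 P2 P3 h1 h2 h3 h4).
- by apply: (glue_right P1 P2 P3 h1 h2 h3 h4); lra.
- by rewrite sum1 sum2 /wl /wr/= E1 E2 E3.
- lra.
Qed.

(** The mirrored layout: the origin lies between the second and third waves, so the first two are
    measured against [A0] and only the last one carries the weight [a]. *)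
Lemma three_waves_plateau2 :
  rel_entropy gamma A2 A0 = a * rel_entropy gamma A2 A3 ->
  0 < - (e1 A0 + e2 A0 + a * e3 A3) -> ~ a_contraction beta gamma A0 A3 sigma a.
Proof.
move=> GV rate; have L0' := L0.
have [w1 [W1 [P1 E1]]] := T1 (- (3 * Lam + 3)).
have [w2 [W2 [P2 E2]]] := T2 (- (Lam + 1)).
have [w3 [W3 [P3 E3]]] := T3 (Lam + 1).
have h1 : - (3 * Lam + 3) + Lam < - (2 * Lam + 2) by lra.
have h2 : - (2 * Lam + 2) < - (Lam + 1) - Lam by lra.
have h3 : - (Lam + 1) + Lam < 0 by lra.
have h4 : 0 < Lam + 1 - Lam by lra.
pose U := glue W1 W2 W3 (- (2 * Lam + 2)) 0.
pose wl (i : 'I_2) := if i == ord0 then w1 else w2.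
pose wr (_ : 'I_1) := w3.
have rep o t x : 0 <= t <= 1 -> oval beta gamma o (U t x) = oval beta gamma o A0 +
    wsum wl (fun j => oder o (wl j)) t x + wsum wr (fun j => oder o (wr j)) t x.
  move=> t01; rewrite (glue_rep P1 P2 P3 h1 h2 h3 h4)// /wsum sum1 sum2 /wl /wr/=.
  by rewrite !addrA.
apply: (@growing_energy_not_a_contraction R beta gamma a sigma A0 A3 A2 2 1 wl wr U K 1 (4 * Lam + 3)) => //.
- move=> j t th t01 th01; rewrite /wl; case: ifP => _.
    by have [_ _ _ _ /(_ t th t01 th01)/andP[? ?]] := P1; apply/andP; split; lra.
  by have [_ _ _ _ /(_ t th t01 th01)/andP[? ?]] := P2; apply/andP; split; lra.
- by move=> j t th t01 th01; have [_ _ _ _ /(_ t th t01 th01)/andP[? ?]] := P3; apply/andP; split; rewrite /wr; lra.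
- exact: (measurable_glue _ _ P1 P2 P3).
- by move=> t x; exact: (glue_in _ _ P1 P2 P3).
- by move=> i; exact: (rep (OU i)).
- by move=> i; exact: (rep (OF i)).
- exact: (rep Oe).
- exact: (rep Oq).
- exact: (glue_mid2 P1 P2 P3 h1 h2 h3 h4).
- by apply: (glue_right P1 P2 P3 h1 h2 h3 h4); lra.
- by rewrite sum1 sum2 /wl /wr/= E1 E2 E3.
- lra.
Qed.

End three_waves.

(** * Contributions of shocks and fans to the energy rate *)

Section wave_energies.
Context {R : realType}.
Variables (beta gamma : R).
Implicit Types (t x th c Lam : R) (A B V : state R) (K : set (state R)).

Lemma shock_translatable A B sigma K Lam :
  flux beta gamma B - flux beta gamma A = sigma *: (B - A) ->
  Qflux beta gamma B - Qflux beta gamma A <= sigma * (eta gamma B - eta gamma A) ->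
  K A -> K B -> `|sigma| <= Lam ->
  translatable_wave beta gamma A B K (fun V => sigma *
    (eta gamma B - eta gamma A - \sum_i grad_eta gamma V i * (B ord0 i - A ord0 i))) Lam.
Proof.
move=> RH ent KA KB sL c; exists (shock_front c RH ent).
exists (fun t x => if c + sigma * t <= x then B else A); split.
  have := profile_le sL (shock_frontP c RH ent).
  move=> [? ? ? h ?]; split => // t x; by case: (h t x) => ->.
by move=> V; rewrite /w_rho/= integ_cst// subr0 mulr1.
Qed.

(** The increment from [A] to [B] of the flux of the relative entropy with respect to [V]. A fan
    contributes it to the energy rate because speed times entropy density is entropy flux
    density. *)
Definition flux_gap A B V : R := Qflux beta gamma B - Qflux beta gamma A -
  \sum_i grad_eta gamma V i * (flux beta gamma B ord0 i - flux beta gamma A ord0 i).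

Variables (Phi : R -> state R) (lam : R -> R).
Variables (gU : 'I_4 -> R -> R) (ge : R -> R) (r0 : R).

Let gr (o : obs) : R -> R := ogr gU (fun i r => lam r * gU i r) ge (fun r => lam r * ge r) o.

Hypothesis cPhi : forall o, continuous (fun r => oval beta gamma o (Phi r)).
Hypothesis cg : forall o, continuous (gr o).
Hypothesis clam : continuous lam.
Hypothesis dPhi : forall o r, r0 < r ->
  is_derive r 1 (fun r => oval beta gamma o (Phi r)) (gr o r).

(** The affine map [th -> p + (q - p) * th] may run along the curve in either direction, so one
    curve provides the fan from [U] to the plateau and the one back. *)
Lemma fan_translatable (p q k : R) K Lam : r0 <= p -> r0 <= q -> p != q ->
  0 <= k <= 1 ->
  (forall th th' t, 0 <= t <= 1 -> 0 <= th -> th <= th' -> th' <= 1 ->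
     lam (p + (q - p) * th) * (t - k) <= lam (p + (q - p) * th') * (t - k)) ->
  (forall th, 0 <= th <= 1 -> K (Phi (p + (q - p) * th))) ->
  (forall th, 0 <= th <= 1 -> `|lam (p + (q - p) * th)| <= Lam) ->
  translatable_wave beta gamma (Phi p) (Phi q) K (flux_gap (Phi p) (Phi q)) Lam.
Proof.
move=> r0p r0q pq k01 mono hK hLam c.
pose rho th : R := p + (q - p) * th.
have crho : continuous rho.
  by move=> th; apply: cvgD; [exact: cvg_cst|apply: cvgM; [exact: cvg_cst|exact: cvg_id]].
have drho th : is_derive th 1 rho (q - p).
  apply: is_derive_eq (isd_add (isd_cst th p) (isd_mul (isd_cst th (q - p)) (isd_id th))) _.
  by rewrite mulr1 mulr0 addr0 add0r.
have cc (f : R -> R) : continuous f -> continuous (fun th => f (rho th)).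
  by move=> cf th; apply: (@continuous_comp _ _ _ rho f); [exact: crho|exact: cf].
pose hU i th := gU i (rho th) * (q - p).
pose hF i th := lam (rho th) * hU i th.
pose he th := ge (rho th) * (q - p).
pose hq th := lam (rho th) * he th.
have hE o th : ogr hU hF he hq o th = gr o (rho th) * (q - p).
  by case: o => //=; rewrite /hF /hU /hq /he ?mulrA//; move=> i; rewrite mulrA.
have cP o : continuous (fun th => oval beta gamma o (Phi (rho th))).
  exact: (cc _ (@cPhi o)).
have ch o : continuous (ogr hU hF he hq o).
  rewrite (_ : ogr _ _ _ _ o = fun th => gr o (rho th) * (q - p)); last exact/funext/hE.
  by move=> th; apply: cvgM; [exact: (cc _ (@cg o))|exact: cvg_cst].
have dP o th : 0 < th < 1 ->
    is_derive th 1 (fun th => oval beta gamma o (Phi (rho th))) (ogr hU hF he hq o th).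
  move=> /andP[th0 th1]; rewrite hE.
  have r0r : r0 < rho th.
    rewrite /rho; case: (ltgtP p q) pq => // h _.
      by apply: (le_lt_trans r0p); rewrite ltrDl mulr_gt0// subr_gt0.
    apply: (le_lt_trans r0q).
    have : 0 < (p - q) * (1 - th) by rewrite mulr_gt0 ?subr_gt0.
    lra.
  exact: (isd_comp (dPhi o r0r) (drho th)).
have hFE i th : hF i th = lam (rho th) * hU i th by [].
have hqE th : hq th = lam (rho th) * he th by [].
pose w := fan_front ch (cc _ clam) hFE hqE c k.
have := @fan_frontP R beta gamma (fun th => Phi (rho th)) (fun th => lam (rho th)) hU hF he hq
  cP ch (cc _ clam) dP hFE hqE c k k01 mono K Lam hK hLam.
rewrite /rho mulr0 addr0 mulr1 (addrC p) subrK => Pw.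
exists w; eexists; split; first exact: Pw.
move=> V; have [_ hB _ _ _] := Pw.
have sr th : w_spd w th * w_rho gamma V w th = w_dq w th - \sum_i grad_eta gamma V i * w_dF w i th.
  rewrite /w_rho mulrBr mulr_sumr; congr (_ - _).
  by apply: eq_bigr => i _; rewrite w_dFE; ring.
transitivity (integ 0 1 (fun th => w_dq w th + \sum_i (- grad_eta gamma V i) * w_dF w i th)).
  apply: eq_integ => th _; rewrite sr -sumrN; congr (_ + _).
  by apply: eq_bigr => i _; rewrite mulNr.
rewrite integD; last 2 first.
- exact: w_bdq.
- by apply: bmeas_sum => i; apply: bmeasM; [exact: bmeas_cst|exact: w_bdF].
rewrite integ_sum; last by move=> i; apply: bmeasM; [exact: bmeas_cst|exact: w_bdF].
have hq1 : Qflux beta gamma (Phi q) = Qflux beta gamma (Phi p) + integ 0 1 (w_dq w) := hB Oq.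
have aK (a b : R) : a + b - a = b by ring.
rewrite /flux_gap hq1 aK -sumrN; congr (_ + _).
apply: eq_bigr => i _; have hF1 : flux beta gamma (Phi q) ord0 i = flux beta gamma (Phi p) ord0 i +
  integ 0 1 (w_dF w i) := hB (OF i).
rewrite hF1 aK.
by rewrite integZ ?mulNr//; exact: w_bdF.
Qed.

End wave_energies.

(** * The integral curve of the fast family *)

Section fast_speed.
Context {R : realType}.
Variables (beta gamma : R).
Hypothesis g1 : 1 < gamma.
Implicit Types (r y : R).

(* With r = 1 / v and y = B ^ 2 / 2, csq r is the square of the sound speed
   and fast r y the larger root alpha_+ of the characteristic equation. *)
Definition csq r : R := gamma * r `^ (gamma + 1).
Definition trc r y : R := (2 * y + beta ^+ 2) * r + csq r.
Definition dsc r y : R := trc r y ^+ 2 - 4 * (beta ^+ 2 * r * csq r).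
Definition fast r y : R := (trc r y + Num.sqrt (dsc r y)) / 2.

Lemma csq_gt0 r : 0 < r -> 0 < csq r.
Proof. by move=> r0; rewrite mulr_gt0 ?powR_gt0// (lt_trans ltr01). Qed.

Lemma dsc_ge r y : 0 < r -> 0 <= y -> (csq r + 2 * y * r - beta ^+ 2 * r) ^+ 2 <= dsc r y.
Proof.
move=> r0 y0; rewrite /dsc /trc -subr_ge0.
rewrite (_ : _ - _ = 8 * y * r * (beta ^+ 2 * r)); last by ring.
have b0 : 0 <= beta ^+ 2 * r by apply: mulr_ge0; [exact: sqr_ge0|exact: ltW].
by apply: mulr_ge0 b0; rewrite !mulr_ge0// ltW.
Qed.

Lemma dsc_ge' r y : 0 < r -> 0 <= y -> (beta ^+ 2 * r + 2 * y * r - csq r) ^+ 2 <= dsc r y.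
Proof.
move=> r0 y0; rewrite /dsc /trc -subr_ge0.
rewrite (_ : _ - _ = 8 * y * r * csq r); last by ring.
by apply: mulr_ge0; [rewrite !mulr_ge0// ltW|exact/ltW/csq_gt0].
Qed.

Lemma dsc_ge0 r y : 0 < r -> 0 <= y -> 0 <= dsc r y.
Proof. by move=> r0 y0; apply: le_trans (dsc_ge r0 y0); exact: sqr_ge0. Qed.

Let le_sqrt_sqr (z d : R) : z ^+ 2 <= d -> z <= Num.sqrt d.
Proof. by move=> h; rewrite (le_trans (ler_norm _))// -sqrtr_sqr ler_wsqrtr. Qed.

(** The characteristic equation [(alpha - c^2)(alpha - beta^2 / v) = alpha * B^2 / v]; later
    arguments rely on it rather than on the closed formula. *)
Lemma fast_root r y : 0 < r -> 0 <= y ->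
  (fast r y - csq r) * (fast r y - beta ^+ 2 * r) = 2 * y * r * fast r y.
Proof.
move=> r0 y0; have := sqr_sqrtr (dsc_ge0 r0 y0); rewrite /fast.
set s := Num.sqrt _ => E; apply/eqP; rewrite -subr_eq0.
rewrite (_ : _ - _ = (s ^+ 2 - dsc r y) / 4); first by rewrite E subrr mul0r.
by rewrite /dsc /trc; field.
Qed.

Lemma fast_ge_csq r y : 0 < r -> 0 <= y -> csq r + 2 * y * r <= fast r y.
Proof. by move=> r0 y0; have := le_sqrt_sqr (dsc_ge r0 y0); rewrite /fast /trc; lra. Qed.

Lemma fast_ge_beta r y : 0 < r -> 0 <= y -> beta ^+ 2 * r + 2 * y * r <= fast r y.
Proof. by move=> r0 y0; have := le_sqrt_sqr (dsc_ge' r0 y0); rewrite /fast /trc; lra. Qed.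

Lemma fast_gt0 r y : 0 < r -> 0 <= y -> 0 < fast r y.
Proof.
move=> r0 y0; apply: lt_le_trans (fast_ge_csq r0 y0).
by rewrite ltr_wpDr ?csq_gt0// !mulr_ge0// ltW.
Qed.

Lemma le_csq r r' : 0 < r -> r <= r' -> csq r <= csq r'.
Proof.
move=> r0 rr'; rewrite /csq ler_pM2l ?(lt_trans ltr01)//.
apply: ge0_ler_powR => //; first by move: g1; lra.
  by rewrite nnegrE ltW.
by rewrite nnegrE (le_trans (ltW r0)).
Qed.

(** If the root [f] at [(r, y)] exceeded the root [f'] at [(r', y')], the quadratic of [(r', y')]
    would be positive at [f], beyond its larger root. But [f] would also exceed both [csq r'] and
    [beta^2 * r'], and raising the coefficients then makes the quadratic at [f] at most the one of
    [(r, y)], which is 0 there. *)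
Lemma le_fast r y r' y' : 0 < r -> 0 <= y -> r <= r' -> y <= y' ->
  fast r y <= fast r' y'.
Proof.
move=> r0 y0 rr' yy'; rewrite leNgt; apply/negP => ff.
have r'0 := lt_le_trans r0 rr'; have y'0 := le_trans y0 yy'.
have E := fast_root r0 y0; have E' := fast_root r'0 y'0.
have cc := le_csq r0 rr'.
have bb : beta ^+ 2 * r <= beta ^+ 2 * r' by rewrite ler_wpM2l ?sqr_ge0.
have yr : 2 * y * r <= 2 * y' * r' by rewrite ler_pM// ?(ltW r0) ?mulr_ge0// ler_pM2l.
have h1 := fast_ge_csq r'0 y'0; have h2 := fast_ge_beta r'0 y'0.
have q0 : 0 <= 2 * y' * r' by rewrite !mulr_ge0// ltW.
have s0 := sqrtr_ge0 (dsc r' y').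
have sE : 2 * fast r' y' = trc r' y' + Num.sqrt (dsc r' y') by rewrite /fast; field.
have f0 := fast_gt0 r0 y0.
set f := fast r y in E ff f0 *; set f' := fast r' y' in E' ff h1 h2 sE *.
have L : (f - csq r') * (f - beta ^+ 2 * r') <= 2 * y' * r' * f.
  apply: (@le_trans _ _ (2 * y * r * f)); last by rewrite ler_pM2r.
  by rewrite -E; apply: ler_pM; move: cc bb ff h1 h2 q0; lra.
have : 0 < (f - f') * (f + f' - trc r' y').
  by rewrite mulr_gt0//; move: ff sE s0; lra.
have -> : (f - f') * (f + f' - trc r' y') = (f - csq r') * (f - beta ^+ 2 * r') - 2 * y' * r' * f
   - ((f' - csq r') * (f' - beta ^+ 2 * r') - 2 * y' * r' * f').
  by rewrite /trc; ring.
by rewrite E' subrr subr0 subr_gt0 ltNge L.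
Qed.

(** A magnetic field bounded away from 0 keeps the two roots apart: the arithmetic-geometric
    inequality for the two summands of the trace bounds the subtracted term of [dsc] by the fraction
    [beta^2 / (2 y0 + beta^2)] of [trc^2]. The inverse of the remaining fraction is the constant, at
    least 1 and so above its own square root. *)
Lemma trc_le_sqrt r y (y0 : R) : 0 < r -> 0 < y0 -> y0 <= y ->
  trc r y <= (2 * y0 + beta ^+ 2) / (2 * y0) * Num.sqrt (dsc r y).
Proof.
move=> r0 y00 y0y; have yp := lt_le_trans y00 y0y.
set k := _ / _; have k1 : 1 <= k.
  by rewrite ler_pdivlMr ?mulr_gt0// mul1r lerDl sqr_ge0.
have t0 : 0 < trc r y.
  rewrite addr_gt0 ?csq_gt0// mulr_gt0// ltr_wpDr ?sqr_ge0// mulr_gt0//.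
have d0 := dsc_ge0 r0 (ltW yp).
have key : trc r y ^+ 2 <= k * dsc r y.
  rewrite /k mulrAC ler_pdivlMr ?mulr_gt0//.
  have am : 4 * ((2 * y + beta ^+ 2) * r * csq r) <= trc r y ^+ 2.
    rewrite -subr_ge0 (_ : _ - _ = ((2 * y + beta ^+ 2) * r - csq r) ^+ 2) ?sqr_ge0//.
    by rewrite /trc; ring.
  have b2 := sqr_ge0 beta; have rc : 0 <= r * csq r by rewrite mulr_ge0 ?(ltW r0) ?(ltW (csq_gt0 r0)).
  rewrite /dsc -subr_ge0.
  rewrite (_ : _ - _ = beta ^+ 2 * (trc r y ^+ 2 - 4 * ((2 * y0 + beta ^+ 2) * r * csq r))); last by ring.
  rewrite mulr_ge0// subr_ge0 (le_trans _ am)// ler_pM2l// -!mulrA ler_wpM2r// lerD2r ler_pM2l//.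
have s0 := sqrtr_ge0 (dsc r y).
have k0 : 0 <= k by apply: le_trans k1.
have ks0 : 0 <= k * Num.sqrt (dsc r y) by apply: mulr_ge0.
rewrite -(@ler_pXn2r _ 2) ?nnegrE ?(ltW t0) ?ks0//.
rewrite exprMn sqr_sqrtr//; apply: le_trans key _; rewrite expr2 -mulrA ler_peMl//.
exact: mulr_ge0.
Qed.

(** The difference of the square roots is the difference of the discriminants over the sum of the
    roots, and [trc_le_sqrt] controls the sum of the traces by that sum. The bound is linear in [r],
    hence harmless once the differential equation divides by [r^2]. *)
Lemma fast_lipschitz r y y' (y0 : R) : 0 < r -> 0 < y0 -> y0 <= y -> y0 <= y' ->
  `|fast r y - fast r y'| <= (1 + (2 * y0 + beta ^+ 2) / (2 * y0)) * r * `|y - y'|.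
Proof.
move=> r0 y00 h h'; set k := _ / _.
have k0 : 0 <= k by rewrite divr_ge0// ?addr_ge0 ?sqr_ge0// mulr_ge0// ltW.
have yp := lt_le_trans y00 h; have yp' := lt_le_trans y00 h'.
have t := trc_le_sqrt r0 y00 h; have t' := trc_le_sqrt r0 y00 h'; rewrite -/k in t t'.
have E : trc r y - trc r y' = 2 * r * (y - y') by rewrite /trc; ring.
have Ed : (Num.sqrt (dsc r y) - Num.sqrt (dsc r y')) * (Num.sqrt (dsc r y) + Num.sqrt (dsc r y')) =
    (trc r y - trc r y') * (trc r y + trc r y').
  rewrite -!subr_sqr !sqr_sqrtr; [|exact: dsc_ge0 (ltW _)..].
  by rewrite /dsc; ring.
have tp : 0 < trc r y.
  rewrite addr_gt0 ?csq_gt0// mulr_gt0// ltr_wpDr ?sqr_ge0// mulr_gt0//.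
have tp' : 0 < trc r y'.
  rewrite addr_gt0 ?csq_gt0// mulr_gt0// ltr_wpDr ?sqr_ge0// mulr_gt0//.
set s := Num.sqrt (dsc r y) in t Ed *; set s' := Num.sqrt (dsc r y') in t' Ed *.
have ks : 0 < k * (s + s') by rewrite mulrDr (lt_le_trans _ (lerD t t'))// addr_gt0.
have ss : 0 < s + s'.
  have kp : 0 < k by rewrite divr_gt0 ?mulr_gt0// ltr_wpDr ?sqr_ge0// mulr_gt0.
  by rewrite -(pmulr_rgt0 _ kp).
have H : `|s - s'| <= k * `|trc r y - trc r y'|.
  rewrite -(ler_pM2r ss) -{1}(gtr0_norm ss) -normrM Ed normrM (gtr0_norm (addr_gt0 tp tp')).
  by rewrite (mulrC k) -mulrA ler_wpM2l// mulrDr lerD.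
rewrite (_ : fast r y - fast r y' = (trc r y - trc r y' + (s - s')) / 2); last first.
  by rewrite /fast -/s -/s'; field.
rewrite normrM (ger0_norm (_ : 0 <= 2^-1)) ?invr_ge0// ler_pdivrMr//.
apply: le_trans (ler_normD _ _) _; apply: le_trans (lerD (lexx _) H) _.
rewrite E !normrM (ger0_norm (ler0n _ 2)) (gtr0_norm r0) le_eqVlt; apply/orP; left; apply/eqP; ring.
Qed.

End fast_speed.

(** * Rules of continuity *)

Section continuity.
Context {R : realType} {T : topologicalType}.
Implicit Types (f g : T -> R).

Lemma ct_cst (k : R) : continuous (fun _ : T => k).
Proof. by move=> x; exact: cvg_cst. Qed.

Lemma ct_add f g : continuous f -> continuous g -> continuous (fun x => f x + g x).
Proof. by move=> cf cg x; apply: cvgD; [exact: cf|exact: cg]. Qed.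

Lemma ct_opp f : continuous f -> continuous (fun x => - f x).
Proof. by move=> cf x; apply: cvgN; exact: cf. Qed.

Lemma ct_mul f g : continuous f -> continuous g -> continuous (fun x => f x * g x).
Proof. by move=> cf cg x; apply: cvgM; [exact: cf|exact: cg]. Qed.

Lemma ct_sqr f : continuous f -> continuous (fun x => f x ^+ 2).
Proof. by move=> cf; under eq_fun do rewrite expr2; exact: ct_mul. Qed.

Lemma ct_inv f : (forall x, f x != 0) -> continuous f -> continuous (fun x => (f x)^-1).
Proof. by move=> f0 cf x; apply: cvgV; [exact: f0|exact: cf]. Qed.

Lemma ct_comp (h : R -> R) f : continuous h -> continuous f -> continuous (fun x => h (f x)).
Proof. by move=> ch cf x; apply: (@continuous_comp _ _ _ f h); [exact: cf|exact: ch]. Qed.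

Lemma ct_sqrt f : continuous f -> continuous (fun x => Num.sqrt (f x)).
Proof. by move=> cf; apply: (@ct_comp Num.sqrt) => //; exact: sqrt_continuous. Qed.

Lemma ct_max f (k : R) : continuous f -> continuous (fun x => Num.max (f x) k).
Proof.
by move=> cf x; apply: (@continuous_max R T f (fun=> k) x); [exact: cf|exact: cvg_cst].
Qed.

Lemma ct_powR f (p : R) : (forall x, 0 < f x) -> continuous f ->
  continuous (fun x => f x `^ p).
Proof.
move=> f0 cf x; apply: (@continuous_comp _ _ _ f (fun z => z `^ p)); first exact: cf.
apply/differentiable_continuous/derivable1_diffP.
exact: (@ex_derive _ _ _ _ _ _ _ (is_derive1_powR p (f0 x))).
Qed.

End continuity.

Lemma powRV {R : realType} (x p : R) : 0 < x -> x^-1 `^ p = x `^ (- p).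
Proof. by move=> x0; rewrite -(powR_inv1 (ltW x0)) -powRrM mulN1r. Qed.

(** * The differential equation of the curve *)

Section curve.
Context {R : realType}.
Variables (beta gamma : R) (U : state R).
Hypothesis g1 : 1 < gamma.
Hypotheses (aU : admissible U) (BU : st_B U != 0).
Implicit Types (r s : R).

Definition base_r : R := (st_v U)^-1.
Definition base_y : R := st_B U ^+ 2 / 2.
Notation r0 := base_r.
Notation y0 := base_y.

Lemma base_r_gt0 : 0 < r0. Proof. by rewrite invr_gt0. Qed.

Lemma base_y_gt0 : 0 < y0.
Proof. by rewrite divr_gt0// lt_neqAle sqr_ge0 eq_sym sqrf_eq0 BU. Qed.

(** The clamp extends the equation to all real [r], as [picard] requires, and keeps the density
    positive. *)
Definition rb r : R := Num.max r r0.

Lemma rb_gt0 r : 0 < rb r.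
Proof. by rewrite lt_max base_r_gt0 orbT. Qed.

Lemma rb_neq0 r : rb r != 0. Proof. by rewrite gt_eqF// rb_gt0. Qed.

Lemma rbE r : r0 <= r -> rb r = r.
Proof. by move=> h; rewrite /rb (max_idPl h). Qed.

Lemma rb_ge r : r0 <= rb r. Proof. by rewrite le_max lexx orbT. Qed.

Lemma ct_csq (T : topologicalType) (f : T -> R) : (forall x, 0 < f x) ->
  continuous f -> continuous (fun x => csq gamma (f x)).
Proof. by move=> f0 cf; apply: ct_mul; [exact: ct_cst|exact: ct_powR]. Qed.

Lemma ct_fast (T : topologicalType) (f g : T -> R) : (forall x, 0 < f x) ->
  continuous f -> continuous g -> continuous (fun x => fast beta gamma (f x) (g x)).
Proof.
move=> f0 cf cg.
have ct : continuous (fun x => trc beta gamma (f x) (g x)).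
  apply: ct_add; last exact: ct_csq.
  apply: ct_mul => //; apply: ct_add; last exact: ct_cst.
  by apply: ct_mul => //; exact: ct_cst.
apply: ct_mul; last exact: ct_cst.
apply: ct_add => //; apply: ct_sqrt; apply: ct_add; first exact: ct_sqr.
apply: ct_opp; apply: ct_mul; first exact: ct_cst.
by apply: ct_mul; [apply: ct_mul => //; exact: ct_cst|exact: ct_csq].
Qed.

(** The first and third equations give [d(p + B^2 / 2) = - alpha dv] along an integral curve. With
    [v = 1 / r] and [p = r^gamma] this becomes [y' = (alpha - c^2) / r^2] for [y = B^2 / 2], a
    scalar equation that decouples from [u] and [w]. *)
Lemma fast_curve_exists : exists y : R -> R,
  [/\ forall r, r <= r0 -> y r = y0, continuous y, forall r, y0 <= y r &
      forall r, r0 < r -> is_derive r 1 y ((fast beta gamma (rb r) (y r) - csq gamma (rb r)) / rb r ^+ 2)].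
Proof.
(* The maximum with [y0] makes the right-hand side Lipschitz in all real [y]; it disappears at the
   end because the solution never goes below [y0]. *)
pose k r y := (fast beta gamma (rb r) (Num.max y y0) - csq gamma (rb r)) / rb r ^+ 2.
pose L := (1 + (2 * y0 + beta ^+ 2) / (2 * y0)) / r0.
have y00 := base_y_gt0; have r00 := base_r_gt0.
have L1 : 0 < 1 + (2 * y0 + beta ^+ 2) / (2 * y0).
  by rewrite ltr_wpDr// divr_ge0 ?addr_ge0 ?sqr_ge0// mulr_ge0// ltW.
have L0 : 0 < L by rewrite divr_gt0.
have lip r y y' : `|k r y - k r y'| <= L * `|y - y'|.
  have rp := rb_gt0 r; have rn := rb_neq0 r.
  rewrite (_ : k r y - k r y' = (fast beta gamma (rb r) (Num.max y y0) -
    fast beta gamma (rb r) (Num.max y' y0)) / rb r ^+ 2); last by rewrite /k; field.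
  rewrite normrM (gtr0_norm (_ : 0 < (rb r ^+ 2)^-1)) ?invr_gt0 ?exprn_gt0//.
  rewrite ler_pdivrMr ?exprn_gt0//.
  have m1 : y0 <= Num.max y y0 by rewrite le_max lexx orbT.
  have m2 : y0 <= Num.max y' y0 by rewrite le_max lexx orbT.
  apply: le_trans (fast_lipschitz beta g1 rp y00 m1 m2) _.
  have m3 : `|Num.max y y0 - Num.max y' y0| <= `|y - y'|.
    rewrite /Num.max; case: ltP => h1; case: ltP => h2 //; rewrite ?subrr ?normr0//.
      rewrite distrC (distrC y) !ger0_norm ?subr_ge0//; lra.
    rewrite !ger0_norm ?subr_ge0//; lra.
  set D := `|y - y'| in m3 *.
  rewrite (_ : L * D * rb r ^+ 2 = (1 + (2 * y0 + beta ^+ 2) / (2 * y0)) * rb r * (D * (rb r / r0))).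
    rewrite ler_pM2l ?mulr_gt0//; apply: le_trans m3 _.
    by rewrite ler_peMr ?normr_ge0// ler_pdivlMr// mul1r rb_ge.
  by rewrite /L; field; rewrite !gt_eqF.
have ck : continuous (fun z : R * R => k z.1 z.2).
  have c1 : continuous (fun z : R * R => z.1 : R) by move=> z; exact: cvg_fst.
  have c2 : continuous (fun z : R * R => z.2 : R) by move=> z; exact: cvg_snd.
  have crb : continuous (fun z : R * R => rb z.1) by exact: ct_max.
  apply: ct_mul.
    apply: ct_add; last by apply/ct_opp/ct_csq => // z; exact: rb_gt0.
    by apply: ct_fast; [move=> z; exact: rb_gt0| |exact: ct_max].
  by apply: ct_inv; [move=> z; rewrite expf_neq0// rb_neq0|exact: ct_sqr].
have [y [yl cy dy]] := picard r0 y0 L0 lip ck.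
have yge r : y0 <= y r.
  have [h|/ltW h] := leP r r0; first by rewrite yl.
  have := @is_derive_le R (fun=> 0) y (fun=> 0) _ r0 r h (@ct_cst R R 0) cy
    (fun s _ => isd_cst s 0) (fun s hs => dy s (andP hs).1).
  rewrite subrr (yl r0 (lexx _)) subr_ge0; apply => s _.
  have rp := rb_gt0 s.
  rewrite divr_ge0 ?sqr_ge0// subr_ge0.
  have m0 : 0 <= Num.max (y s) y0 by rewrite le_max (ltW y00) orbT.
  apply: le_trans (fast_ge_csq beta gamma rp m0).
  by rewrite lerDl !mulr_ge0// ltW.
exists y; split => // r h; have := dy r h; rewrite /k.
by rewrite (max_idPl (yge r)).
Qed.

End curve.

(** * States, fluxes and entropies along the curve *)

Section curve_states.
Context {R : realType}.
Variables (beta gamma eps : R) (U : state R) (y : R -> R).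
Hypotheses (g1 : 1 < gamma) (eps2 : eps ^+ 2 = 1).
Hypotheses (aU : admissible U) (BU : st_B U != 0).
Implicit Types (r s : R).
Notation r0 := (base_r U).
Notation y0 := (base_y U).
Notation rb := (rb U).

Definition aly r : R := fast beta gamma (rb r) (y r).
Definition slope r : R := (aly r - csq gamma (rb r)) / rb r ^+ 2.

Hypothesis y_left : forall r, r <= r0 -> y r = y0.
Hypothesis y_cont : continuous y.
Hypothesis y_ge : forall r, y0 <= y r.
Hypothesis y_der : forall r, r0 < r -> is_derive r 1 y (slope r).

Let r00 : 0 < r0. Proof. exact: base_r_gt0. Qed.
Let y00 : 0 < y0. Proof. exact: base_y_gt0. Qed.
Let rp r : 0 < rb r. Proof. exact: rb_gt0. Qed.
Let rn r : rb r != 0. Proof. exact: rb_neq0. Qed.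
Let yp r : 0 < y r. Proof. exact: lt_le_trans (y_ge r). Qed.
Let ypw r : 0 <= y r. Proof. exact: ltW. Qed.

Lemma aly_gt0 r : 0 < aly r.
Proof. exact: fast_gt0. Qed.

(** [eps = -1] gives the speed lambda_1 and [eps = 1] the speed lambda_4; both families are treated
    together. *)
Definition cspd r : R := eps * Num.sqrt (aly r).
(** The field B, with the sign it has at [U]: as [y] stays positive, B cannot change sign. *)
Definition mag r : R := Num.sg (st_B U) * Num.sqrt (2 * y r).
Definition dmag r : R := slope r / mag r.

Let eps0 : eps != 0.
Proof. by apply: contra_eq_neq eps2 => ->; rewrite expr0n eq_sym oner_neq0. Qed.

Lemma cspd_sqr r : cspd r ^+ 2 = aly r.
Proof. by rewrite exprMn eps2 mul1r sqr_sqrtr// ltW// aly_gt0. Qed.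

Lemma cspd_neq0 r : cspd r != 0.
Proof. by rewrite mulf_neq0// sqrtr_eq0 -ltNge aly_gt0. Qed.

Let sg2 : Num.sg (st_B U) ^+ 2 = 1.
Proof. by rewrite sqr_sg BU. Qed.

Lemma mag_sqr r : mag r ^+ 2 = 2 * y r.
Proof. by rewrite exprMn sg2 mul1r sqr_sqrtr// mulr_ge0. Qed.

Lemma mag_neq0 r : mag r != 0.
Proof. by rewrite -sqrf_eq0 mag_sqr mulf_neq0// gt_eqF. Qed.

Lemma mag_left r : r <= r0 -> mag r = st_B U.
Proof.
move=> h; rewrite /mag y_left// /base_y (_ : 2 * _ = st_B U ^+ 2); last by field.
by rewrite sqrtr_sqr -numEsg.
Qed.

(* (beta ^ 2 - alpha v) dB = alpha B dv in the variable r = 1 / v *)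
Lemma dmag_eq r : dmag r * (aly r - beta ^+ 2 * rb r) = aly r * mag r / rb r.
Proof.
have E := fast_root beta gamma (rp r) (ypw r); rewrite -/(aly r) in E.
rewrite /dmag /slope.
rewrite (_ : _ * _ = (aly r - csq gamma (rb r)) * (aly r - beta ^+ 2 * rb r) / (rb r ^+ 2 * mag r)); last first.
  by field; rewrite mag_neq0 rn.
by rewrite E -mag_sqr; field; rewrite mag_neq0 rn.
Qed.

(** The second and fourth equations with [w] eliminated: [dmag / rb - mag / rb^2] is the derivative
    of [q = mag / rb]. *)
Lemma dmag_eq2 r : beta ^+ 2 * dmag r = aly r * (dmag r / rb r - mag r / rb r ^+ 2).
Proof.
have -> : dmag r / rb r - mag r / rb r ^+ 2 = (dmag r - mag r / rb r) / rb r by field; exact: rn.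
rewrite mulrA mulrBr (_ : aly r * (mag r / rb r) = aly r * mag r / rb r); last by rewrite mulrA.
by rewrite -dmag_eq; field; exact: rn.
Qed.

Let crb : continuous rb. Proof. by apply: ct_max => x; exact: cvg_id. Qed.

Lemma aly_cont : continuous aly.
Proof. exact: ct_fast. Qed.

Lemma cspd_cont : continuous cspd.
Proof. by apply: ct_mul; [exact: ct_cst|apply: ct_sqrt; exact: aly_cont]. Qed.

Lemma mag_cont : continuous mag.
Proof.
apply: ct_mul; first exact: ct_cst.
by apply: ct_sqrt; apply: ct_mul => //; exact: ct_cst.
Qed.

Let crb2V : continuous (fun r => (rb r ^+ 2)^-1).
Proof. by apply: ct_inv; [move=> r; rewrite expf_neq0|exact: ct_sqr]. Qed.

Lemma slope_cont : continuous slope.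
Proof.
apply: ct_mul => //; apply: ct_add; first exact: aly_cont.
by apply: ct_opp; exact: ct_csq.
Qed.

Lemma dmag_cont : continuous dmag.
Proof.
apply: ct_mul; first exact: slope_cont.
by apply: ct_inv; [exact: mag_neq0|exact: mag_cont].
Qed.

(** [du] and [dw] solve the first and fourth components of [F' = lambda U']; the other two
    components are the equations for [y] and for [mag]. *)
Definition du r : R := cspd r / rb r ^+ 2.
Definition dw r : R := - beta * dmag r / cspd r.

Lemma du_cont : continuous du.
Proof. by apply: ct_mul => //; exact: cspd_cont. Qed.

Lemma dw_cont : continuous dw.
Proof.
apply: ct_mul; first by apply: ct_mul; [exact: ct_cst|exact: dmag_cont].
by apply: ct_inv; [exact: cspd_neq0|exact: cspd_cont].
Qed.

Definition vu r : R := st_u U + integ r0 r du.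
Definition vw r : R := st_w U + integ r0 r dw.

Lemma vu_cont : continuous vu.
Proof. by apply: ct_add; [exact: ct_cst|case: (primitiveP r0 du_cont)]. Qed.

Lemma vw_cont : continuous vw.
Proof. by apply: ct_add; [exact: ct_cst|case: (primitiveP r0 dw_cont)]. Qed.

Lemma vu_der r : r0 < r -> is_derive r 1 vu (du r).
Proof.
move=> h; case: (primitiveP r0 du_cont) => _ _ _ /(_ r h) d.
by have := isd_add (isd_cst r (st_u U)) d; rewrite add0r.
Qed.

Lemma vw_der r : r0 < r -> is_derive r 1 vw (dw r).
Proof.
move=> h; case: (primitiveP r0 dw_cont) => _ _ _ /(_ r h) d.
by have := isd_add (isd_cst r (st_w U)) d; rewrite add0r.
Qed.

Definition Phi r : state R := mkstate (rb r)^-1 (mag r / rb r) (vu r) (vw r).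

Lemma Phi_base : Phi r0 = U.
Proof.
rewrite -[RHS]mkstateK /Phi rbE// mag_left// /base_r invrK.
have [z1 _ _ _] := primitiveP r0 du_cont; have [z2 _ _ _] := primitiveP r0 dw_cont.
rewrite /vu /vw z1 z2 !addr0; congr mkstate.
by rewrite /st_B mulfVK// gt_eqF.
Qed.

Lemma Phi_B r : st_B (Phi r) = mag r.
Proof. by rewrite /st_B !mkstateE invrK mulfVK. Qed.

Lemma Phi_pressure r : pressure gamma (st_v (Phi r)) = rb r `^ gamma.
Proof. by rewrite /pressure mkstateE powRV// opprK. Qed.

Lemma Phi_eta r : eta gamma (Phi r) =
  rb r `^ (gamma - 1) / (gamma - 1) + (vu r ^+ 2 + vw r ^+ 2) / 2 + y r / rb r.
Proof.
rewrite /eta !mkstateE powRV// opprB; congr (_ + _).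
have -> : y r = mag r ^+ 2 / 2 by rewrite mag_sqr mulrAC divff ?mul1r.
by field; rewrite rn.
Qed.

Lemma Phi_Q r : Qflux beta gamma (Phi r) =
  (rb r `^ gamma + y r) * vu r - beta * mag r * vw r.
Proof.
rewrite /Qflux Phi_pressure Phi_B !mkstateE mag_sqr.
by rewrite (mulrC 2) mulfK.
Qed.

Lemma Phi_U r i : Phi r ord0 i = [:: (rb r)^-1; mag r / rb r; vu r; vw r]`_i.
Proof. by rewrite mxE. Qed.

Lemma Phi_F r i : flux beta gamma (Phi r) ord0 i =
  [:: - vu r; - (beta * vw r); rb r `^ gamma + y r; - (beta * mag r)]`_i.
Proof.
rewrite /flux mxE Phi_pressure Phi_B !mkstateE mag_sqr.
by rewrite (mulrC 2) mulfK.
Qed.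

Definition gU (i : 'I_4) r : R :=
  [:: - (rb r ^+ 2)^-1; dmag r / rb r - mag r / rb r ^+ 2; du r; dw r]`_i.
Definition ge r : R := rb r `^ (gamma - 2) + slope r / rb r - y r / rb r ^+ 2
  + vu r * du r + vw r * dw r.

Let gr (o : obs) : R -> R :=
  ogr gU (fun i r => cspd r * gU i r) ge (fun r => cspd r * ge r) o.

Let crbV : continuous (fun r => (rb r)^-1).
Proof. exact: ct_inv. Qed.

Lemma gU_cont i : continuous (gU i).
Proof.
elim/ord4_ind: i; rewrite /gU inordK//=.
- exact: ct_opp.
- apply: ct_add; first by apply: ct_mul => //; exact: dmag_cont.
  by apply: ct_opp; apply: ct_mul => //; exact: mag_cont.
- exact: du_cont.
- exact: dw_cont.
Qed.

Lemma ge_cont : continuous ge.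
Proof.
apply: ct_add; last by apply: ct_mul; [exact: vw_cont|exact: dw_cont].
apply: ct_add; last by apply: ct_mul; [exact: vu_cont|exact: du_cont].
apply: ct_add; last by apply: ct_opp; exact: ct_mul.
by apply: ct_add; [exact: ct_powR|apply: ct_mul => //; exact: slope_cont].
Qed.

Lemma gr_cont o : continuous (gr o).
Proof.
case: o => [i|i||]; rewrite /gr/=.
- exact: gU_cont.
- by apply: ct_mul; [exact: cspd_cont|exact: gU_cont].
- exact: ge_cont.
- by apply: ct_mul; [exact: cspd_cont|exact: ge_cont].
Qed.

Lemma oval_cont o : continuous (fun r => oval beta gamma o (Phi r)).
Proof.
case: o => [i|i||]; rewrite /oval.
- under eq_fun do rewrite Phi_U; elim/ord4_ind: i; rewrite inordK//=.
  + by apply: ct_mul => //; exact: mag_cont.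
  + exact: vu_cont.
  + exact: vw_cont.
- under eq_fun do rewrite Phi_F; elim/ord4_ind: i; rewrite inordK//=.
  + by apply: ct_opp; exact: vu_cont.
  + by apply/ct_opp/ct_mul; [exact: ct_cst|exact: vw_cont].
  + by apply: ct_add => //; exact: ct_powR.
  + by apply/ct_opp/ct_mul; [exact: ct_cst|exact: mag_cont].
- under eq_fun do rewrite Phi_eta; apply: ct_add; last exact: ct_mul.
  apply: ct_add; first by apply: ct_mul; [exact: ct_powR|exact: ct_cst].
  apply: ct_mul; last exact: ct_cst.
  by apply: ct_add; apply: ct_sqr; [exact: vu_cont|exact: vw_cont].
- under eq_fun do rewrite Phi_Q; apply: ct_add.
    by apply: ct_mul; [apply: ct_add => //; exact: ct_powR|exact: vu_cont].
  apply/ct_opp/ct_mul; last exact: vw_cont.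
  by apply: ct_mul; [exact: ct_cst|exact: mag_cont].
Qed.

Lemma rb_der r : r0 < r -> is_derive r 1 rb 1.
Proof.
move=> h; apply: near_eq_is_derive (isd_id r); near=> s.
rewrite rbE//; apply/ltW; near: s; exact: lt_nbhsr.
Unshelve. all: by end_near. Qed.

Lemma mag_der r : r0 < r -> is_derive r 1 mag (dmag r).
Proof.
move=> h; have y2 : 0 < 2 * y r by rewrite mulr_gt0.
have d2 : is_derive r 1 (fun r => 2 * y r) (2 * slope r).
  by have := isd_mul (isd_cst r 2) (y_der h); rewrite mulr0 addr0.
have := isd_mul (isd_cst r (Num.sg (st_B U))) (@isd_sqrt R (fun r => 2 * y r) r _ y2 d2).
move/is_derive_eq; apply; rewrite mulr0 addr0 /dmag /mag.
set s := Num.sg _; have s0 : s != 0 by rewrite sgr_eq0.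
have q0 : Num.sqrt (2 * y r) != 0 by rewrite sqrtr_eq0 -ltNge.
rewrite [RHS](_ : _ = slope r * s / (s ^+ 2 * Num.sqrt (2 * y r))); last by field; rewrite s0 q0.
by rewrite sg2; field.
Qed.

Let pow_der r p : r0 < r -> is_derive r 1 (fun r => rb r `^ p) (p * rb r `^ (p - 1)).
Proof. by move=> h; have := isd_powR p (rp r) (rb_der h); rewrite mulr1. Qed.

Let csq_pow r : csq gamma (rb r) = gamma * rb r `^ (gamma - 1) * rb r ^+ 2.
Proof.
rewrite /csq -mulrA; congr (_ * _); rewrite -[rb r ^+ 2]/(rb r ^+ 2).
rewrite -powR_mulrn ?(ltW (rp r))// -powRD; first by congr (_ `^ _); ring.
by rewrite rn implybT.
Qed.

Let pow2 r : rb r `^ gamma = rb r `^ (gamma - 2) * rb r ^+ 2.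
Proof.
rewrite -powR_mulrn ?(ltW (rp r))// -powRD; first by congr (_ `^ _); ring.
by rewrite rn implybT.
Qed.

Let inv_der r : r0 < r -> is_derive r 1 (fun r => (rb r)^-1) (- (rb r ^+ 2)^-1).
Proof. by move=> h; have := isd_inv (rn r) (rb_der h); rewrite mulN1r. Qed.

Let magr_der r : r0 < r ->
  is_derive r 1 (fun r => mag r / rb r) (dmag r / rb r - mag r / rb r ^+ 2).
Proof.
move=> h; have := isd_mul (mag_der h) (inv_der h); move/is_derive_eq; apply.
by ring.
Qed.

Lemma oval_der o r : r0 < r ->
  is_derive r 1 (fun r => oval beta gamma o (Phi r)) (gr o r).
Proof.
move=> h; have l0 := cspd_neq0 r; have l2 := cspd_sqr r.
have m0 := mag_neq0 r; have m2 := mag_sqr r.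
have b2 := dmag_eq2 r.
case: o => [i|i||]; rewrite /oval /gr/=.
- under eq_fun do rewrite Phi_U; elim/ord4_ind: i; rewrite /gU !inordK//=.
  + exact: inv_der.
  + exact: magr_der.
  + exact: vu_der.
  + exact: vw_der.
- under eq_fun do rewrite Phi_F; elim/ord4_ind: i; rewrite /gU !inordK//=.
  + apply: is_derive_eq (isd_opp (vu_der h)) _; rewrite /du; ring.
  + have := isd_opp (isd_mul (isd_cst r beta) (vw_der h)); move/is_derive_eq; apply.
    rewrite mulr0 addr0 /dw.
    apply: (mulfI l0); rewrite [RHS]mulrA -[X in _ = X * _]expr2 l2 -b2; field; exact: l0.
  + have := isd_add (pow_der gamma h) (y_der h); move/is_derive_eq; apply.
    by rewrite /du [RHS]mulrA -[X in _ = X / _]expr2 l2 /slope csq_pow; field; exact: rn.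
  + have := isd_opp (isd_mul (isd_cst r beta) (mag_der h)); move/is_derive_eq; apply.
    by rewrite mulr0 addr0 /dw; field; exact: l0.
- under eq_fun do rewrite Phi_eta.
  have := isd_add (isd_add (isd_mul (pow_der (gamma - 1) h) (isd_cst r (gamma - 1)^-1))
    (isd_mul (isd_add (isd_sqr (vu_der h)) (isd_sqr (vw_der h))) (isd_cst r 2^-1)))
    (isd_mul (y_der h) (inv_der h)).
  move/is_derive_eq; apply; rewrite /ge (_ : gamma - 1 - 1 = gamma - 2); last by ring.
  have g0 : gamma - 1 != 0 by rewrite subr_eq0 gt_eqF.
  by field; rewrite g0 rn.
- under eq_fun do rewrite Phi_Q.
  have := isd_add (isd_mul (isd_add (pow_der gamma h) (y_der h)) (vu_der h))
    (isd_opp (isd_mul (isd_mul (isd_cst r beta) (mag_der h)) (vw_der h))).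
  move/is_derive_eq; apply.
  have F2 : gamma * rb r `^ (gamma - 1) + slope r = cspd r ^+ 2 / rb r ^+ 2.
    by rewrite l2 /slope csq_pow; field; exact: rn.
  (* This is [dmag_eq2] multiplied by [mag]; with the momentum relation [F2] it reduces
     [Q' = lambda eta'] to field algebra. *)
  have key : beta ^+ 2 * slope r - cspd r ^+ 2 * (slope r / rb r - 2 * y r / rb r ^+ 2) = 0.
    have -> : slope r = dmag r * mag r by rewrite /dmag divfK.
    rewrite l2 mulrA b2 -m2; field; exact: rn.
  rewrite F2 /ge /du /dw pow2; apply/eqP; rewrite -subr_eq0; apply/eqP.
  rewrite (_ : dmag r = slope r / mag r)//.
  rewrite -[RHS](mul0r (cspd r)^-1) -[in RHS]key.
  by field; rewrite l0 rn m0.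
Qed.

End curve_states.

(** * Energies along the curve *)

Section relative_entropy.
Context {R : realType}.
Variable (gamma : R).
Hypothesis g1 : 1 < gamma.
Implicit Types (U V : state R).

(** By homogeneity only the ratio [x = v / v'] matters, and the claim follows from
    [x^(1 - gamma) >= 1 + (1 - gamma) ln x] and [ln x <= x - 1]. *)
Lemma internal_energy_convex (v v' : R) : 0 < v -> 0 < v' ->
  0 <= v `^ (1 - gamma) / (gamma - 1) - v' `^ (1 - gamma) / (gamma - 1)
       + v' `^ (- gamma) * (v - v').
Proof.
move=> v0 v'0; have g0 : 0 < gamma - 1 by rewrite subr_gt0.
have E1 : v `^ (1 - gamma) = v' `^ (1 - gamma) * (v / v') `^ (1 - gamma).
  by rewrite -powRM ?divr_ge0 ?ltW// mulrCA divff ?mulr1// gt_eqF.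
have E2 : v' `^ (- gamma) = v' `^ (1 - gamma) / v'.
  rewrite [in LHS](_ : - gamma = (1 - gamma) - 1); last by ring.
  by rewrite powRD ?(gt_eqF v'0) ?implybT// powR_inv1 ?(ltW v'0).
rewrite E1 E2; set p := v' `^ _; set x := v / v'.
have x0 : 0 < x by rewrite divr_gt0.
have -> : p * x `^ (1 - gamma) / (gamma - 1) - p / (gamma - 1) + p / v' * (v - v') =
   p / (gamma - 1) * (x `^ (1 - gamma) - 1 + (gamma - 1) * (x - 1)).
  by rewrite /x; field; rewrite !gt_eqF.
rewrite mulr_ge0 ?divr_ge0 ?powR_ge0 ?(ltW g0)//.
have h1 : 1 + (1 - gamma) * ln x <= x `^ (1 - gamma).
  by rewrite /powR gt_eqF//; exact: expR_ge1Dx.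
have h2 : ln x <= x - 1.
  have -> : ln x = ln (1 + (x - 1)) by rewrite addrC subrK.
  by apply: le_ln1Dx; rewrite ltrBrDr addNr.
have : (gamma - 1) * ln x <= (gamma - 1) * (x - 1) by rewrite ler_pM2l.
by move: h1; lra.
Qed.

(** In terms of v, B, u, w the relative entropy is the convexity defect of the internal energy plus
    half the squares of the jumps of u and w plus [v / 2] times the square of the jump of B. *)
Lemma rel_entropy_ge U V : admissible U -> admissible V ->
  (st_u U - st_u V) ^+ 2 / 2 <= rel_entropy gamma U V.
Proof.
move=> aU aV; rewrite rel_entropyE// sum4 /grad_eta !inordK//=.
rewrite -/(st_v U) -/(st_q U) -/(st_u U) -/(st_w U) -/(st_v V) -/(st_q V) -/(st_u V) -/(st_w V).
have := internal_energy_convex aU aV; rewrite /eta /Pi /pressure => I.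
rewrite -subr_ge0.
have vU : st_v U != 0 by rewrite gt_eqF.
have vV : st_v V != 0 by rewrite gt_eqF.
set pU := st_v U `^ _ in I *; set pV := st_v V `^ (1 - gamma) in I *; set q := st_v V `^ _ in I *.
have -> : pU / (gamma - 1) + (st_u U ^+ 2 + st_w U ^+ 2) / 2 + st_q U ^+ 2 / (2 * st_v U) -
   (pV / (gamma - 1) + (st_u V ^+ 2 + st_w V ^+ 2) / 2 + st_q V ^+ 2 / (2 * st_v V)) -
   (- (q + st_B V ^+ 2 / 2) * (st_v U - st_v V) + st_B V * (st_q U - st_q V) +
    st_u V * (st_u U - st_u V) + st_w V * (st_w U - st_w V)) -
   (st_u U - st_u V) ^+ 2 / 2 =
   (pU / (gamma - 1) - pV / (gamma - 1) + q * (st_v U - st_v V)) +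
   (st_w U - st_w V) ^+ 2 / 2 + st_v U * (st_B U - st_B V) ^+ 2 / 2.
  by rewrite /st_B; field; rewrite vU vV subr_eq0 gt_eqF.
have h1 : 0 <= (st_w U - st_w V) ^+ 2 / 2 by rewrite divr_ge0 ?sqr_ge0.
have h2 : 0 <= st_v U * (st_B U - st_B V) ^+ 2 / 2.
  by rewrite divr_ge0// mulr_ge0 ?sqr_ge0// ltW.
by move: I h1 h2; lra.
Qed.

Lemma rel_entropy_ge0 U V : admissible U -> admissible V -> 0 <= rel_entropy gamma U V.
Proof.
by move=> aU aV; apply: le_trans (rel_entropy_ge aU aV); rewrite divr_ge0 ?sqr_ge0.
Qed.

Lemma rel_entropy_gt0 U V : admissible U -> admissible V -> st_u U != st_u V ->
  0 < rel_entropy gamma U V.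
Proof.
move=> aU aV uu; apply: lt_le_trans (rel_entropy_ge aU aV).
by rewrite divr_gt0// lt_neqAle sqr_ge0 eq_sym sqrf_eq0 subr_eq0 uu.
Qed.

End relative_entropy.

Section first_zero.
Context {R : realType}.

(** [c] is the end of the largest initial interval on which [f >= 0]. The function may touch 0
    earlier; the later use needs the sign on all of [[a, c]]. *)
Lemma first_zero (f : R -> R) (a b : R) : continuous f -> a < b -> 0 < f a -> f b < 0 ->
  exists c, [/\ a < c, f c = 0 & forall x, a <= x <= c -> 0 <= f x].
Proof.
move=> cf ab fa fb.
pose S : set R := [set x | a <= x <= b /\ forall s, a <= s <= x -> 0 <= f s].
have Sa : S a.
  split; first by rewrite lexx ltW.
  by move=> s; rewrite -eq_le => /eqP <-; exact: ltW.
have Sub : has_ubound S by exists b => x [/andP[]].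
pose c := sup S.
have ac : a <= c by exact: ub_le_sup.
have cb : c <= b by apply: ge_sup; [exists a|move=> x [/andP[]]].
have below s : a <= s -> s < c -> 0 <= f s.
  move=> as_ sc; have [x [_ hx] sx] : exists2 x, S x & s < x.
    have [|x Sx] := @sup_adherent _ S (c - s) _ (conj (ex_intro _ a Sa) Sub).
      by rewrite subr_gt0.
    by rewrite opprB addrCA subrr addr0 => h; exists x.
  by apply: hx; rewrite as_ ltW.
have nb e : 0 < e -> exists2 d, 0 < d & forall s, `|c - s| < d -> `|f c - f s| < e.
  by move=> e0; have /cvgrPdist_lt/(_ e e0)/nbhs_ballP[d /= d0 hd] := cf c; exists d.
have fc0 : 0 <= f c.
  rewrite leNgt; apply/negP => fc.
  have [|d d0 hd] := nb (- f c); first by rewrite oppr_gt0.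
  have ca : a < c by rewrite lt_neqAle ac andbT; apply: contraTneq fa => ->; rewrite -leNgt ltW.
  pose s := Num.max a (c - d / 2).
  have sc : s < c by rewrite gt_max ca gtrBl divr_gt0.
  have as_ : a <= s by rewrite le_max lexx.
  have sd : c - d / 2 <= s by rewrite le_max lexx orbT.
  have /hd : `|c - s| < d by rewrite gtr0_norm ?subr_gt0//; lra.
  by have := below s as_ sc; rewrite ltr_norml => ? /andP[]; lra.
have cltb : c < b by rewrite lt_neqAle cb andbT; apply: contraTneq fb => <-; rewrite -leNgt.
have fcE : f c = 0.
  apply/eqP; rewrite eq_le fc0 andbT leNgt; apply/negP => fc.
  have [d d0 hd] := nb _ fc.
  pose s := Num.min b (c + d / 2).
  have cs : c < s by rewrite lt_min cltb ltrDl divr_gt0.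
  have sb : s <= b by rewrite ge_min lexx.
  have sd : s <= c + d / 2 by rewrite ge_min lexx orbT.
  suff : s <= c by rewrite leNgt cs.
  apply: ub_le_sup => //; split; first by rewrite sb (le_trans ac (ltW cs)).
  move=> x /andP[ax xs]; have [xc|xc] := ltP x c; first exact: below.
  have /hd : `|c - x| < d by rewrite distrC ger0_norm ?subr_ge0//; lra.
  by rewrite ltr_norml => /andP[]; lra.
exists c; split => //.
  by rewrite lt_neqAle ac andbT; apply: contraTneq fa => ->; rewrite fcE ltxx.
move=> x /andP[ax]; rewrite le_eqVlt => /predU1P[->|xc]; first by rewrite fcE.
exact: below.
Qed.

Lemma is_derive_ge0 (f : R -> R) (r l : R) : is_derive r 1 f l ->
  (forall h, 0 < h -> f r <= f (r + h)) -> 0 <= l.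
Proof.
move=> df hf; rewrite leNgt; apply/negP => l0.
have C : (fun h => h^-1 *: ((f \o shift r) (h *: 1) - f r)) @ 0^' --> l.
  rewrite -(@derive_val _ _ _ _ _ _ _ df); exact: (@ex_derive _ _ _ _ _ _ _ df).
have /cvgrPdist_lt/(_ (- l)) := C; rewrite oppr_gt0 => /(_ l0).
rewrite /dnbhs /within /= => /nbhs_ballP[d /= d0 hd].
have h0 : 0 < d / 2 by rewrite divr_gt0.
have := hd (d / 2); rewrite /ball/= sub0r normrN gtr0_norm// => /(_ _ _).
have dd : d / 2 < d by rewrite ltr_pdivrMr// ltr_pMr// ltr1n.
move=> /(_ dd); rewrite gt_eqF// => /(_ isT).
rewrite [d / 2 *: 1]mulr1 (addrC _ r) [_ *: _]mulrC.
have q : 0 <= (f (r + d / 2) - f r) / (d / 2) by apply: divr_ge0 (ltW h0); rewrite subr_ge0; exact: hf.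
by rewrite ltr_norml => /andP[]; lra.
Qed.

End first_zero.

(** * The gap between the weighted relative entropies along the curve *)

Section curve_gap.
Context {R : realType}.
Variables (beta gamma eps a : R) (U U' : state R) (y : R -> R).
Hypotheses (g1 : 1 < gamma) (eps2 : eps ^+ 2 = 1).
Hypotheses (aU : admissible U) (BU : st_B U != 0).
Implicit Types (r s : R) (V : state R).
Notation r0 := (base_r U).
Notation y0 := (base_y U).
Notation rb := (rb U).
Notation aly := (aly beta gamma U y).
Notation slope := (slope beta gamma U y).
Notation cspd := (cspd beta gamma eps U y).
Notation mag := (mag U y).
Notation dmag := (dmag beta gamma U y).
Notation Phi := (Phi beta gamma eps U y).
Notation gU := (gU beta gamma eps U y).
Notation ge := (ge beta gamma eps U y).

Hypothesis y_left : forall r, r <= r0 -> y r = y0.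
Hypothesis y_cont : continuous y.
Hypothesis y_ge : forall r, y0 <= y r.
Hypothesis y_der : forall r, r0 < r -> is_derive r 1 y (slope r).

Let r00 : 0 < r0. Proof. exact: base_r_gt0. Qed.
Let y00 : 0 < y0. Proof. exact: base_y_gt0. Qed.
Let rp r : 0 < rb r. Proof. exact: rb_gt0. Qed.
Let rn r : rb r != 0. Proof. exact: rb_neq0. Qed.
Let yp r : 0 < y r. Proof. exact: lt_le_trans (y_ge r). Qed.
Let ypw r : 0 <= y r. Proof. exact: ltW. Qed.
Let crb : continuous rb. Proof. by apply: ct_max => x; exact: cvg_id. Qed.
Let al0 r : 0 < aly r. Proof. exact: aly_gt0. Qed.
Let sp r : 0 < Num.sqrt (aly r). Proof. by rewrite sqrtr_gt0. Qed.
Let s2 r : Num.sqrt (aly r) ^+ 2 = aly r. Proof. by rewrite sqr_sqrtr// ltW. Qed.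

Lemma slope_ge r : 2 * y r / rb r <= slope r.
Proof.
have h := fast_ge_csq beta gamma (rp r) (ypw r); rewrite -/(aly r) in h.
rewrite /slope ler_pdivlMr ?exprn_gt0// (_ : _ * rb r ^+ 2 = 2 * y r * rb r).
  by move: h; lra.
by field; exact: rn.
Qed.

Lemma slope_ge0 r : 0 <= slope r.
Proof. by apply: le_trans (slope_ge r); rewrite divr_ge0 ?mulr_ge0// ltW. Qed.

Lemma le_y r s : r0 <= r -> r <= s -> y r <= y s.
Proof.
move=> h rs.
have := @is_derive_le R (fun=> 0) y (fun=> 0) slope r s rs (@ct_cst R R 0) y_cont
  (fun z _ => isd_cst z 0) (fun z hz => y_der (le_lt_trans h (andP hz).1)).
by rewrite subrr subr_ge0; apply => z _; exact: slope_ge0.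
Qed.

Lemma le_aly r s : r0 <= r -> r <= s -> aly r <= aly s.
Proof.
move=> h rs; apply: le_fast => //; last exact: le_y.
by rewrite !rbE// (le_trans h).
Qed.

Lemma le_sqrt_aly r s : r0 <= r -> r <= s -> Num.sqrt (aly r) <= Num.sqrt (aly s).
Proof. by move=> h rs; rewrite ler_wsqrtr// le_aly. Qed.

(** By [slope_ge], [y / r^2] is nondecreasing, so |B| grows at least linearly in [r]; this drives
    the divergence of the gap. *)
Lemma y_growth r : r0 <= r -> y0 * r ^+ 2 <= y r * r0 ^+ 2.
Proof.
move=> h.
have cG : continuous (fun z => y z * (rb z ^+ 2)^-1).
  by apply: ct_mul => //; apply: ct_inv; [move=> z; rewrite expf_neq0|exact: ct_sqr].
pose g z : R := (slope z - 2 * y z / rb z) / rb z ^+ 2.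
have dG z : r0 < z < r -> is_derive z 1 (fun z => y z * (rb z ^+ 2)^-1) (g z).
  move=> /andP[hz _].
  have r2 : rb z ^+ 2 != 0 by rewrite expf_neq0.
  have := isd_mul (y_der hz) (@isd_inv R (fun z => rb z ^+ 2) z _ r2 (isd_sqr (rb_der hz))).
  move/is_derive_eq; apply; rewrite /g; field; exact: rn.
have := @is_derive_le R (fun=> 0) (fun z => y z * (rb z ^+ 2)^-1) (fun=> 0) g r0 r h
  (@ct_cst R R 0) cG (fun z _ => isd_cst z 0) dG.
rewrite subrr subr_ge0 !rbE// y_left//.
rewrite ler_pdivrMr ?exprn_gt0// mulrAC ler_pdivlMr ?exprn_gt0 ?(lt_le_trans r00)//.
apply => z _; rewrite /g divr_ge0 ?sqr_ge0// subr_ge0; exact: slope_ge.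
Qed.

Lemma mag_growth r : r0 <= r -> `|st_B U| / r0 * r <= `|mag r|.
Proof.
move=> h; have rr := lt_le_trans r00 h.
have n0 : 0 <= `|st_B U| / r0 * r by apply: mulr_ge0 (ltW rr); apply: divr_ge0 (ltW r00).
rewrite -(@ler_pXn2r _ 2) ?nnegrE ?n0 ?normr_ge0//.
rewrite !exprMn -!normrX [X in _ <= X]ger0_norm ?sqr_ge0// mag_sqr//.
rewrite [X in X * _ * _]ger0_norm ?sqr_ge0//.
have := y_growth h; rewrite {1}/base_y => k.
rewrite exprVn mulrAC ler_pdivrMr ?exprn_gt0//; move: k; lra.
Qed.

Lemma aly_ge r : r0 <= r -> mag r ^+ 2 * r <= aly r.
Proof.
move=> h; have := fast_ge_csq beta gamma (rp r) (ypw r); rewrite -/(aly r) mag_sqr// rbE//.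
by have := csq_gt0 g1 (lt_le_trans r00 h); lra.
Qed.

Lemma slope_le r : slope r <= aly r / rb r ^+ 2.
Proof.
by rewrite /slope ler_pM2r ?invr_gt0 ?exprn_gt0// gerBl ltW// csq_gt0.
Qed.

Lemma norm_dmag r : `|dmag r| <= aly r / (rb r ^+ 2 * `|mag r|).
Proof.
have m0 : 0 < `|mag r| by rewrite normr_gt0 mag_neq0.
rewrite /dmag normrM normfV ger0_norm ?slope_ge0// ler_pdivrMr//.
rewrite (_ : _ * `|mag r| = aly r / rb r ^+ 2); first exact: slope_le.
by field; rewrite rn gt_eqF.
Qed.

(** The discriminant is positive by [trc_le_sqrt], so both square roots are taken at positive
    arguments. The sign of the derivative is read off later from monotonicity. *)
Lemma sqrt_aly_derivable r : r0 < r -> exists l, is_derive r 1 (fun r => Num.sqrt (aly r)) l.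
Proof.
move=> h; have dr := rb_der h; have dy := y_der h.
have db := isd_cst r (beta ^+ 2); have d4 := isd_cst r 4.
have dc := isd_mul (isd_cst r gamma) (isd_powR (gamma + 1) (rp r) dr).
have dt := isd_add (isd_mul (isd_add (isd_mul (isd_cst r 2) dy) db) dr) dc.
have dd := isd_add (isd_sqr dt) (isd_opp (isd_mul d4 (isd_mul (isd_mul db dr) dc))).
have d0 : 0 < dsc beta gamma (rb r) (y r).
  rewrite -sqrtr_gt0.
  have t := trc_le_sqrt beta g1 (rp r) y00 (y_ge r).
  have t0 : 0 < trc beta gamma (rb r) (y r).
    apply: addr_gt0; last exact: csq_gt0.
    by rewrite mulr_gt0// ltr_wpDr ?sqr_ge0// mulr_gt0.
  rewrite lt_neqAle sqrtr_ge0 andbT; apply: contraTneq t => <-.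
  by rewrite mulr0 -ltNge.
have df := isd_mul (isd_add dt (@isd_sqrt R (fun r => dsc beta gamma (rb r) (y r)) r _ d0 dd)) (isd_cst r 2^-1).
eexists; exact: (@isd_sqrt R aly r _ (al0 r) df).
Qed.

Let cPhi := oval_cont g1 eps2 aU BU y_cont y_ge (beta := beta).
Let dPhi := oval_der g1 eps2 aU BU y_cont y_ge y_der.

Lemma Phi_admissible r : admissible (Phi r).
Proof. by rewrite /admissible mkstateE invr_gt0. Qed.

Definition dent V r : R := ge r - \sum_i grad_eta gamma V i * gU i r.

Lemma rel_entropy_cont V : admissible V -> continuous (fun r => rel_entropy gamma (Phi r) V).
Proof.
move=> aV; under eq_fun do rewrite rel_entropyE// sum4.
have ct i : continuous (fun r => grad_eta gamma V i * (Phi r ord0 i - V ord0 i)).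
  apply: ct_mul; first exact: ct_cst.
  by apply: ct_add; [exact: (@cPhi (OU i))|exact: ct_cst].
apply: ct_add; first by apply: ct_add; [exact: (@cPhi Oe)|exact: ct_cst].
by apply: ct_opp; do 3! (apply: ct_add; last exact: ct).
Qed.

Lemma rel_entropy_der V r : admissible V -> r0 < r ->
  is_derive r 1 (fun r => rel_entropy gamma (Phi r) V) (dent V r).
Proof.
move=> aV h; under eq_fun do rewrite rel_entropyE// sum4.
have dt i := isd_mul (isd_cst r (grad_eta gamma V i))
  (isd_add (@dPhi (OU i) r h) (isd_cst r (- V ord0 i))).
have := isd_add (isd_add (@dPhi Oe r h) (isd_cst r (- eta gamma V)))
  (isd_opp (isd_add (isd_add (isd_add (dt (inord 0)) (dt (inord 1))) (dt (inord 2))) (dt (inord 3)))).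
by move/is_derive_eq; apply; rewrite /dent sum4 /=; ring.
Qed.

Lemma flux_gap_cont A V : continuous (fun r => flux_gap beta gamma A (Phi r) V).
Proof.
rewrite /flux_gap; under eq_fun do rewrite sum4.
have ct i : continuous (fun r => grad_eta gamma V i *
    (flux beta gamma (Phi r) ord0 i - flux beta gamma A ord0 i)).
  apply: ct_mul; first exact: ct_cst.
  by apply: ct_add; [exact: (@cPhi (OF i))|exact: ct_cst].
apply: ct_add; first by apply: ct_add; [exact: (@cPhi Oq)|exact: ct_cst].
by apply: ct_opp; do 3! (apply: ct_add; last exact: ct).
Qed.

Lemma flux_gap_der A V r : r0 < r ->
  is_derive r 1 (fun r => flux_gap beta gamma A (Phi r) V) (cspd r * dent V r).
Proof.
move=> h; rewrite /flux_gap; under eq_fun do rewrite sum4.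
have dt i := isd_mul (isd_cst r (grad_eta gamma V i))
  (isd_add (@dPhi (OF i) r h) (isd_cst r (- flux beta gamma A ord0 i))).
have := isd_add (isd_add (@dPhi Oq r h) (isd_cst r (- Qflux beta gamma A)))
  (isd_opp (isd_add (isd_add (isd_add (dt (inord 0)) (dt (inord 1))) (dt (inord 2))) (dt (inord 3)))).
by move/is_derive_eq; apply; rewrite /dent sum4 /=; ring.
Qed.

Hypotheses (aU' : admissible U') (a0 : 0 < a) (a1 : a <= 1).
Hypothesis compress : eps * (st_u U - st_u U') < 0.

Let d (i : 'I_4) : R := grad_eta gamma U i - grad_eta gamma U' i.
Let delta : R := - (eps * d (inord 2)).

Let dE : delta = - (eps * (st_u U - st_u U')).
Proof. by rewrite /delta /d /grad_eta !inordK. Qed.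

Let delta0 : 0 < delta. Proof. by rewrite dE oppr_gt0. Qed.

(** The derivative of the entropy cancels and leaves the linear form [d] on the tangent vector. Its
    u-term is [- delta * sqrt(alpha) / r^2]; the threshold on |B| bounds the v- and q-terms
    together, and the w-term, by a quarter of its size each. Then [alpha >= B^2 * r] and the linear
    growth of |B| leave a rate of order [r^(-1/2)], whose integral diverges. *)
Lemma dent_diff_le r : r0 <= r -> 1 <= r ->
  4 * (`|d (inord 0)| + `|d (inord 1)| * beta ^+ 2 + `|d (inord 3)| * `|beta|) / delta + 1
    <= `|mag r| ->
  dent U' r - dent U r <= - (delta * (`|st_B U| / r0)) * (1 / (2 * Num.sqrt r)).
Proof.
move=> h r1; set D0 := `|d (inord 0)|; set D1 := `|d (inord 1)|; set D3 := `|d (inord 3)|.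
have D00 : 0 <= D0 by exact: normr_ge0.
have D10 : 0 <= D1 by exact: normr_ge0.
have D30 : 0 <= D3 by exact: normr_ge0.
set m := `|mag r| => hX.
have rr : 0 < r := lt_le_trans ltr01 r1.
have b20 := sqr_ge0 beta; have nb := normr_ge0 beta.
have X0 : 0 <= D0 + D1 * beta ^+ 2 + D3 * `|beta|.
  by rewrite !addr_ge0 ?(mulr_ge0 D10 b20) ?(mulr_ge0 D30 nb).
have m1 : 1 <= m by apply: le_trans hX; rewrite lerDr divr_ge0 ?(ltW delta0)// mulr_ge0.
have m0 : 0 < m := lt_le_trans ltr01 m1.
have hX' : 4 * (D0 + D1 * beta ^+ 2 + D3 * `|beta|) <= delta * m.
  by rewrite (mulrC delta) -ler_pdivrMr//; move: hX; lra.
set s := Num.sqrt (aly r).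
have sr : 1 <= Num.sqrt r by rewrite -(sqrtr1 R) ler_wsqrtr.
have sm : m * Num.sqrt r <= s.
  rewrite /m -sqrtr_sqr -sqrtrM ?sqr_ge0// ler_wsqrtr// aly_ge//.
have s0 : 0 < s := sp r.
have ms : m <= s by apply: le_trans sm; rewrite ler_peMr// ltW.
have al2 : aly r = s ^+ 2 by rewrite s2.
have nd := norm_dmag r; rewrite rbE// -/m al2 in nd.
have gen (x c z ss : R) : 0 <= c -> 0 < ss -> `|z| <= ss / (r ^+ 2 * m) ->
    x * (c * z / ss) <= `|x| * c / r ^+ 2.
  move=> c0 ss0 hz; apply: le_trans (ler_norm _) _.
  rewrite !normrM normfV (ger0_norm c0) (gtr0_norm ss0) -!mulrA ler_wpM2l// ler_wpM2l//.
  rewrite ler_pdivrMr//; apply: le_trans hz _.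
  by rewrite mulrC ler_pM2r// invfM ler_piMr ?invf_le1// invr_ge0 sqr_ge0.
have t1 : d (inord 1) * gU (inord 1) r <= D1 * beta ^+ 2 / r ^+ 2.
  have -> : gU (inord 1) r = beta ^+ 2 * dmag r / s ^+ 2.
    rewrite /gU inordK//= (dmag_eq2 _ _ aU BU y_ge) al2 [RHS]mulrC mulKf//.
    by rewrite expf_neq0// gt_eqF.
  by apply: gen => //; rewrite exprn_gt0.
have t3 : d (inord 3) * gU (inord 3) r <= D3 * `|beta| * (s / m) / r ^+ 2.
  have -> : gU (inord 3) r = - beta * dmag r / (eps * s) by rewrite /gU inordK.
  have ne : `|eps| = 1.
    by apply/eqP; rewrite -(@eqrXn2 _ 2)// ?normr_ge0// -normrX eps2 expr1n normr1.
  move: nd; move: (dmag r) => z nd.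
  apply: le_trans (ler_norm _) _; rewrite !normrM -/D3 normfV normrM normrN ne mul1r (gtr0_norm s0).
  rewrite -!mulrA ler_wpM2l// ler_wpM2l// ler_pdivrMr//; apply: le_trans nd _.
  rewrite le_eqVlt; apply/orP; left; apply/eqP; field; rewrite !gt_eqF//.
have t0 : d (inord 0) * gU (inord 0) r <= D0 / r ^+ 2.
  rewrite /gU inordK//= rbE// mulrN -mulNr ler_pM2r ?invr_gt0 ?exprn_gt0//.
  by rewrite /D0 -normrN ler_norm.
have t2 : d (inord 2) * gU (inord 2) r = - delta * s / r ^+ 2.
  by rewrite /gU inordK//= /du /cspd rbE// /delta -/s; field; rewrite gt_eqF.
have -> : dent U' r - dent U r = d (inord 0) * gU (inord 0) r + d (inord 1) * gU (inord 1) r +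
    d (inord 2) * gU (inord 2) r + d (inord 3) * gU (inord 3) r.
  by rewrite /dent /d !sum4; ring.
have B0 : 0 < `|st_B U| / r0 by rewrite divr_gt0// normr_gt0.
set b := `|st_B U| / r0 in B0 *.
have mb : b * r <= m by exact: mag_growth.
apply: (@le_trans _ _ (- delta * s / 2 / r ^+ 2)).
  have u1 : D3 * `|beta| * (s / m) <= delta * s / 4.
    rewrite mulrA ler_pdivrMr//.
    have v1 : 4 * (D3 * `|beta|) <= delta * m.
      by move: hX' D00 (mulr_ge0 D10 b20); lra.
    have := ler_wpM2r (ltW s0) v1; lra.
  have u2 : D0 + D1 * beta ^+ 2 <= delta * s / 4.
    have v1 : delta * m <= delta * s by rewrite ler_pM2l.
    by move: hX' (mulr_ge0 D30 nb) v1; lra.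
  have i0 : 0 < (r ^+ 2)^-1 by rewrite invr_gt0 exprn_gt0.
  have := ler_wpM2r (ltW i0) u1; have := ler_wpM2r (ltW i0) u2.
  rewrite t2; move: t0 t1 t3; set i := _^-1; lra.
set q := Num.sqrt r in sr sm *.
have q0 : 0 < q := lt_le_trans ltr01 sr.
have q2 : q ^+ 2 = r by rewrite /q sqr_sqrtr// ltW.
have sb : b * r * q <= s by apply: le_trans sm; rewrite ler_pM2r.
rewrite (_ : - (delta * b) * (1 / (2 * q)) = - delta * (b * r * q) / 2 / r ^+ 2).
  rewrite !ler_pM2r ?invr_gt0 ?exprn_gt0//.
  by rewrite ler_nM2l ?oppr_lt0.
by rewrite -q2; field; rewrite gt_eqF.
Qed.

Definition gap r : R := a * rel_entropy gamma (Phi r) U' - rel_entropy gamma (Phi r) U.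

(** Since [a <= 1] and relative entropies are nonnegative, the gap is at most its value [A] at
    weight 1, and [dent_diff_le] makes [A] fall like a negative multiple of the square root of
    [r]. *)
Lemma gap_lt0 : exists2 r, r0 < r & gap r < 0.
Proof.
have aux (x z n : R) : x - z <= - (n + 1) -> z <= n -> x < 0 by lra.
set X := 4 * (`|d (inord 0)| + `|d (inord 1)| * beta ^+ 2 + `|d (inord 3)| * `|beta|) / delta + 1.
have X0 : 0 <= X.
  have n1 := mulr_ge0 (normr_ge0 (d (inord 1))) (sqr_ge0 beta).
  have n3 := mulr_ge0 (normr_ge0 (d (inord 3))) (normr_ge0 beta).
  apply: addr_ge0 => //; apply: divr_ge0 (ltW delta0); apply: mulr_ge0 => //.
  by apply: addr_ge0 n3; apply: addr_ge0 n1; exact: normr_ge0.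
have B0 : 0 < `|st_B U| by rewrite normr_gt0.
have b0 : 0 < `|st_B U| / r0 by rewrite divr_gt0.
set k := delta * (`|st_B U| / r0).
have k0 : 0 < k by rewrite mulr_gt0.
(* Beyond [rh] all conditions of [dent_diff_le] hold: the last summand brings |B| above [X] through
   [mag_growth]. *)
pose rh := 1 + r0 + X * r0 / `|st_B U|.
have Xr : 0 <= X * r0 / `|st_B U| by rewrite divr_ge0 ?mulr_ge0// ltW.
have rh1 : 1 <= rh by rewrite /rh; move: Xr r00; lra.
have rh0 : r0 < rh by rewrite /rh; move: Xr r00; lra.
have hX r : rh <= r -> X <= `|mag r|.
  move=> h; apply: le_trans (mag_growth _); last exact: le_trans (ltW rh0) h.
  rewrite mulrAC ler_pdivlMr// (mulrC `|st_B U|) -ler_pdivrMr//; apply: le_trans h.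
  by rewrite /rh; move: Xr r00; lra.
pose A r := rel_entropy gamma (Phi r) U' - rel_entropy gamma (Phi r) U.
have cA : continuous A.
  by apply: ct_add; [exact: rel_entropy_cont|apply: ct_opp; exact: rel_entropy_cont].
have dA r : r0 < r -> is_derive r 1 A (dent U' r - dent U r).
  by move=> h; exact: isd_add (rel_entropy_der aU' h) (isd_opp (rel_entropy_der aU h)).
(* Chosen so that the descent [k * (q - sqrt rh)] from [rh] to [q^2] equals [|A rh| + 1], which
   makes [A] negative at [q^2]. *)
pose q := Num.sqrt rh + (`|A rh| + 1) / k.
have q0 : 0 <= q by rewrite addr_ge0 ?sqrtr_ge0// divr_ge0 ?(ltW k0)// addr_ge0.
have rq : rh <= q ^+ 2.
  rewrite -[X in X <= _](@sqr_sqrtr _ rh) ?(le_trans ler01)//.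
  by rewrite ler_pXn2r ?nnegrE ?sqrtr_ge0// /q lerDl divr_ge0 ?(ltW k0)// addr_ge0.
exists (q ^+ 2); first exact: lt_le_trans rq.
have cG : continuous (fun r : R => - k * Num.sqrt r).
  by apply: ct_mul; [exact: ct_cst|apply: ct_sqrt => z; exact: cvg_id].
have dG r : rh < r < q ^+ 2 ->
    is_derive r 1 (fun r : R => - k * Num.sqrt r) (- k * (1 / (2 * Num.sqrt r))).
  move=> /andP[h _]; have rr : 0 < r by apply: lt_trans h; exact: lt_le_trans rh1.
  have := isd_mul (isd_cst r (- k)) (isd_sqrt rr (isd_id r)).
  by move/is_derive_eq; apply; rewrite mulr0 addr0.
have := @is_derive_le R A _ _ _ rh (q ^+ 2) rq cA cG
  (fun s hs => dA s (lt_trans rh0 (andP hs).1)) dG.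
have step z : rh < z < q ^+ 2 -> dent U' z - dent U z <= - k * (1 / (2 * Num.sqrt z)).
  move=> /andP[/ltW h _]; apply: dent_diff_le; last exact: hX.
    exact: le_trans (ltW rh0) h.
  exact: le_trans rh1 h.
move=> /(_ step); rewrite sqrtr_sqr (ger0_norm q0).
rewrite (_ : - k * q - - k * Num.sqrt rh = - (`|A rh| + 1)); last by rewrite /q; field; rewrite gt_eqF.
have gA r : gap r <= A r.
  rewrite /gap /A lerD2r ler_piMl// rel_entropy_ge0//; exact: Phi_admissible.
move=> hB; apply: le_lt_trans (gA _) _; exact: aux hB (ler_norm _).
Qed.

Lemma gap_cont : continuous gap.
Proof.
apply: ct_add; last by apply: ct_opp; exact: rel_entropy_cont.
by apply: ct_mul; [exact: ct_cst|exact: rel_entropy_cont].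
Qed.

Let Pb : Phi r0 = U. Proof. exact: Phi_base. Qed.

Let relUU : rel_entropy gamma U U = 0.
Proof.
rewrite rel_entropyE// subrr sub0r big1 ?oppr0// => i _.
by rewrite subrr mulr0.
Qed.

Let gapUU V : flux_gap beta gamma U U V = 0.
Proof.
by rewrite /flux_gap subrr sub0r big1 ?oppr0// => i _; rewrite subrr mulr0.
Qed.

(* The entropy flux and the entropy gaps satisfy F' = lambda G', and
   |lambda| increases along the curve, so F stays below the value it would
   have with a constant speed. *)
Lemma curve_plateau : exists r1, [/\ r0 < r1, gap r1 = 0 &
  eps * (a * flux_gap beta gamma U (Phi r1) U' - flux_gap beta gamma U (Phi r1) U)
    <= - (Num.sqrt (aly r0) * (a * rel_entropy gamma U U'))].
Proof.
have [re re0 gre] := gap_lt0.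
have g0E : gap r0 = a * rel_entropy gamma U U' by rewrite /gap Pb relUU subr0.
have g00 : 0 < gap r0.
  rewrite g0E mulr_gt0// rel_entropy_gt0//.
  by apply: contraTneq compress => ->; rewrite subrr mulr0 ltxx.
have [r1 [h1 gr1 pos]] := first_zero gap_cont re0 g00 gre.
exists r1; split => //.
pose F r := a * flux_gap beta gamma U (Phi r) U' - flux_gap beta gamma U (Phi r) U.
pose s r := Num.sqrt (aly r); pose ds (r : R) : R := 'D_1 s r.
have ds_der r : r0 < r -> is_derive r 1 s (ds r).
  move=> h; have [l dl] := sqrt_aly_derivable h.
  by rewrite /ds (@derive_val _ _ _ _ _ _ _ dl).
have ds0 r : r0 < r -> 0 <= ds r.
  move=> h; apply: (is_derive_ge0 (ds_der r h)) => z z0.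
  by apply: le_sqrt_aly; rewrite ?(ltW h)// lerDl ltW.
have cs : continuous s by apply: ct_sqrt; exact: aly_cont.
have cF : continuous F.
  apply: ct_add; last by apply: ct_opp; exact: flux_gap_cont.
  by apply: ct_mul; [exact: ct_cst|exact: flux_gap_cont].
(* Since [eps^2 = 1], this function has derivative [- ds * gap], nonpositive up to [r1]. At [r1] the
   gap vanishes and at [r0] so does [F]. *)
have cK : continuous (fun r => eps * F r - s r * gap r).
  apply: ct_add; first by apply: ct_mul => //; exact: ct_cst.
  by apply: ct_opp; apply: ct_mul => //; exact: gap_cont.
have dK r : r0 < r < r1 -> is_derive r 1 (fun r => eps * F r - s r * gap r) (- (ds r * gap r)).
  move=> /andP[h _].
  have dF V := flux_gap_der U V h.
  have dF' := isd_add (isd_mul (isd_cst r a) (dF U')) (isd_opp (dF U)).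
  have dg := isd_add (isd_mul (isd_cst r a) (rel_entropy_der aU' h)) (isd_opp (rel_entropy_der aU h)).
  have := isd_add (isd_mul (isd_cst r eps) dF') (isd_opp (isd_mul (ds_der r h) dg)).
  move/is_derive_eq; apply; rewrite /gap /s /cspd; set q := Num.sqrt _.
  transitivity ((eps ^+ 2 - 1) * q * (a * dent U' r - dent U r) - ds r * gap r).
    by rewrite /gap; ring.
  by rewrite eps2 subrr !mul0r sub0r.
have := @is_derive_le R _ (fun=> 0) _ (fun=> 0) r0 r1 (ltW h1) cK (@ct_cst R R 0) dK
  (fun z _ => isd_cst z 0).
have step z : r0 < z < r1 -> - (ds z * gap z) <= 0.
  move=> /andP[z0 z1]; rewrite oppr_le0; apply: mulr_ge0; first exact: ds0 z0.
  by apply: pos; rewrite (ltW z0) (ltW z1).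
have Fr0 : F r0 = 0 by rewrite /F Pb !gapUU mulr0 subrr.
move=> /(_ step); rewrite gr1 Fr0 g0E mulr0 subr0 mulr0 sub0r opprK [X in _ <= X]subrr.
by rewrite -lerBrDr sub0r.
Qed.

End curve_gap.

(** * Characteristic speeds in the variables of the curve *)

Section speeds.
Context {R : realType}.
Variables (beta gamma : R).
Hypothesis g1 : 1 < gamma.
Implicit Types (U : state R).

Lemma sound_sqr (v : R) : 0 < v -> sound gamma v ^+ 2 = csq gamma v^-1.
Proof.
move=> v0; have d := is_derive1_powR (- gamma) v0.
have E : (derive1 (pressure gamma)) v = - gamma * v `^ (- gamma - 1).
  by rewrite derive1E; exact: (@derive_val _ _ _ _ _ _ _ d).
have E2 : - (derive1 (pressure gamma)) v = csq gamma v^-1.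
  by rewrite E mulNr opprK /csq powRV// opprD.
by rewrite /sound E2 sqr_sqrtr// ltW// csq_gt0// invr_gt0.
Qed.

Lemma alpha_trueE U : admissible U ->
  alpha beta gamma true U = fast beta gamma (base_r U) (base_y U).
Proof.
move=> aU; rewrite /alpha /fast /dsc /trc sound_sqr// -/(base_r U).
set c := csq _ _; set b := base_r U.
have -> : (2 * base_y U + beta ^+ 2) * b + c = (st_B U ^+ 2 + beta ^+ 2) * b + c.
  by rewrite /base_y; field.
by congr ((_ + Num.sqrt (_ - _)) / _); ring.
Qed.

(** The characteristic quadratic takes the value [- beta^2 * B^2 / v^2 <= 0] at [beta^2 / v], which
    therefore lies between the two roots. For slow shocks this yields [v * sigma^2 < beta^2]. *)
Lemma alpha_false_le U : admissible U ->
  alpha beta gamma false U <= beta ^+ 2 * base_r U.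
Proof.
move=> aU; rewrite /alpha sound_sqr// -/(base_r U).
set c := csq _ _; set b := base_r U.
have b0 : 0 < b by exact: base_r_gt0.
set S := _ + c; set D := S ^+ 2 - _.
have : S - 2 * (beta ^+ 2 * b) <= Num.sqrt D.
  apply: le_trans (ler_norm _) _; rewrite -sqrtr_sqr ler_wsqrtr//.
  rewrite -subr_ge0 /D (_ : _ - _ = 4 * (beta ^+ 2 * b) * (st_B U ^+ 2 * b)).
    have p1 := mulr_ge0 (sqr_ge0 beta) (ltW b0).
    have p2 := mulr_ge0 (sqr_ge0 (st_B U)) (ltW b0).
    by apply: mulr_ge0 p2; apply: mulr_ge0.
  by rewrite /S; ring.
by set q := Num.sqrt D; lra.
Qed.

End speeds.

(** * Bounded convex sets of states *)

Section boxes.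
Context {R : realType}.
Implicit Types (U : state R) (m M : R).

Definition box m M : set (state R) := [set U | m <= st_v U /\ forall i, `|U ord0 i| <= M].

Lemma box_admissible m M : 0 < m -> box m M `<=` [set U | admissible U].
Proof. by move=> m0 U [h _]; exact: lt_le_trans h. Qed.

Lemma box_bounded m M : bounded_set (box m M).
Proof.
exists `|M|; split; first exact: num_real.
move=> z hz U [_ hU]; rewrite /Num.norm/= mx_normrE; apply/bigmax_leP; split.
  by apply: le_trans (ltW hz); exact: normr_ge0.
move=> [i j] _ /=; rewrite (ord1 i); apply: le_trans (hU j) _.
by apply: le_trans (ltW hz); exact: ler_norm.
Qed.

Lemma box_convex m M : convex_states (box m M).
Proof.
move=> U V l [hU hU'] [hV hV'] /andP[l0 l1]; have l1' : 0 <= 1 - l by rewrite subr_ge0.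
split.
  rewrite /st_v !mxE -/(st_v U) -/(st_v V).
  by have := ler_wpM2l l0 hU; have := ler_wpM2l l1' hV; lra.
move=> i; rewrite !mxE; apply: le_trans (ler_normD _ _) _.
rewrite !normrM (ger0_norm l0) (ger0_norm l1').
by have := ler_wpM2l l0 (hU' i); have := ler_wpM2l l1' (hV' i); lra.
Qed.

Lemma le_box m M m' M' : m' <= m -> M <= M' -> box m M `<=` box m' M'.
Proof.
move=> h h' U [hU hU']; split; first exact: le_trans hU.
by move=> i; exact: le_trans (hU' i) h'.
Qed.

Lemma box_of U : admissible U -> exists m M, 0 < m /\ box m M U.
Proof.
move=> aU; exists (st_v U), (\sum_i `|U ord0 i|); split => //; split => // i.
by rewrite (bigD1 i)//= lerDl sumr_ge0.
Qed.

Lemma continuous_bounded (f : R -> R) (p q : R) : p <= q -> continuous f ->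
  exists M, forall r, p <= r <= q -> `|f r| <= M.
Proof.
move=> pq cf.
have cn : continuous (fun r => `|f r|).
  by move=> x; apply: continuous_comp; [exact: cf|exact: norm_continuous].
have [c _ hc] := EVT_max pq (@continuousW R p q _ cn).
by exists `|f c| => r hr; apply: hc; rewrite in_itv.
Qed.

End boxes.

(** * The plateau state and its two fans *)

Section plateau.
Context {R : realType}.
Variables (beta gamma : R).
Hypothesis g1 : 1 < gamma.
Implicit Types (U V : state R) (K : set (state R)) (m M Lam eps a : R).

(** The fans are granted for every larger [K] and [Lam'], because the set must later also contain
    the end states of the shock and the width must also dominate [|sigma|]. *)
Lemma plateau_exists eps a U U' : eps ^+ 2 = 1 -> admissible U -> st_B U != 0 ->
  admissible U' -> 0 < a -> a <= 1 -> eps * (st_u U - st_u U') < 0 ->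
  exists V m M Lam, [/\ 0 < m /\ 0 <= Lam,
    a * rel_entropy gamma V U' = rel_entropy gamma V U,
    eps * (a * flux_gap beta gamma U V U' - flux_gap beta gamma U V U)
      <= - (Num.sqrt (alpha beta gamma true U) * (a * rel_entropy gamma U U')) &
    forall K Lam', box m M `<=` K -> Lam <= Lam' ->
      translatable_wave beta gamma U V K (flux_gap beta gamma U V) Lam' /\
      translatable_wave beta gamma V U K (flux_gap beta gamma V U) Lam'].
Proof.
move=> eps2 aU BU aU' a0 a1 comp.
have [y [yl yc yge yd]] := fast_curve_exists beta g1 aU BU.
have [r1 [h1 gr1 rate]] := curve_plateau g1 eps2 aU BU yl yc yge yd aU' a0 a1 comp.
pose P := Phi beta gamma eps U y; pose lam := cspd beta gamma eps U y.
set r0 := base_r U in h1 rate *.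
have r00 : 0 < r0 by exact: base_r_gt0.
have PU : P r0 = U by exact: Phi_base.
have cP := oval_cont g1 eps2 aU BU yc yge (beta := beta).
have cg := @gr_cont R beta gamma eps U y g1 eps2 aU BU yc yge.
have clam := @cspd_cont R beta gamma eps U y aU yc.
have dP := oval_der g1 eps2 aU BU yc yge yd.
have bnd i : exists M, forall r, r0 <= r <= r1 -> `|P r ord0 i| <= M.
  exact: continuous_bounded (ltW h1) (cP (OU i)).
have [Mi hM] := boolp.choice bnd.
have PK r : r0 <= r <= r1 -> box r1^-1 (\sum_i `|Mi i|) (P r).
  move=> /andP[ha hb]; split.
    by rewrite mkstateE rbE// lef_pV2// posrE ?(lt_le_trans r00 ha) ?(lt_trans r00 h1).
  move=> i; apply: le_trans (hM i r _) _; first by rewrite ha.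
  rewrite (bigD1 i)//=; apply: le_trans (ler_norm _) _.
  by rewrite lerDl sumr_ge0.
have sm := @le_sqrt_aly R beta gamma U y g1 aU BU yc yge yd.
pose s r := Num.sqrt (aly beta gamma U y r).
have lamE r : lam r = eps * s r by [].
have ne : `|eps| = 1.
  by apply/eqP; rewrite -(@eqrXn2 _ 2)// ?normr_ge0// -normrX eps2 expr1n normr1.
have fan p q k K Lam' : r0 <= p <= r1 -> r0 <= q <= r1 -> p != q -> 0 <= k <= 1 ->
    (forall t, 0 <= t <= 1 -> 0 <= eps * (q - p) * (t - k)) ->
    box r1^-1 (\sum_i `|Mi i|) `<=` K -> s r1 <= Lam' ->
    translatable_wave beta gamma (P p) (P q) K (flux_gap beta gamma (P p) (P q)) Lam'.
  move=> /andP[pa pb] /andP[qa qb] pq k01 hk bK sL.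
  have rho th : 0 <= th <= 1 -> r0 <= p + (q - p) * th <= r1.
    move=> /andP[t0 t1]; have t1' : 0 <= 1 - th by rewrite subr_ge0.
    have := ler_wpM2r t0 qa; have := ler_wpM2r t0 qb.
    have := ler_wpM2r t1' pa; have := ler_wpM2r t1' pb => i1 i2 i3 i4.
    by apply/andP; split; lra.
  apply: (fan_translatable cP cg clam dP pa qa pq k01) => [th th' t t01 t0 tt t1|th h|th h].
  - have h : 0 <= th <= 1 by rewrite t0 (le_trans tt).
    have h' : 0 <= th' <= 1 by rewrite t1 (le_trans t0).
    have /andP[x0 x1] := rho th h; have /andP[z0 z1] := rho th' h'.
    set x := p + _ in x0 x1 *; set z := p + _ in z0 z1 *.
    have hk' := hk t t01; rewrite -/lam !lamE -subr_ge0.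
    rewrite (_ : _ - _ = eps * (t - k) * (s z - s x)); last by ring.
    have [lt|gt|e] := ltgtP p q; last by rewrite e eqxx in pq.
      apply: mulr_ge0; last by rewrite subr_ge0 sm// /x /z lerD2l ler_wpM2l// subr_ge0 ltW.
      by rewrite -(@pmulr_lge0 _ (q - p)) ?subr_gt0// mulrAC.
    rewrite -mulrNN; apply: mulr_ge0.
      by rewrite -(@pmulr_lge0 _ (p - q)) ?subr_gt0// mulNr -mulrN opprB mulrAC.
    by rewrite opprB subr_ge0 sm// /x /z lerD2l ler_wnM2l// subr_le0 ltW.
  - exact/bK/PK/rho.
  - have /andP[x0 x1] := rho th h; rewrite -/lam lamE normrM ne mul1r ger0_norm ?sqrtr_ge0//.
    by apply: le_trans sL; exact: sm.
(* The speed increases along the curve for [eps = 1] and decreases for [eps = -1]. The outgoing fan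
   is accordingly a rarefaction ([k = 0]) or a compression ([k = 1]), and the returning fan is of
   the other kind. *)
have [k [k01 hk hk']] : exists k, [/\ 0 <= k <= 1, (forall t, 0 <= t <= 1 -> 0 <= eps * (t - k)) &
     forall t, 0 <= t <= 1 -> 0 <= - eps * (t - (1 - k))].
  have /orP[/eqP e1|/eqP e1] : (eps == 1) || (eps == -1) by rewrite -eqf_sqr expr1n eps2.
    exists 0; rewrite e1 lexx ler01; split => // t /andP[t0 t1]; lra.
  exists 1; rewrite e1 lexx ler01; split => // t /andP[t0 t1]; lra.
exists (P r1), r1^-1, (\sum_i `|Mi i|), (s r1); split.
- by split; [rewrite invr_gt0 (lt_trans r00)|exact: sqrtr_ge0].
- by apply/eqP; rewrite -subr_eq0; apply/eqP.
- by move: rate; rewrite alpha_trueE// /aly rbE// yl.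
- move=> K Lam' bK sL.
  have d0 : 0 < r1 - r0 by rewrite subr_gt0.
  have r1i : r0 <= r1 <= r1 by rewrite lexx (ltW h1).
  have r0i : r0 <= r0 <= r1 by rewrite lexx (ltW h1).
  rewrite -PU; split.
    apply: (fan r0 r1 k) => //; first by rewrite lt_eqF.
    by move=> t /hk h; rewrite mulrAC; apply: mulr_ge0 => //; exact: ltW.
  apply: (fan r1 r0 (1 - k)) => //; first by rewrite gt_eqF.
    by move: k01 => /andP[k0 k1]; rewrite subr_ge0 k1 lerBlDr lerDl.
  move=> t /hk' h; rewrite -opprB mulrN -mulNr mulrAC; apply: mulr_ge0 => //; exact: ltW.
Qed.


End plateau.

(** * Shocks of the slow families *)

Section non_contraction.
Context {R : realType}.
Variables (beta gamma : R).
Hypothesis g1 : 1 < gamma.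
Variables (Ul Ur : state R) (sigma a : R).
Hypotheses (aUl : admissible Ul) (aUr : admissible Ur).
Hypothesis RH : flux beta gamma Ur - flux beta gamma Ul = sigma *: (Ur - Ul).
Hypothesis ent : Qflux beta gamma Ur - Qflux beta gamma Ul <= sigma * (eta gamma Ur - eta gamma Ul).
Hypothesis u_lr : st_u Ur < st_u Ul.
Hypothesis a0 : 0 < a.

Let common_box (m M : R) : 0 < m -> exists m' M',
  [/\ 0 < m', box m M `<=` box m' M', box m' M' Ul & box m' M' Ur].
Proof.
move=> m0; have [m1 [M1 [m10 h1]]] := box_of aUl; have [m2 [M2 [m20 h2]]] := box_of aUr.
exists (Num.min m (Num.min m1 m2)), (Num.max M (Num.max M1 M2)); split.
- by rewrite !lt_min m0 m10.
- by apply: le_box; rewrite ?ge_min ?le_max lexx.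
- by apply: le_box h1; rewrite !(ge_min, le_max) lexx ?orbT.
- by apply: le_box h2; rewrite !(ge_min, le_max) lexx ?orbT.
Qed.

Let flux_gapC (A B V : state R) : flux_gap beta gamma A B V = - flux_gap beta gamma B A V.
Proof. by rewrite /flux_gap !sum4; ring. Qed.

Lemma not_a_contraction_left : st_B Ul != 0 -> a <= 1 ->
  - Num.sqrt (alpha beta gamma true Ul) < sigma -> ~ a_contraction beta gamma Ul Ur sigma a.
Proof.
move=> BUl a1 hs.
have comp : -1 * (st_u Ul - st_u Ur) < 0 by move: u_lr; lra.
have e2 : (-1 : R) ^+ 2 = 1 by rewrite sqrrN expr1n.
have [V [m [M [Lam [[m0 L0] GV rate tw]]]]] :=
  plateau_exists beta g1 e2 aUl BUl aUr a0 a1 comp.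
have [m' [M' [m'0 bb bl br]]] := common_box M m0.
have L0' : 0 <= Lam + `|sigma| by rewrite addr_ge0.
have LL : Lam <= Lam + `|sigma| by rewrite lerDl.
have sL : `|sigma| <= Lam + `|sigma| by rewrite lerDr.
have [T1 T2] := tw _ _ bb LL.
have T3 := shock_translatable RH ent bl br sL.
apply: (three_waves_plateau1 g1 aUl aUr (box_admissible m'0) (@box_bounded _ _ _)
  (@box_convex _ _ _) L0' T1 T2 T3); first by rewrite GV.
have uu : st_u Ul != st_u Ur by rewrite gt_eqF.
have ar0 : 0 < a * rel_entropy gamma Ul Ur by rewrite mulr_gt0// rel_entropy_gt0.
have E : eta gamma Ur - eta gamma Ul - \sum_i grad_eta gamma Ur i * (Ur ord0 i - Ul ord0 i) =
    - rel_entropy gamma Ul Ur by rewrite (rel_entropyE _ g1 aUr) !sum4; ring.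
rewrite E (flux_gapC V Ul).
(* By antisymmetry of [flux_gap] the two fans contribute the quantity bounded by [rate], and the
   shock adds [sigma * a * eta(Ul|Ur)]; this product is a lower bound for the energy rate. *)
have : 0 < (Num.sqrt (alpha beta gamma true Ul) + sigma) * (a * rel_entropy gamma Ul Ur).
  by rewrite mulr_gt0//; move: hs; lra.
by move: rate; lra.
Qed.

(** The curve now starts at [Ur], with [Ul] as the other state and weight [1 / a <= 1]. Multiplying
    by [a] turns the resulting gap relations into those of the energy with weight [a]. *)
Lemma not_a_contraction_right : st_B Ur != 0 -> 1 <= a ->
  sigma < Num.sqrt (alpha beta gamma true Ur) -> ~ a_contraction beta gamma Ul Ur sigma a.
Proof.
move=> BUr a1 hs.
have comp : 1 * (st_u Ur - st_u Ul) < 0 by move: u_lr; lra.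
have e2 : (1 : R) ^+ 2 = 1 by rewrite expr1n.
have aV0 : 0 < a^-1 by rewrite invr_gt0.
have aV1 : a^-1 <= 1 by rewrite invf_le1.
have [V [m [M [Lam [[m0 L0] GV rate tw]]]]] :=
  plateau_exists beta g1 e2 aUr BUr aUl aV0 aV1 comp.
have [m' [M' [m'0 bb bl br]]] := common_box M m0.
have L0' : 0 <= Lam + `|sigma| by rewrite addr_ge0.
have LL : Lam <= Lam + `|sigma| by rewrite lerDl.
have sL : `|sigma| <= Lam + `|sigma| by rewrite lerDr.
have [T2 T3] := tw _ _ bb LL.
have T1 := shock_translatable RH ent bl br sL.
apply: (three_waves_plateau2 g1 aUl aUr (box_admissible m'0) (@box_bounded _ _ _)
  (@box_convex _ _ _) L0' T1 T2 T3); first by rewrite -GV mulVKf// gt_eqF.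
have uu : st_u Ur != st_u Ul by rewrite lt_eqF.
have r0 : 0 < rel_entropy gamma Ur Ul by rewrite rel_entropy_gt0.
rewrite -(rel_entropyE _ g1 aUl) (flux_gapC V Ur).
have : 0 < (Num.sqrt (alpha beta gamma true Ur) - sigma) * rel_entropy gamma Ur Ul.
  by rewrite mulr_gt0//; move: hs; lra.
have := ler_wpM2l (ltW a0) rate.
rewrite mul1r mulrBr mulVKf ?gt_eqF// mulrN mulrCA mulVKf ?gt_eqF//.
by lra.
Qed.

End non_contraction.

Section lax_shocks.
Context {R : realType}.
Variables (beta gamma : R).
Hypothesis g1 : 1 < gamma.
Variables (Ul Ur : state R) (sigma : R).
Hypotheses (aUl : admissible Ul) (aUr : admissible Ur).
Hypothesis RH : flux beta gamma Ur - flux beta gamma Ul = sigma *: (Ur - Ul).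

Let jump i : flux beta gamma Ur ord0 i - flux beta gamma Ul ord0 i =
  sigma * (Ur ord0 i - Ul ord0 i).
Proof. by have /rowP/(_ i) := RH; rewrite !mxE. Qed.

Lemma jump_u : st_u Ul - st_u Ur = sigma * (st_v Ur - st_v Ul).
Proof. by have := jump (inord 0); rewrite /flux !mxE !inordK//= => <-; ring. Qed.

(** The second and fourth jump relations with the jump of [w] eliminated. *)
Lemma jump_B : sigma ^+ 2 * (st_v Ur * st_B Ur - st_v Ul * st_B Ul) =
  beta ^+ 2 * (st_B Ur - st_B Ul).
Proof.
have j1 := jump (inord 1); have j3 := jump (inord 3).
rewrite /flux !mxE !inordK//= -/(st_q Ur) -/(st_q Ul) in j1.
rewrite /flux !mxE !inordK//= -/(st_w Ur) -/(st_w Ul) in j3.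
have qE (U : state R) : admissible U -> st_v U * st_B U = st_q U.
  by move=> aU; rewrite /st_B mulrC divfK// gt_eqF.
rewrite !qE// expr2 -mulrA -j1.
rewrite (_ : - (beta * st_w Ur) - - (beta * st_w Ul) = - beta * (st_w Ur - st_w Ul)); last by ring.
by rewrite mulrCA -j3; ring.
Qed.

(** By [jump_u] it suffices to compare the volumes. Let [v] belong to the state with the smaller
    |B|, where [v * sigma^2 < beta^2]. Were the other volume at most [v], the left side of [jump_B],
    up to a common sign, would be at most [v * sigma^2] times the increase of |B|, hence strictly
    below the right side. *)
Lemma slow_shock_compressive :
  (0 < sigma /\ st_v Ul * sigma ^+ 2 < beta ^+ 2 /\ (0 < st_B Ul < st_B Ur \/ st_B Ur < st_B Ul < 0)) \/
  (sigma < 0 /\ st_v Ur * sigma ^+ 2 < beta ^+ 2 /\ (0 < st_B Ur < st_B Ul \/ st_B Ul < st_B Ur < 0)) ->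
  st_u Ur < st_u Ul.
Proof.
have vl : 0 < st_v Ul by []; have vr : 0 < st_v Ur by [].
move=> H; rewrite -subr_gt0 jump_u; move: H jump_B.
move: (st_v Ul) (st_v Ur) (st_B Ul) (st_B Ur) vl vr => x z b c vl vr H E.
have key (s2 b2 v w p q : R) : 0 < s2 -> 0 < v -> v * s2 < b2 -> 0 < p -> p < q ->
    s2 * (w * q - v * p) = b2 * (q - p) -> v < w.
  move=> s0 v0 h p0 pq E'; rewrite ltNge; apply/negP => wv.
  have i1 : s2 * (w * q) <= s2 * (v * q) by rewrite ler_pM2l// ler_pM2r// (lt_trans p0).
  have i2 : v * s2 * (q - p) < b2 * (q - p) by rewrite ltr_pM2r// subr_gt0.
  by move: i1 i2 E'; lra.
case: H => [[s0 [h B]]|[s0 [h B]]].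
  have s2 : 0 < sigma ^+ 2 by rewrite exprn_gt0.
  rewrite mulr_gt0// subr_gt0.
  case: B => /andP[h1 h2]; first exact: (key (sigma ^+ 2) (beta ^+ 2) x z b c).
  by apply: (key (sigma ^+ 2) (beta ^+ 2) x z (- b) (- c)); move: h1 h2 E; lra.
have s2 : 0 < sigma ^+ 2 by rewrite -sqrrN exprn_gt0// oppr_gt0.
rewrite nmulr_rgt0// subr_lt0.
case: B => /andP[h1 h2].
  by apply: (key (sigma ^+ 2) (beta ^+ 2) z x c b) => //; move: E; lra.
by apply: (key (sigma ^+ 2) (beta ^+ 2) z x (- c) (- b)); move: h h1 h2 E; lra.
Qed.

Lemma slow_shock_not_a_contraction (a : R) :
  Qflux beta gamma Ur - Qflux beta gamma Ul <= sigma * (eta gamma Ur - eta gamma Ul) ->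
  st_u Ur < st_u Ul -> st_B Ul != 0 -> st_B Ur != 0 ->
  - Num.sqrt (alpha beta gamma true Ul) < sigma < Num.sqrt (alpha beta gamma true Ur) ->
  0 < a -> ~ a_contraction beta gamma Ul Ur sigma a.
Proof.
move=> ent uu Bl Br /andP[sl sr] a0; have [a1|/ltW a1] := leP a 1.
  exact: not_a_contraction_left.
exact: not_a_contraction_right.
Qed.

End lax_shocks.

Lemma lt_sqrt_sqr {R : realType} (t x : R) : 0 <= t -> t < Num.sqrt x -> t ^+ 2 < x.
Proof.
move=> t0 h; have x0 : 0 < x by rewrite -sqrtr_gt0 (le_lt_trans t0).
by rewrite -[X in _ < X](@sqr_sqrtr _ x) ?(ltW x0)// ltr_pXn2r// nnegrE sqrtr_ge0.
Qed.

Theorem theorem5p2 (R : realType) (beta gamma : R) :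
  beta != 0 -> 1 < gamma ->
  (forall (Ul Ur : state R) (sigma2 : R),
     shock_wave beta gamma 2 Ul Ur sigma2 ->
     (0 < st_B Ur < st_B Ul \/ st_B Ul < st_B Ur < 0) ->
     ~ (exists a : R, 0 < a /\ a_contraction beta gamma Ul Ur sigma2 a))
  /\
  (forall (Ult Urt : state R) (sigma3 : R),
     shock_wave beta gamma 3 Ult Urt sigma3 ->
     (0 < st_B Ult < st_B Urt \/ st_B Urt < st_B Ult < 0) ->
     ~ (exists a : R, 0 < a /\ a_contraction beta gamma Ult Urt sigma3 a)).
Proof.
move=> b0 g1.
have neq (x y : R) : 0 < x < y \/ y < x < 0 -> x != 0 /\ y != 0.
  move=> [|] /andP[h1 h2]; first by rewrite !gt_eqF// (lt_trans h1).
  by rewrite !lt_eqF// (lt_trans h1).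
have small (U : state R) (t : R) : admissible U -> 0 <= t ->
    t < Num.sqrt (alpha beta gamma false U) -> st_v U * t ^+ 2 < beta ^+ 2.
  move=> aU t0 /(lt_sqrt_sqr t0) h; rewrite mulrC -ltr_pdivlMr//.
  exact: lt_le_trans h (alpha_false_le beta g1 aU).
(* The Lax condition bounds [|sigma|] by the slow speed at [Ur] for a 2-shock and at [Ul] for a
   3-shock: in both cases the state with the smaller |B|, as [slow_shock_compressive] requires. The
   neighbouring fast family gives one strict bound on [sigma], its sign the other. *)
split=> Ul Ur s [[al ar] _ RH ent [_ /andP[sr sl] s1 s4]] B [a [a0 ac]].
- have /= {}s1 := s1 isT; rewrite /= in sr sl.
  have s0 : s < 0 by apply: lt_le_trans sl _; rewrite oppr_le0 sqrtr_ge0.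
  have [Br Bl] := neq _ _ B.
  apply: (slow_shock_not_a_contraction g1 al ar RH ent _ Bl Br _ a0 ac).
    apply: (slow_shock_compressive al ar RH); right; split => //; split => //.
    by rewrite -sqrrN; apply: small => //; rewrite ?oppr_ge0 ?ltW// ltrNl.
  by rewrite s1 (lt_le_trans s0)// sqrtr_ge0.
- have /= {}s4 := s4 isT; rewrite /= in sr sl.
  have s0 : 0 < s by apply: le_lt_trans sr; rewrite sqrtr_ge0.
  have [Bl Br] := neq _ _ B.
  apply: (slow_shock_not_a_contraction g1 al ar RH ent _ Bl Br _ a0 ac).
    apply: (slow_shock_compressive al ar RH); left; split => //; split => //.
    by apply: small => //; exact: ltW.
  by rewrite s4 andbT (le_lt_trans _ s0)// oppr_le0 sqrtr_ge0.
Qed.
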